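(* Let $(M,\mathsf c)$ be a selfdual conformal $4$-manifold with a selfdual affine conformal submersion $\pi\colon M\to B$ over an Einstein-Weyl space $(B,\mathsf c_B,D^B)$ (with $D^B$ the induced Weyl derivative $D^0+\omega$). Then with respect to an arbitrary affine coordinate $t$ on $M\to B$, the conformal structure on $M$ is $$\mathsf c=\pi^*\mathsf c_B+(tw_1+w_0)^{-2}(dt+tA_1+A_0)^2,$$ where $$*_BD^Bw_1=dA_1\quad\text{and}\quad *_B(D^Bw_0+A_1w_0-A_0w_1)=dA_0+A_1\wedge A_0$$ for some $w_0,w_1\in C^\infty(B,L_B^{-1})$ and $A_0,A_1\in C^\infty(B,T^*B)$. Conversely, for any solution $(w_0,w_1,A_0,A_1)$ of the affine monopole equations $*_BD^Bw_1=dA_1$ and $*_B(D^Bw_0+A_1w_0-A_0w_1)=dA_0+A_1\wedge A_0$ on an Einstein-Weyl space $(B,\mathsf c_B,D^B)$ of dimension $3$, the conformal structure $\mathsf c=\pi^*\mathsf c_B+(tw_1+w_0)^{-2}(dt+tA_1+A_0)^2$ is selfdual, and the projection $\pi$, with horizontal bundle $\mathcal H=\ker(dt+tA_1+A_0)$ and relative length scale $w=tw_1+w_0$, defines a selfdual affine conformal submersion over $B$.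
   Context: Everything is smooth and local; in the formula $M$ is (locally) an open subset of $B\times\mathbb R$ with $\pi$ the projection, on which $w=tw_1+w_0>0$. On an $n$-manifold $M$, $L^w$ denotes the oriented real line bundle of densities of weight $w$, associated to the frame bundle by $A\mapsto|\det A|^{w/n}$; $L=L^1$. A conformal structure $\mathsf c$ is a (unit determinant) metric on $L^{-1}TM$, i.e. an $L^2$-valued inner product $\langle\cdot,\cdot\rangle$ on $TM$; it identifies vectors and $1$-forms of the same weight. A Weyl derivative $D$ is a covariant derivative on $L$ (hence on every $L^w$), with curvature $2$-form $F^D$; on a conformal manifold it determines a unique torsion-free connection $D$ on $TM$ with $D\mathsf c=0$. $D$ is Einstein-Weyl if the symmetric tracefree part of its Ricci tensor vanishes. A conformal submersion with oriented one dimensional fibres is a surjective submersion $\pi\colon M\to B$ of conformal manifolds with $d\pi_x$ restricted to $\mathcal H_x=\mathcal V_x^\perp$ a nonzero conformal map, $\mathcal V=\ker d\pi$. Let $\xi\in L^{-1}\mathcal V$ be the weightless positive unit vertical vector field (also viewed as a weightless $1$-form); $L\cong\mathcal V$ via $\xi$ and $L\cong\pi^*L_B$ via $\mathcal H\cong\pi^*TB$; the composite positive isomorphism $\pi^*L_B\to\mathcal V$ is called the relative length scale. In a fibre coordinate $t$, it is a section $w$ of $\pi^*L_B^{-1}$, $\mathcal H=\ker(dt+A)$ with $A$ a section of $\pi^*T^*B$, and $\mathsf c=\pi^*\mathsf c_B+w^{-2}(dt+A)^2$. The minimal Weyl derivative $D^0$ is the unique Weyl derivative with $D^0_\xi\xi=0$,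 $\mathrm{tr}\,D^0\xi=0$; $F^0$ is its Faraday curvature. An affine structure on $\pi$ is a flat torsion-free connection on each fibre. $\mathcal H$ is affine if for every vector field $X$ on $B$ with horizontal lift $\tilde X$, the map $U\mapsto[\tilde X,U]$ preserves the vertical vector fields which are parallel on each fibre. The relative length scale is affine if it maps sections of $L_B$ (pulled back) to vertical vector fields which are affine on each fibre. The conformal submersion is affine if there is an affine structure for which both $\mathcal H$ and the relative length scale are affine; an affine coordinate is a fibre coordinate $t$ affine on each fibre. For $M$ oriented of dimension $4$ the star operator on weighted forms satisfies $\iota_X{*\alpha}=*(\langle X,\cdot\rangle\wedge\alpha)$ with $*1$ the orientation; $*^2=1$ on $2$-forms. The same convention is used for $*_B$ on $B$ (so $*_B^2=-1$), and $*1=*_B1\wedge\xi$. $\mathsf c$ is selfdual if the antiselfdual part of its Weyl curvature vanishes. With $\omega=-( *d^D\xi)(\xi,\cdot)$ (independent of $D$), $\xi$ is selfdual if $F^0$ is selfdual; then $D^0+\omega$ is the pullback of a Weyl derivative $D^B$ on $B$. *)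

(* Defs.v *)
From mathcomp Require Import all_boot all_order all_algebra.
From mathcomp Require Import boolp classical_sets functions reals.
From mathcomp Require Import topology normedtype derive.

Set Implicit Arguments.
Unset Strict Implicit.
Unset Printing Implicit Defensive.

Import Order.TTheory GRing.Theory Num.Theory.
Import numFieldNormedType.Exports.

Local Open Scope classical_set_scope.
Local Open Scope ring_scope.

(* Local differential geometry on open subsets U of R^n, oriented by the order
   of the coordinates.  Vector fields and 1-forms are maps 'rV_n -> 'rV_n,
   bilinear forms and 2-forms are maps 'rV_n -> 'M_n; all are only meaningful
   on U.

   Densities are written in a gauge: a nowhere vanishing positive section l of
   the density bundle L over U turns sections of L^k into functions
   (f stands for f l^k).  In particular
   - a conformal structure c (an L^2-valued inner product) is given by the
     metric g with c = g l^2, so that l may be any gauge, g any representative;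
   - a Weyl derivative D is given by the 1-form a with D l = a l.
   Gauges l on the total space M and l_B on the base B are chosen independently
   of each other, see conformal_submersion. *)

Section Calculus.
Context {R : realType} {n : nat}.
Implicit Types (U : set 'rV[R]_n) (f : 'rV[R]_n -> R).

Definition pd (i : 'I_n) f : 'rV[R]_n -> R := fun x => 'D_(delta_mx 0 i) f x.

Definition dfun f (x : 'rV[R]_n) : 'rV[R]_n := \row_i pd i f x.

(* C^infinity: every iterated partial derivative exists and is continuous. *)
Definition smooth U f : Prop :=
  forall (s : seq 'I_n) x, U x ->
    {for x, continuous (foldr pd f s)} /\
    forall i, derivable (foldr pd f s) x (delta_mx 0 i).

Definition smooth_rV U (a : 'rV[R]_n -> 'rV[R]_n) : Prop :=
  forall i, smooth U (fun x => a x 0 i).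

Definition smooth_mx U (g : 'rV[R]_n -> 'M[R]_n) : Prop :=
  forall i j, smooth U (fun x => g x i j).

Definition wedge (a b : 'rV[R]_n) : 'M[R]_n := a^T *m b - b^T *m a.

Definition ext_d (a : 'rV[R]_n -> 'rV[R]_n) (x : 'rV[R]_n) : 'M[R]_n :=
  \matrix_(i, j) (pd i (fun y => a y 0 j) x - pd j (fun y => a y 0 i) x).

Definition bracket (X Y : 'rV[R]_n -> 'rV[R]_n) (x : 'rV[R]_n) : 'rV[R]_n :=
  \row_k \sum_i (X x 0 i * pd i (fun y => Y y 0 k) x
               - Y x 0 i * pd i (fun y => X y 0 k) x).

End Calculus.

Section Conformal.
Context {R : realType} {n : nat}.
Implicit Types (U : set 'rV[R]_n) (g : 'rV[R]_n -> 'M[R]_n)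
  (a : 'rV[R]_n -> 'rV[R]_n) (x : 'rV[R]_n).

Definition ip (G : 'M[R]_n) (X Y : 'rV[R]_n) : R := (X *m G *m Y^T) 0 0.

Definition conformal_manifold U g : Prop :=
  [/\ open U, smooth_mx U g &
      forall x, U x ->
        (g x)^T = g x /\ forall v, v != 0 -> 0 < ip (g x) v v].

(* The component at (i, j, k) of the derivative of c = g l^2 with respect to D
   acting on L^2 and to the flat connection of the chart acting on TU. *)
Definition dmetric g a x (i j k : 'I_n) : R :=
  pd i (fun y => g y j k) x + 2 * a x 0 i * g x j k.

(* Koszul formula for the torsion-free connection on TU with D c = 0:
   D_(e_i) e_j = \sum_k (christoffel g a x k i j) e_k.
   For a = 0 it is the Levi-Civita connection of g. *)
Definition christoffel g a x (k i j : 'I_n) : R :=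
  2^-1 * \sum_l invmx (g x) k l *
           (dmetric g a x i j l + dmetric g a x j i l - dmetric g a x l i j).

(* R(e_i, e_j) e_k = \sum_l (curvature g a x l k i j) e_l *)
Definition curvature g a x (l k i j : 'I_n) : R :=
  pd i (fun y => christoffel g a y l j k) x
  - pd j (fun y => christoffel g a y l i k) x
  + \sum_m (christoffel g a x l i m * christoffel g a x m j k
          - christoffel g a x l j m * christoffel g a x m i k).

(* Ric(Y, Z) is the trace of X |-> R(X, Y) Z; it need not be symmetric. *)
Definition ricci g a x : 'M[R]_n :=
  \matrix_(j, k) \sum_i curvature g a x i k i j.

Definition sym_tracefree (G S : 'M[R]_n) : 'M[R]_n :=
  let S' := 2^-1 *: (S + S^T) in
  S' - (\tr (invmx G *m S') / n%:R) *: G.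

Definition einstein_weyl U g a : Prop :=
  forall x, U x -> sym_tracefree (g x) (ricci g a x) = 0.

(* Schouten tensor of g, and the Weyl tensor with all indices lowered:
   weyl g x l k i j = g(W(e_i, e_j) e_k, e_l). *)
Definition schouten g x : 'M[R]_n :=
  let Ric := ricci g (fun=> 0) x in
  (n%:R - 2)^-1 *:
    (Ric - (\tr (invmx (g x) *m Ric) / (2 * (n%:R - 1))) *: g x).

Definition weyl g x (l k i j : 'I_n) : R :=
  let P := schouten g x in
  \sum_m g x l m * curvature g (fun=> 0) x m k i j
  - (g x i l * P j k + g x j k * P i l - g x i k * P j l - g x j l * P i k).

(* D acting on a section w of L^-1. *)
Definition weylD_Lm1 a (w : 'rV[R]_n -> R) x : 'rV[R]_n :=
  dfun w x - w x *: a x.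

(* D acting on a weightless vector field X, a section of L^-1 TU; row i is
   D_(e_i) X. *)
Definition weylD_vec0 g a (X : 'rV[R]_n -> 'rV[R]_n) x : 'M[R]_n :=
  \matrix_(i, k) (pd i (fun y => X y 0 k) x
    + \sum_j christoffel g a x k i j * X x 0 j - a x 0 i * X x 0 k).

(* d^D acting on an L-valued 1-form. *)
Definition weyl_ext_d a (b : 'rV[R]_n -> 'rV[R]_n) x : 'M[R]_n :=
  ext_d b x + wedge (a x) (b x).

(* Volume form of G, evaluated on the vectors of the list Xs. *)
Definition vol (G : 'M[R]_n) (Xs : seq 'rV[R]_n) : R :=
  Num.sqrt (\det G) * \det (\matrix_(r < n) nth 0 Xs r).

End Conformal.

(* Iterating i_X * b = * (<X, .> /\ b) from * 1 = vol gives
   ( * a)(Y, Z) = vol(a#, Y, Z) for a 1-form in dimension 3 and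
   ( * (a /\ b))(Y, Z) = vol(b#, a#, Y, Z) in dimension 4.  The latter is
   opposite to the usual Hodge star on 2-forms: * e12 = - e34. *)
Definition star1 (R : realType) (G : 'M[R]_3) (a : 'rV[R]_3) : 'M[R]_3 :=
  \matrix_(k, l) vol G [:: a *m invmx G; delta_mx 0 k; delta_mx 0 l].

Definition star2 (R : realType) (G b : 'M[R]_(3 + 1)) : 'M[R]_(3 + 1) :=
  \matrix_(k, l) (2^-1 * \sum_i \sum_j (invmx G *m b *m (invmx G)^T) i j *
    vol G [:: delta_mx 0 j; delta_mx 0 i; delta_mx 0 k; delta_mx 0 l]).

Definition asd_part (R : realType) (G b : 'M[R]_(3 + 1)) : 'M[R]_(3 + 1) :=
  2^-1 *: (b - star2 G b).

Definition selfdual_conformal (R : realType) (M : set 'rV[R]_(3 + 1))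
    (g : 'rV[R]_(3 + 1) -> 'M[R]_(3 + 1)) : Prop :=
  forall x, M x -> forall l k, asd_part (g x) (\matrix_(i, j) weyl g x l k i j) = 0.

(* The submersion is pi = lsubmx : M -> B, the restriction to an open subset M
   of R^3 x R of the projection onto R^3; it is linear, so d pi = lsubmx too.
   The fibres are oriented by increasing last coordinate s = x 0 fib. *)
Section Submersion.
Context {R : realType}.
Implicit Types (M : set 'rV[R]_(3 + 1)) (B : set 'rV[R]_3)
  (g : 'rV[R]_(3 + 1) -> 'M[R]_(3 + 1)) (gB : 'rV[R]_3 -> 'M[R]_3)
  (x : 'rV[R]_(3 + 1)).

Definition fib : 'I_(3 + 1) := rshift 3 ord0.

Definition d_fib : 'rV[R]_(3 + 1) := delta_mx 0 fib.

Definition pullback (a : 'rV[R]_3 -> 'rV[R]_3) x : 'rV[R]_(3 + 1) :=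
  row_mx (a (lsubmx x)) 0.

Definition pullback_metric gB x : 'M[R]_(3 + 1) :=
  block_mx (gB (lsubmx x)) 0 0 0.

Definition horizontal g x (X : 'rV[R]_(3 + 1)) : Prop :=
  forall V : 'rV[R]_(3 + 1), lsubmx V = 0 :> 'rV[R]_3 -> ip (g x) V X = 0.

(* lam compares the gauges: c = g l^2 and pi^* c_B = (pi^* gB) l_B^2 agree on
   the horizontal bundle, so pi^* l_B = lam l under L = pi^* L_B. *)
Definition conformal_submersion M B g gB (lam : 'rV[R]_(3 + 1) -> R) : Prop :=
  [/\ conformal_manifold M g, conformal_manifold B gB,
      [set (lsubmx x : 'rV[R]_3) | x in M] = B, smooth M lam &
      forall x, M x -> 0 < lam x /\
        forall X Y, horizontal g x X -> horizontal g x Y ->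
          ip (g x) X Y =
          lam x ^+ 2 * ip (gB (lsubmx x)) (lsubmx X) (lsubmx Y)].

(* xi, as a section of L^-1 TM and as an L-valued 1-form. *)
Definition xi g x : 'rV[R]_(3 + 1) := (Num.sqrt (g x fib fib))^-1 *: d_fib.

Definition xi_form g x : 'rV[R]_(3 + 1) := xi g x *m g x.

(* a0 represents the minimal Weyl derivative D^0. *)
Definition minimal_weyl M g (a0 : 'rV[R]_(3 + 1) -> 'rV[R]_(3 + 1)) : Prop :=
  smooth_rV M a0 /\
  forall x, M x -> xi g x *m weylD_vec0 g a0 (xi g) x = 0 /\
                   \tr (weylD_vec0 g a0 (xi g) x) = 0.

(* omega = - ( * d^D xi)(xi, .) *)
Definition omega g (a : 'rV[R]_(3 + 1) -> 'rV[R]_(3 + 1)) x :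
    'rV[R]_(3 + 1) :=
  - (xi g x *m star2 (g x) (weyl_ext_d a (xi_form g) x)).

Definition selfdual_submersion M g : Prop :=
  exists2 a0, minimal_weyl M g a0 &
    forall x, M x -> star2 (g x) (ext_d a0 x) = ext_d a0 x.

(* D^0 + omega is the pullback of the Weyl derivative D^B given by aB.  The
   gauge change to pi^* l_B = lam l adds d lam / lam to a0 + omega. *)
Definition induced_weyl M g (lam : 'rV[R]_(3 + 1) -> R)
    (aB : 'rV[R]_3 -> 'rV[R]_3) : Prop :=
  exists2 a0, minimal_weyl M g a0 &
    forall x, M x ->
      a0 x + omega g a0 x + (lam x)^-1 *: dfun lam x = pullback aB x.

(* The relative length scale pi^* L_B -> V sends f l_B to the vertical vector
   field (f o pi) (rel_scale g lam) d/ds. *)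
Definition rel_scale g (lam : 'rV[R]_(3 + 1) -> R) x : R :=
  lam x / Num.sqrt (g x fib fib).

(* A (smooth) family of connections on the fibres is a function gam, with
   nabla_(d/ds) (d/ds) = gam d/ds; in dimension one all are flat and
   torsion-free.  A vertical field u d/ds is parallel if nabla u = 0, and
   affine if the endomorphism nabla u is parallel. *)
Definition fibre_nabla (gam u : 'rV[R]_(3 + 1) -> R) x : R :=
  pd fib u x + gam x * u x.

Definition fibre_parallel M (gam u : 'rV[R]_(3 + 1) -> R) : Prop :=
  forall x, M x -> fibre_nabla gam u x = 0.

Definition fibre_affine_field M (gam u : 'rV[R]_(3 + 1) -> R) : Prop :=
  forall x, M x -> pd fib (fibre_nabla gam u) x = 0.

(* An oriented fibre coordinate t with nabla dt = 0 on each fibre. *)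
Definition affine_coordinate M (gam t : 'rV[R]_(3 + 1) -> R) : Prop :=
  smooth M t /\
  forall x, M x -> 0 < pd fib t x /\
                   pd fib (pd fib t) x - gam x * pd fib t x = 0.

Definition affine_horizontal M B g (gam : 'rV[R]_(3 + 1) -> R) : Prop :=
  forall (X : 'rV[R]_3 -> 'rV[R]_3) (Xt : 'rV[R]_(3 + 1) -> 'rV[R]_(3 + 1)),
    smooth_rV B X ->
    (forall x, M x -> lsubmx (Xt x) = X (lsubmx x) /\ horizontal g x (Xt x)) ->
    forall u : 'rV[R]_(3 + 1) -> R, smooth M u -> fibre_parallel M gam u ->
      let Z := bracket Xt (fun x => u x *: d_fib) in
      (forall x, M x -> lsubmx (Z x) = 0 :> 'rV[R]_3) /\
      fibre_parallel M gam (fun x => Z x 0 fib).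

Definition affine_scale M B g (lam gam : 'rV[R]_(3 + 1) -> R) : Prop :=
  forall f : 'rV[R]_3 -> R, smooth B f ->
    fibre_affine_field M gam (fun x => f (lsubmx x) * rel_scale g lam x).

(* The conformal submersion is affine with respect to gam. *)
Definition affine_submersion M B g (lam gam : 'rV[R]_(3 + 1) -> R) : Prop :=
  [/\ smooth M gam, affine_horizontal M B g gam & affine_scale M B g lam gam].

(* The 1-form dt + t A1 + A0 and pi^* gB + (t w1 + w0)^-2 (dt + t A1 + A0)^2. *)
Definition affine_form (A0 A1 : 'rV[R]_3 -> 'rV[R]_3)
    (t : 'rV[R]_(3 + 1) -> R) x : 'rV[R]_(3 + 1) :=
  dfun t x + t x *: pullback A1 x + pullback A0 x.

Definition affine_weight (w0 w1 : 'rV[R]_3 -> R) (t : 'rV[R]_(3 + 1) -> R)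
    x : R :=
  t x * w1 (lsubmx x) + w0 (lsubmx x).

Definition affine_metric gB (w0 w1 : 'rV[R]_3 -> R)
    (A0 A1 : 'rV[R]_3 -> 'rV[R]_3) (t : 'rV[R]_(3 + 1) -> R) x :
    'M[R]_(3 + 1) :=
  pullback_metric gB x + (affine_weight w0 w1 t x) ^- 2 *:
    ((affine_form A0 A1 t x)^T *m affine_form A0 A1 t x).

(* w0, w1 are sections of L_B^-1, written in the gauge l_B. *)
Definition affine_monopole B gB (aB : 'rV[R]_3 -> 'rV[R]_3)
    (w0 w1 : 'rV[R]_3 -> R) (A0 A1 : 'rV[R]_3 -> 'rV[R]_3) : Prop :=
  [/\ smooth B w0, smooth B w1, smooth_rV B A0, smooth_rV B A1 &
   forall b, B b ->
     star1 (gB b) (weylD_Lm1 aB w1 b) = ext_d A1 b /\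
     star1 (gB b) (weylD_Lm1 aB w0 b + w0 b *: A1 b - w1 b *: A0 b)
       = ext_d A0 b + wedge (A1 b) (A0 b)].

End Submersion.

(* Main.v *)
Require Import Defs.
From mathcomp Require Import all_boot all_order all_algebra.
From mathcomp Require Import boolp classical_sets functions reals.
From mathcomp Require Import topology normedtype derive realfun.
From mathcomp Require Import perm ring lra.
Set Implicit Arguments.
Unset Strict Implicit.
Unset Printing Implicit Defensive.
Import Order.TTheory GRing.Theory Num.Theory.
Import numFieldNormedType.Exports.
Local Open Scope classical_set_scope.
Local Open Scope ring_scope.

(** A conformal submersion onto B with one-dimensional fibres has a metric
    lam^2 gB + rho^-2 (ds + theta)^2 in the coordinates (b, s), see
    [submersion_adapted]. For such a metric the Koszul formula gives the minimal
    Weyl derivative explicitly, [minimal_weylP], and the condition that D^0 + omega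
    is the pullback of a Weyl derivative h on B becomes one equation between
    2-forms on the horizontal bundle, [induced_weylP]: the star of
    scale_form - rho lam h is the curvature of the horizontal distribution.

    From submersions to monopoles: in an affine coordinate t the length scale and
    the connection form are polynomials of degree one in t. Their coefficients are
    constant along the fibres and descend to B because the fibres of N are
    connected. The equation of [induced_weylP] is then affine in t; a fibre of the
    open set N carries two values of t, so the two coefficients agree separately,
    and they are the two monopole equations ([monopole_direct]).

    From monopoles to submersions: read backwards, the same computation gives the
    induced Weyl derivative, and one more derivative along the fibres shows that
    F^0 is selfdual ([horizontal_faraday]). That the conformal structure is
    selfdual is proved with moving frames. Pull back a coframe e_1, e_2, e_3 of gB
    and put eta = w^-1 (dt + t A1 + A0). If al and p are the components of the
    Weyl 1-form of B and of w^-1 times the form whose star appears in the monopole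
    equations, then, by these equations ([ext_d_vcoform]),
      d eta = - sum_c (al_c + p_c) e_c /\ eta + sum_c p_c e_(c+1) /\ e_(c+2),
    while d e_c involves only al and the connection forms om of B.
    The Levi-Civita connection can be read off, [lc_conn]. Its antiselfdual part
    consists of the three forms - om_c + gam_c eta + (gam x e)_c, where
    gam = - (al + p / 2), and these are the connection forms of a bundle of rank
    three ([curvature_lc_conn]). In the curvature of this bundle the derivatives
    of om give minus the curvature of B, and all remaining antiselfdual components
    form a multiple of the identity plus a skew matrix ([asd_curv_sym]). The
    antiselfdual Weyl tensor is the symmetric tracefree part of this matrix
    ([frame_weyl_selfdual]), so it is, up to sign, the symmetric tracefree part of
    the curvature of B in dimension three, which vanishes by the Einstein-Weyl
    equation ([base_curv_frame_sym]). *)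

Local Notation pi := (@lsubmx _ 1 3 1).
Local Notation base i := (lshift 1 i).
Local Notation o0 := (@Ordinal 3 0 isT).
Local Notation o1 := (@Ordinal 3 1 isT).
Local Notation o2 := (@Ordinal 3 2 isT).

(** * Smooth functions *)

Section SmoothFunctions.
Context {R : realType} {n : nat}.
Implicit Types (U : set 'rV[R]_n) (f g : 'rV[R]_n -> R) (x : 'rV[R]_n).

Lemma pd_eq_on U f g i x : open U -> (forall y, U y -> f y = g y) -> U x ->
  pd i f x = pd i g x.
Proof.
move=> oU fg Ux; apply: near_eq_derive.
have : \near x, U x by exact: open_nbhs_nbhs.
by apply: filterS => y /fg.
Qed.

Lemma smooth_continuous U f x : smooth U f -> U x -> {for x, continuous f}.
Proof. by move=> fs Ux; case: (fs [::] x Ux). Qed.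

Lemma smooth_derivable U f x i : smooth U f -> U x ->
  derivable f x (delta_mx 0 i).
Proof. by move=> fs Ux; case: (fs [::] x Ux). Qed.

Lemma smooth_pd U f i : smooth U f -> smooth U (pd i f).
Proof. by move=> fs s x Ux; have := fs (rcons s i) x Ux; rewrite foldr_rcons. Qed.

Lemma smooth_subset U V f : V `<=` U -> smooth U f -> smooth V f.
Proof. by move=> VU fs s x /VU; exact: fs. Qed.

(** Finite order of differentiability is the induction variable in the closure
    properties: a partial derivative of a product, inverse or square root is
    an expression of the same kind in functions of one order less. *)
Fixpoint cont_diff (k : nat) U f : Prop :=
  (forall x, U x -> {for x, continuous f}) /\
  if k is k'.+1 then
    (forall x i, U x -> derivable f x (delta_mx 0 i)) /\
    forall i, cont_diff k' U (pd i f)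
  else True.

Lemma smoothP U f : smooth U f <-> forall k, cont_diff k U f.
Proof.
split=> [fs k|fs s].
  elim: k f fs => [|k IH] f fs; split; try by move=> x; exact: smooth_continuous.
    by [].
  by split=> [x i|i]; [exact: smooth_derivable|exact/IH/smooth_pd].
elim/last_ind: s f fs => [|s i IH] f fs x Ux.
  by have [fc [fd _]] := fs 1%N; split=> [|i]; [exact: fc|exact: fd].
rewrite foldr_rcons; apply: IH => // k.
have [_ [_ fp]] := fs k.+1; exact: fp.
Qed.

Lemma cont_diff_pred k U f : cont_diff k.+1 U f -> cont_diff k U f.
Proof.
elim: k f => [|k IH] f [fc [fd fp]]; split=> //; split=> // i.
exact/IH/fp.
Qed.

Lemma cont_diff_eq_on k U f g : open U -> (forall y, U y -> f y = g y) ->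
  cont_diff k U f -> cont_diff k U g.
Proof.
move=> oU.
have near_fg f' g' x : (forall y, U y -> f' y = g' y) -> U x ->
    \near x, f' x = g' x.
  move=> fg Ux; have : \near x, U x by exact: open_nbhs_nbhs.
  by apply: filterS => y /fg.
have cont_eq f' g' : (forall y, U y -> f' y = g' y) ->
    (forall x, U x -> {for x, continuous f'}) ->
    forall x, U x -> {for x, continuous g'}.
  move=> fg fc x Ux; have fcx := fc x Ux.
  rewrite /prop_for /continuous_at -(fg x Ux).
  exact: cvg_trans (near_eq_cvg (near_fg _ _ _ fg Ux)) fcx.
elim: k f g => [|k IH] f g fg [fc fS]; split=> //; try exact: cont_eq fg fc.
have [fd fp] := fS; split=> [x i Ux|i].
  exact: near_eq_derivable (near_fg _ _ _ fg Ux) (fd x i Ux).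
apply: (IH (pd i f)) (fp i) => y Uy; exact: pd_eq_on Uy.
Qed.

Lemma smooth_eq_on U f g : open U -> (forall y, U y -> f y = g y) ->
  smooth U f -> smooth U g.
Proof. by move=> oU fg /smoothP fs; apply/smoothP => k; exact: cont_diff_eq_on fg (fs k). Qed.

Lemma pd_cst c i x : pd i (fun=> c) x = 0.
Proof. exact: derive_cst. Qed.

Lemma smooth_cst U c : smooth U (fun=> c).
Proof.
apply/smoothP => k; elim: k c => [|k IH] c; split=> //; try by move=> x _; exact: cst_continuous.
split=> [x i _|i]; first exact: derivable_cst.
have -> : pd i (fun=> c) = (fun=> 0) by apply/funext => x; exact: pd_cst.
exact: IH.
Qed.

Lemma cont_diffD k U f g : open U -> cont_diff k U f -> cont_diff k U g ->
  cont_diff k U (fun x => f x + g x).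
Proof.
move=> oU; elim: k f g => [|k IH] f g [fc fS] [gc gS]; split=> //;
  try by move=> x Ux; apply: (cvgD (fc x Ux) (gc x Ux)).
have [[fd fp] [gd gp]] := (fS, gS); split=> [x i Ux|i].
  by apply: derivableD; auto.
apply: cont_diff_eq_on (IH _ _ (fp i) (gp i)) => // y Uy.
by rewrite [RHS]deriveD; auto.
Qed.

Lemma cont_diffM k U f g : open U -> cont_diff k U f -> cont_diff k U g ->
  cont_diff k U (fun x => f x * g x).
Proof.
move=> oU; elim: k f g => [|k IH] f g fS gS; have [fc fS'] := fS;
  have [gc gS'] := gS; split=> //;
  try by move=> x Ux; apply: (cvgM (fc x Ux) (gc x Ux)).
have [[fd fp] [gd gp]] := (fS', gS'); split=> [x i Ux|i].
  by apply: derivableM; auto.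
apply: cont_diff_eq_on
  (cont_diffD oU (IH _ _ (cont_diff_pred fS) (gp i))
                 (IH _ _ (cont_diff_pred gS) (fp i))) => // y Uy.
by rewrite [RHS]deriveM; auto.
Qed.

Lemma smoothD U f g : open U -> smooth U f -> smooth U g ->
  smooth U (fun x => f x + g x).
Proof. by move=> oU /smoothP fs /smoothP gs; apply/smoothP => k; apply: cont_diffD. Qed.

Lemma smoothM U f g : open U -> smooth U f -> smooth U g ->
  smooth U (fun x => f x * g x).
Proof. by move=> oU /smoothP fs /smoothP gs; apply/smoothP => k; apply: cont_diffM. Qed.

Lemma smoothN U f : open U -> smooth U f -> smooth U (fun x => - f x).
Proof.
move=> oU fs; have := smoothM oU (smooth_cst (U:=U) (-1)) fs.
by apply: smooth_eq_on => // y _; rewrite mulN1r.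
Qed.

Lemma smoothB U f g : open U -> smooth U f -> smooth U g ->
  smooth U (fun x => f x - g x).
Proof. by move=> oU fs gs; exact: smoothD oU fs (smoothN oU gs). Qed.

Lemma smooth_sum (I : Type) (r : seq I) (P : pred I) (F : I -> 'rV[R]_n -> R) U :
  open U -> (forall i, P i -> smooth U (F i)) ->
  smooth U (fun x => \sum_(i <- r | P i) F i x).
Proof.
move=> oU Fs; elim: r => [|i r IH].
  by apply: smooth_eq_on (smooth_cst (U:=U) 0) => // y _; rewrite big_nil.
case Pi : (P i); last by apply: smooth_eq_on IH => // y _; rewrite big_cons Pi.
by apply: smooth_eq_on (smoothD oU (Fs i Pi) IH) => // y _; rewrite big_cons Pi.
Qed.

Lemma smoothV U f : open U -> (forall x, U x -> f x != 0) -> smooth U f ->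
  smooth U (fun x => (f x)^-1).
Proof.
move=> oU f0 fs; apply/smoothP; elim=> [|k IH]; split=> //;
  try by move=> x Ux; apply: (cvgV (f0 x Ux) (smooth_continuous fs Ux)).
split=> [x i Ux|i].
  by apply: derivableV; [exact: f0|exact: smooth_derivable fs Ux].
have /smoothP/(_ k) fp : smooth U (fun x => - pd i f x).
  exact/smoothN/smooth_pd.
apply: cont_diff_eq_on (cont_diffM oU fp (cont_diffM oU IH IH)) => // y Uy.
rewrite [RHS]deriveV; [|exact: f0|exact: smooth_derivable fs Uy].
by rewrite /GRing.scale /= expr2 invfM /pd; ring.
Qed.

Lemma pdD U f g i x : smooth U f -> smooth U g -> U x ->
  pd i (fun y => f y + g y) x = pd i f x + pd i g x.
Proof.
by move=> fs gs Ux; apply: deriveD; [exact: smooth_derivable fs Ux|exact: smooth_derivable gs Ux].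
Qed.

Lemma pdM U f g i x : smooth U f -> smooth U g -> U x ->
  pd i (fun y => f y * g y) x = pd i f x * g x + f x * pd i g x.
Proof.
move=> fs gs Ux; rewrite /pd deriveM; [|exact: smooth_derivable fs Ux|exact: smooth_derivable gs Ux].
by rewrite /GRing.scale /= addrC [g x * _]mulrC.
Qed.

Lemma pdN U f i x : smooth U f -> U x -> pd i (fun y => - f y) x = - pd i f x.
Proof. by move=> fs Ux; apply: deriveN; exact: smooth_derivable fs Ux. Qed.

Lemma pdB U f g i x : smooth U f -> smooth U g -> U x ->
  pd i (fun y => f y - g y) x = pd i f x - pd i g x.
Proof.
by move=> fs gs Ux; apply: deriveB; [exact: smooth_derivable fs Ux|exact: smooth_derivable gs Ux].
Qed.

Lemma pdV U f i x : f x != 0 -> smooth U f -> U x ->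
  pd i (fun y => (f y)^-1) x = - pd i f x / f x ^+ 2.
Proof.
move=> f0 fs Ux; rewrite /pd deriveV //; last exact: smooth_derivable fs Ux.
by rewrite /GRing.scale /= mulrC mulrN mulNr.
Qed.

Lemma pd_sum (I : Type) (r : seq I) (P : pred I) (F : I -> 'rV[R]_n -> R) U i x :
  open U -> (forall j, P j -> smooth U (F j)) -> U x ->
  pd i (fun y => \sum_(j <- r | P j) F j y) x = \sum_(j <- r | P j) pd i (F j) x.
Proof.
move=> oU Fs Ux; elim: r => [|j r IH].
  rewrite big_nil -[RHS](pd_cst 0 i x) /pd; congr ('D__ _ x).
  by apply/funext => y; rewrite big_nil.
rewrite big_cons; case: ifP => Pj.
  rewrite -IH -(pdD i (Fs j Pj) (smooth_sum r oU Fs) Ux) /pd; congr ('D__ _ x).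
  by apply/funext => y; rewrite big_cons Pj.
by rewrite -IH /pd; congr ('D__ _ x); apply/funext => y; rewrite big_cons Pj.
Qed.

End SmoothFunctions.

(** * Symmetry of mixed partial derivatives *)

Section AlongLines.
Context {R : realType} {n : nat}.
Implicit Types (U : set 'rV[R]_n) (f : 'rV[R]_n -> R) (x e : 'rV[R]_n).

Lemma is_derive_line f x e s : derivable f (x + s *: e) e ->
  is_derive s 1 (fun u : R => f (x + u *: e)) ('D_e f (x + s *: e)).
Proof.
have quot : (fun h : R => h^-1 *: (((fun u : R => f (x + u *: e)) \o shift s) (h *: 1)
      - f (x + s *: e)))
    = (fun h => h^-1 *: ((f \o shift (x + s *: e)) (h *: e) - f (x + s *: e))).
  apply/funext => h /=; congr (_ *: (f _ - _)).
  by rewrite scalerDl /GRing.scale /= mulr1 addrCA addrC.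
move=> df; apply: DeriveDef; first by rewrite /derivable quot.
by rewrite /derive quot.
Qed.

Lemma MVT_line f x e h : 0 < h ->
  (forall s, 0 <= s <= h -> derivable f (x + s *: e) e) ->
  exists2 s, 0 <= s <= h & f (x + h *: e) - f x = 'D_e f (x + s *: e) * h.
Proof.
move=> h0 df.
have dline s : 0 <= s <= h -> is_derive s 1 (fun u : R => f (x + u *: e))
    ('D_e f (x + s *: e)) by move=> /df; exact: is_derive_line.
have [|||s sh] := @MVT_segment R (fun u : R => f (x + u *: e))
   (fun s => 'D_e f (x + s *: e)) 0 h.
- exact: ltW.
- by move=> s; rewrite in_itv /= => /andP[s0 sh]; apply: dline; rewrite !ltW.
- apply: derivable_within_continuous => s; rewrite in_itv /= => sh.
  by have [] := dline s sh.
rewrite scale0r addr0 subr0 => E; exists s => //.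
Qed.

Lemma smooth_sqrt U f : open U -> (forall x, U x -> 0 < f x) -> smooth U f ->
  smooth U (fun x => Num.sqrt (f x)).
Proof.
move=> oU f0 fs.
have dsqrt x e : U x -> derivable f x e ->
    is_derive x e (fun y => Num.sqrt (f y)) ('D_e f x * (2 * Num.sqrt (f x))^-1).
  move=> Ux df.
  have quot (g : 'rV[R]_n -> R) : (fun h : R => h^-1 *: ((g \o shift x) (h *: e) - g x))
      = (fun h => h^-1 *: (((fun u : R => g (x + u *: e)) \o shift 0) (h *: 1)
            - g (x + 0 *: e))).
    apply/funext => h /=; rewrite scale0r !addr0 [x + _]addrC.
    by rewrite [h *: 1]mulr1.
  have df0 : derivable f (x + 0 *: e) e by rewrite scale0r addr0.
  have [dl Dl] := is_derive_line df0.
  have sq0 : is_derive (f (x + 0 *: e)) 1 Num.sqrt (2 * Num.sqrt (f (x + 0 *: e)))^-1.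
    by apply: is_derive1_sqrt; rewrite scale0r addr0; exact: f0.
  have [ds Ds] := sq0.
  have dc : derivable (Num.sqrt \o (fun u : R => f (x + u *: e))) 0 1.
    have /derivable1_diffP dl' := dl; have /derivable1_diffP ds' := ds.
    apply/derivable1_diffP; exact: differentiable_comp dl' ds'.
  apply: DeriveDef.
    by rewrite /derivable quot; exact: dc.
  have E : 'D_1 (Num.sqrt \o (fun u : R => f (x + u *: e))) 0
      = 'D_e f x * (2 * Num.sqrt (f x))^-1.
    by rewrite -derive1E (derive1_comp dl ds) !derive1E Dl Ds scale0r addr0 mulrC.
  by rewrite /derive quot; exact: E.
have contS x : U x -> {for x, continuous (fun y => Num.sqrt (f y))}.
  move=> Ux; apply: (@continuous_comp _ _ _ f Num.sqrt).
    exact: smooth_continuous fs Ux.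
  exact: sqrt_continuous.
have [fsk Vsk] : smooth U f /\ smooth U (fun x => (2 * f x)^-1).
  split; first exact: fs.
  apply: (smoothV oU _ (smoothM oU (smooth_cst 2) fs)) => x Ux.
  by apply: lt0r_neq0; apply: mulr_gt0 (f0 x Ux); exact: (ltr0Sn _ 1).
apply/smoothP; elim=> [|k IH]; split=> //.
split=> [x i Ux|i].
  by have [] := dsqrt x _ Ux (@smooth_derivable _ _ _ _ _ i fs Ux).
have /smoothP/(_ k) fp : smooth U (fun x => pd i f x * (2 * f x)^-1).
  exact/smoothM/Vsk/smooth_pd.
apply: cont_diff_eq_on (cont_diffM oU fp IH) => // y Uy.
rewrite [RHS]/pd; have [_ ->] := dsqrt y _ Uy (@smooth_derivable _ _ _ _ _ i fs Uy).
rewrite -mulrA; congr (_ * _); have fy := f0 y Uy.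
have sy : Num.sqrt (f y) != 0 by rewrite gt_eqF // sqrtr_gt0.
by rewrite -{1}(sqr_sqrtr (ltW fy)); field.
Qed.

(** The second difference over a small square is the square of the side times
    the mixed derivative at a nearby point: the mean value theorem is applied
    along each of the two directions in turn. *)
Lemma second_difference U f i j x : open U -> smooth U f -> U x ->
  let ei := delta_mx 0 i : 'rV[R]_n in let ej := delta_mx 0 j : 'rV[R]_n in
  exists2 d, 0 < d & forall h, 0 < h -> h < d ->
    exists2 y, `|x - y| < h * (`|ei| + `|ej| + 1) &
      f (x + h *: ei + h *: ej) - f (x + h *: ei) - (f (x + h *: ej) - f x) =
      pd j (pd i f) y * (h * h).
Proof.
move=> oU fs Ux ei ej; set rad := `|ei| + `|ej| + 1.
have rad0 : 0 < rad by rewrite /rad; have := normr_ge0 ei; have := normr_ge0 ej; lra.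
have near0 h s t : 0 < h -> 0 <= s <= h -> 0 <= t <= h ->
    `|x - (x + s *: ei + t *: ej)| < h * rad.
  move=> h0 /andP[s0 sh] /andP[t0 th].
  rewrite -addrA opprD addrA subrr add0r normrN.
  apply: le_lt_trans (ler_normD _ _) _; rewrite !normrZ !ger0_norm // /rad.
  have := ler_wpM2r (normr_ge0 ei) sh; have := ler_wpM2r (normr_ge0 ej) th.
  lra.
have [d d0 dU] : exists2 d, 0 < d & forall y, `|x - y| < d -> U y.
  have /nbhs_ballP[d d0 dU] : nbhs x U by exact: open_nbhs_nbhs.
  exists d => // y xy; apply: dU; by rewrite -ball_normE.
exists (d / rad); first exact: divr_gt0.
move=> h h0; rewrite ltr_pdivlMr // => hd.
have Ust s t : 0 <= s <= h -> 0 <= t <= h -> U (x + s *: ei + t *: ej).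
  by move=> sh th; apply/dU/(lt_trans (near0 _ _ _ h0 sh th)).
have z0 : 0 <= (0 : R) <= h by rewrite lexx ltW.
have hh : 0 <= h <= h by rewrite lexx ltW.
have Us s : 0 <= s <= h -> U (x + s *: ei).
  by move=> sh; rewrite -[_ + _]addr0 -(scale0r ej); exact: Ust.
(* The second difference of f is the difference of phi at two points on a line
   in direction i. *)
pose phi y := f (y + h *: ej) - f y.
have dphi s : 0 <= s <= h -> is_derive (x + s *: ei) ei phi
    (pd i f (x + s *: ei + h *: ej) - pd i f (x + s *: ei)).
  move=> sh.
  have dsh : is_derive (x + s *: ei) ei (fun y => f (y + h *: ej))
      (pd i f (x + s *: ei + h *: ej)).
    have quot : (fun u : R => u^-1 *: (((fun y => f (y + h *: ej)) \o shift (x + s *: ei)) (u *: ei)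
         - f (x + s *: ei + h *: ej)))
       = (fun u => u^-1 *: ((f \o shift (x + s *: ei + h *: ej)) (u *: ei)
         - f (x + s *: ei + h *: ej))).
      by apply/funext => u /=; rewrite !addrA.
    have := @smooth_derivable _ _ _ _ _ i fs (Ust s h sh hh) => df.
    by apply: DeriveDef; [rewrite /derivable quot|rewrite /derive quot].
  by apply: is_deriveB; apply/derivableP/(@smooth_derivable _ _ _ _ _ i fs)/Us.
have [|s sh Es] := @MVT_line phi x ei h h0.
  by move=> s /dphi[].
have [|t th Et] := @MVT_line (pd i f) (x + s *: ei) ej h h0.
  by move=> t th; apply: (@smooth_derivable _ _ _ _ _ j (smooth_pd i fs)); exact: Ust.
exists (x + s *: ei + t *: ej); first exact: near0.
have [_ Ds] := dphi s sh.
by rewrite [LHS]Es Ds Et mulrA.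
Qed.

(** Schwarz: if the two mixed derivatives differed at x, the second difference over a small
    square, which is symmetric in the two directions, would take two values. *)
Lemma pdC U f i j x : open U -> smooth U f -> U x ->
  pd i (pd j f) x = pd j (pd i f) x.
Proof.
have halves (p q p' q' : R) : p' = q' ->
    `|p - p'| < `|p - q| / 2 -> `|q - q'| < `|p - q| / 2 -> False.
  by move=> <-; have := ler_distD p' p q; rewrite [`|q - p'|]distrC; lra.
move=> oU fs Ux; set P := pd i (pd j f); set Q := pd j (pd i f).
apply/eqP/negPn/negP => PQ.
have e0 : 0 < `|P x - Q x| / 2 by rewrite divr_gt0 // normr_gt0 subr_eq0.
have contE (F : 'rV[R]_n -> R) : smooth U F -> exists2 d, 0 < d &
    forall y, `|x - y| < d -> `|F x - F y| < `|P x - Q x| / 2.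
  move=> Fs; have /cvgrPdist_lt/(_ _ e0) := smooth_continuous Fs Ux.
  move=> /nbhs_ballP[d d0 dF]; exists d => // y xy; apply: dF.
  by rewrite -ball_normE.
have [dP dP0 nearP] := contE P (smooth_pd i (smooth_pd j fs)).
have [dQ dQ0 nearQ] := contE Q (smooth_pd j (smooth_pd i fs)).
have [d1 d10 sd1] := second_difference i j oU fs Ux.
have [d2 d20 sd2] := second_difference j i oU fs Ux.
set rad := `|delta_mx 0 i : 'rV[R]_n| + `|delta_mx 0 j : 'rV[R]_n| + 1 in sd1.
have rad0 : 0 < rad.
  rewrite /rad; have := normr_ge0 (delta_mx 0 i : 'rV[R]_n).
  have := normr_ge0 (delta_mx 0 j : 'rV[R]_n); lra.
(* The square has to be small enough for both second differences and for both
   continuity estimates at once. *)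
pose m := Num.min (Num.min d1 d2) (Num.min (dP / rad) (dQ / rad)).
have m0 : 0 < m by rewrite !lt_min d10 d20 !divr_gt0.
have [h h0 hm] : exists2 h, 0 < h & h < m by exists (m / 2); lra.
move: hm; rewrite !lt_min !ltr_pdivlMr // => /andP[/andP[h1 h2] /andP[hP hQ]].
have [y1 xy1 E1] := sd1 h h0 h1; have [y2 xy2 E2] := sd2 h h0 h2.
have P2 : `|P x - P y2| < `|P x - Q x| / 2.
  apply: nearP; apply: lt_trans xy2 _.
  by rewrite [`|delta_mx 0 j| + _]addrC.
have Q1 : `|Q x - Q y1| < `|P x - Q x| / 2 by apply/nearQ/(lt_trans xy1).
have xij : x + h *: delta_mx 0 j + h *: delta_mx 0 i
    = x + h *: delta_mx 0 i + h *: delta_mx 0 j by exact: addrAC.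
have swap (a b c d : R) : a - b - (c - d) = a - c - (b - d) by ring.
have PQ12 : P y2 = Q y1.
  apply: (mulIf (lt0r_neq0 (mulr_gt0 h0 h0))).
  by apply: etrans (esym E2) (etrans _ E1); rewrite xij; exact: swap.
exact: halves PQ12 P2 Q1.
Qed.

End AlongLines.

(** * Functions pulled back from the base *)

Section Projection.
Context {R : realType}.
Implicit Types (M N : set 'rV[R]_(3 + 1)) (B : set 'rV[R]_3)
  (W : 'rV[R]_(3 + 1) -> R) (v : 'rV[R]_3 -> R) (x : 'rV[R]_(3 + 1)).

Notation pi := (@lsubmx R 1 3 1).
Notation base i := (lshift 1 i).

Lemma lsubmx_shift h x y : pi (h *: x + y) = h *: pi x + pi y.
Proof. by apply/rowP => j; rewrite !mxE. Qed.

Lemma lsubmx_base (i : 'I_3) : pi (delta_mx 0 (base i)) = delta_mx 0 i.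
Proof. by apply/rowP => j; rewrite !mxE !eqxx /= (inj_eq (@lshift_inj _ _)). Qed.

Lemma lsubmx_fib : pi (delta_mx 0 fib) = 0.
Proof. by apply/rowP => j; rewrite !mxE !eqxx /= eq_lrshift. Qed.

(** The difference quotients agree on the nose, so differentiability and value
    transfer together, in both directions. *)
Lemma quotient_base v x (i : 'I_3) :
  (fun h : R => h^-1 *: (((fun y => v (pi y)) \o shift x) (h *: delta_mx 0 (base i)) - v (pi x)))
  = (fun h => h^-1 *: ((v \o shift (pi x)) (h *: delta_mx 0 i) - v (pi x))).
Proof. by apply/funext => h /=; rewrite lsubmx_shift lsubmx_base. Qed.

Lemma pd_base_lsubmx v x (i : 'I_3) : pd (base i) (fun y => v (pi y)) x = pd i v (pi x).
Proof. by rewrite /pd /derive quotient_base. Qed.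

Lemma derivable_base_lsubmx v x (i : 'I_3) :
  derivable (fun y => v (pi y)) x (delta_mx 0 (base i)) <->
  derivable v (pi x) (delta_mx 0 i).
Proof. by rewrite /derivable quotient_base. Qed.

Lemma is_derive_fib_lsubmx v x :
  is_derive x (delta_mx 0 fib) (fun y => v (pi y)) 0.
Proof.
have quot : (fun h : R => h^-1 *: (((fun y => v (pi y)) \o shift x) (h *: delta_mx 0 fib) - v (pi x)))
    = (fun=> 0).
  apply/funext => h /=; rewrite lsubmx_shift lsubmx_fib.
  by rewrite [h *: (0 : 'rV_3)]scaler0 add0r subrr scaler0.
apply: DeriveDef; first by rewrite /derivable quot; exact: is_cvg_cst.
by rewrite /derive quot; exact: lim_cst.
Qed.

Lemma pd_fib_lsubmx v x : pd fib (fun y => v (pi y)) x = 0.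
Proof. by have [] := is_derive_fib_lsubmx v x. Qed.

Lemma ord4P (P : 'I_(3 + 1) -> Prop) : (forall i : 'I_3, P (base i)) -> P fib -> forall i, P i.
Proof. by move=> Pb Pf i; case: (split_ordP i) => j ->; rewrite ?(ord1 j). Qed.

Lemma open_pi_preimage B : open B -> open [set x | B (pi x)].
Proof. by move=> oB; apply: open_comp => // x _; exact: continuous_lsubmx. Qed.

Lemma smooth_lsubmx B v : open B -> smooth B v ->
  smooth [set x | B (pi x)] (fun x => v (pi x)).
Proof.
move=> oB vs; apply/smoothP => k; elim: k v vs => [|k IH] v vs; split=> //;
  try by move=> x Bx; apply: (@continuous_comp _ _ _ pi v);
    [exact: continuous_lsubmx|exact: smooth_continuous vs Bx].
have oBpi := open_pi_preimage oB.
split.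
  move=> x i; elim/ord4P: i => [i Bx|_].
    by apply/derivable_base_lsubmx; exact: smooth_derivable vs Bx.
  by have [] := is_derive_fib_lsubmx v x.
elim/ord4P => [i|].
  apply: cont_diff_eq_on (IH _ (smooth_pd i vs)) => // y _.
  by rewrite pd_base_lsubmx.
have /smoothP/(_ k) : smooth [set x | B (pi x)] (fun=> 0) by exact: smooth_cst.
by apply: cont_diff_eq_on => // y _; rewrite pd_fib_lsubmx.
Qed.

Lemma is_derive_coord e (j : 'I_(3 + 1)) x :
  is_derive x e (fun y : 'rV[R]_(3 + 1) => y 0 j) (e 0 j).
Proof.
have did : derivable (@id 'rV[R]_(3 + 1)) x e by exact: derivable_id.
apply: DeriveDef; first exact: ((derivable_mxP _ _ _).1 did 0 j).
by have := congr1 (fun u : 'rV[R]_(3 + 1) => u 0 j) (derive_mx did); rewrite derive_id mxE.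
Qed.

Lemma pd_coord i (j : 'I_(3 + 1)) x : pd i (fun y => y 0 j) x = (i == j)%:R.
Proof.
rewrite /pd; have [_ ->] := is_derive_coord (delta_mx 0 i) j x.
by rewrite mxE eqxx eq_sym.
Qed.

Lemma smooth_coord M (j : 'I_(3 + 1)) : open M -> smooth M (fun y => y 0 j).
Proof.
move=> oM; apply/smoothP; elim=> [|k IH]; split=> //;
  try by move=> x _; exact: coord_continuous.
split=> [x i _|i].
  by have [] := is_derive_coord (delta_mx 0 i) j x.
have /smoothP/(_ k) : smooth M (fun=> (i == j)%:R) by exact: smooth_cst.
by apply: cont_diff_eq_on => // y _; rewrite pd_coord.
Qed.

End Projection.

(** * Functions constant along the fibres *)

Section Descent.
Context {R : realType}.
Implicit Types (M N : set 'rV[R]_(3 + 1)) (B : set 'rV[R]_3)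
  (W : 'rV[R]_(3 + 1) -> R) (v : 'rV[R]_3 -> R) (x y : 'rV[R]_(3 + 1)).

Definition image_pi N : set 'rV[R]_3 := [set (pi x : 'rV[R]_3) | x in N].

Lemma eq_pi_fib x y : pi x = pi y -> y = x + (y 0 fib - x 0 fib) *: delta_mx 0 fib.
Proof.
move=> xy; apply/rowP; elim/ord4P => [i|]; rewrite !mxE eqxx /=.
  have := congr1 (fun u : 'rV[R]_3 => u 0 i) xy; rewrite !mxE => ->.
  by rewrite eq_lrshift mulr0 addr0.
by rewrite ?eqxx mulr1 addrC subrK.
Qed.

(** The mean value theorem along the fibre; connectedness makes the last coordinate of a
    fibre of N an interval. *)
Lemma fibre_constant N W : open N ->
  (forall b : 'rV[R]_3, connected (N `&` [set x | lsubmx x = b])) ->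
  smooth N W -> (forall x, N x -> pd fib W x = 0) ->
  forall x y, N x -> N y -> pi x = pi y -> W x = W y.
Proof.
move=> oN cN Ws W0 x y Nx Ny xy.
wlog lexy : x y Nx Ny xy / x 0 fib <= y 0 fib.
  by move=> H; case: (leP (x 0 fib) (y 0 fib)) => [|/ltW] le_; [exact: H|apply/esym/H].
have /connected_intervalP itvS : connected ((fun z : 'rV[R]_(3 + 1) => z 0 fib) @`
    (N `&` [set z | lsubmx z = pi x])).
  apply: connected_continuous_connected (cN (pi x)) _.
  apply: continuous_subspaceT => z; exact: coord_continuous.
have segN u : 0 <= u <= y 0 fib - x 0 fib -> N (x + u *: delta_mx 0 fib).
  move=> /andP[u0 uy].
  have [|||z [Nz /= zx] zu] := itvS (x 0 fib) (y 0 fib) _ _ (x 0 fib + u).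
  - by exists x.
  - by exists y => //; split.
  - by apply/andP; split; lra.
  - by rewrite (_ : u = z 0 fib - x 0 fib) -?(eq_pi_fib (esym zx)) // zu; lra.
have [h0|hpos] := eqVneq (y 0 fib - x 0 fib) 0.
  by rewrite (eq_pi_fib xy) h0 scale0r addr0.
have h0 : 0 < y 0 fib - x 0 fib by rewrite lt_def hpos subr_ge0.
have [s /segN Ns|s /segN Ns] := @MVT_line _ _ W x (delta_mx 0 fib) _ h0.
  exact: smooth_derivable Ws Ns.
rewrite -(eq_pi_fib xy) [X in X * _](W0 _ Ns) mul0r => E.
by apply/esym/eqP; rewrite -subr_eq0; apply/eqP.
Qed.

(** The projection has a local section through every point: change the base
    coordinates and keep the last one. *)
Lemma ball_section x (b : 'rV[R]_3) d : ball (pi x) d b ->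
  ball x d (row_mx b (rsubmx x)).
Proof.
move=> [d0 xb]; split=> // i; elim/ord4P => [j|].
  by have := xb i j; rewrite row_mxEl mxE.
rewrite row_mxEr mxE; exact: ballxx.
Qed.

Lemma open_image_pi N : open N -> open (image_pi N).
Proof.
move=> oN; rewrite openE => _ [x Nx <-].
have /nbhs_ballP[d d0 dN] : nbhs x N by exact: open_nbhs_nbhs.
apply/nbhs_ballP; exists d => // b /ball_section/dN Nb.
by exists (row_mx b (rsubmx x)) => //; rewrite row_mxKl.
Qed.

Lemma continuous_descent N W v x : open N -> (forall x, N x -> W x = v (pi x)) ->
  N x -> {for x, continuous W} -> {for pi x, continuous v}.
Proof.
move=> oN Wv Nx Wc; have oNx : nbhs x N by exact: open_nbhs_nbhs.
move=> A vA; have /Wc WA : nbhs (W x) A by rewrite Wv.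
have : nbhs x (N `&` W @^-1` A) by exact: filterI.
move=> /nbhs_ballP[d d0 dN].
apply/nbhs_ballP; exists d => // b /ball_section/dN[Nb].
by rewrite /= Wv // row_mxKl.
Qed.

Lemma pd_descent N W v x i : open N -> (forall x, N x -> W x = v (pi x)) ->
  N x -> pd i v (pi x) = pd (base i) W x.
Proof. by move=> oN Wv Nx; rewrite -pd_base_lsubmx; apply/esym/pd_eq_on/Nx. Qed.

(** The partial derivatives of v are again descended functions, so the induction runs
    over all pairs W, v at once. *)
Lemma smooth_descent N W v : open N -> (forall x, N x -> W x = v (pi x)) ->
  smooth N W -> smooth (image_pi N) v.
Proof.
move=> oN Wv /smoothP Ws; apply/smoothP => k.
elim: k W v Wv {Ws}(Ws k) => [|k IH] W v Wv [Wc WS]; split=> //;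
  try by move=> _ [x Nx <-]; apply: (continuous_descent oN Wv Nx (Wc x Nx)).
have [Wd Wp] := WS; split=> [_ i [x Nx <-]|i].
  apply/derivable_base_lsubmx; apply: near_eq_derivable (Wd x (base i) Nx).
  have : \near x, N x by exact: open_nbhs_nbhs.
  by apply: filterS => y /Wv.
by apply: (IH (pd (base i) W)) (Wp _) => x Nx; rewrite (pd_descent i oN Wv Nx).
Qed.

End Descent.

(** * Hodge stars in an oriented orthonormal frame *)

Section Frames.
Context {R : realType}.

Lemma det_row_linear n (F : 'rV[R]_n -> 'M[R]_n) (r : 'I_n) (u : 'rV[R]_n) :
  (forall v, row r (F v) = v) -> (forall v w, row' r (F v) = row' r (F w)) ->
  \sum_k u 0 k * \det (F (delta_mx 0 k)) = \det (F u).
Proof.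
move=> Fr F'.
have cof v w k : cofactor (F v) r k = cofactor (F w) r k.
  rewrite /cofactor; congr (_ * \det _); apply/matrixP => i j.
  by have := congr1 (fun m : 'M_(_, _) => m i (lift k j)) (F' v w); rewrite !mxE.
have entry v k : F v r k = v 0 k.
  by rewrite -[in RHS](Fr v) mxE.
rewrite [RHS](expand_det_row _ r); apply: eq_bigr => k _.
rewrite entry; congr (_ * _); rewrite (expand_det_row _ r) (bigD1 k) //= big1.
  by rewrite entry mxE !eqxx mul1r addr0; exact: cof.
by move=> j jk; rewrite entry mxE eqxx (negbTE jk) mul0r.
Qed.

(** The rows of E are an oriented orthonormal basis for G. *)
Definition orthoframe n (G E : 'M[R]_n) : Prop :=
  E *m G *m E^T = 1%:M /\ 0 < \det E.

Section General.
Variables (n : nat) (G E : 'M[R]_n).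
Hypothesis orthoE : orthoframe G E.

Lemma coframeK : (E *m G) *m E^T = 1%:M. Proof. by case: orthoE. Qed.

Lemma frame_coframe : E^T *m (E *m G) = 1%:M.
Proof. exact/mulmx1C/coframeK. Qed.

Lemma invmx_frame : invmx G = E^T *m E.
Proof.
have GE : (E^T *m E) *m G = 1%:M by rewrite -mulmxA frame_coframe.
have /mulmx1_unit[_ Gu] := GE.
by rewrite -[LHS]mul1mx -GE -[LHS]mulmxA mulmxV ?mulmx1.
Qed.

Lemma det_frame : Num.sqrt (\det G) * \det E = 1.
Proof.
have [orth E0] := orthoE; have := congr1 determinant orth.
rewrite !det_mulmx det_tr det1 => dE.
have -> : \det G = (\det E)^-1 ^+ 2.
  by apply: (mulfI (lt0r_neq0 E0)); apply: (mulIf (lt0r_neq0 E0)); rewrite dE; field; exact: lt0r_neq0.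
by rewrite sqrtr_sqr ger0_norm ?invr_ge0 ?ltW // mulVf // lt0r_neq0.
Qed.

(** In an oriented orthonormal frame the volume form is the determinant. *)
Lemma vol_frame (Xs : seq 'rV[R]_n) (Y : 'M[R]_n) :
  \matrix_(r < n) nth 0 Xs r = Y *m E -> vol G Xs = \det Y.
Proof. by move=> XY; rewrite /vol XY det_mulmx mulrCA det_frame mulr1. Qed.

End General.

Lemma vol_row_linear n (G : 'M[R]_n) (Xs : 'rV[R]_n -> seq 'rV[R]_n) (r : 'I_n)
  (u : 'rV[R]_n) :
  (forall v, nth 0 (Xs v) r = v) ->
  (forall v w (i : 'I_n), i != r -> nth 0 (Xs v) i = nth 0 (Xs w) i) ->
  \sum_k u 0 k * vol G (Xs (delta_mx 0 k)) = vol G (Xs u).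
Proof.
move=> Xr X'; rewrite /vol.
rewrite -(@det_row_linear _ (fun v => \matrix_(i < n) nth 0 (Xs v) i) r u) ?mulr_sumr.
- by apply: eq_bigr => k _; rewrite mulrCA.
- by move=> v; rewrite rowK.
by move=> v w; apply/matrixP => i k; rewrite !mxE (X' v w) // eq_sym neq_lift.
Qed.

Lemma sum4_exchange (I : finType) (F : I -> I -> I -> I -> R) :
  \sum_i \sum_j \sum_q \sum_p F i j q p = \sum_p \sum_q \sum_i \sum_j F i j q p.
Proof.
transitivity (\sum_i \sum_q \sum_j \sum_p F i j q p).
  by apply: eq_bigr => i _; exact: exchange_big.
rewrite exchange_big /= [RHS]exchange_big /=; apply: eq_bigr => q _.
transitivity (\sum_i \sum_p \sum_j F i j q p); last exact: exchange_big.
by apply: eq_bigr => i _; exact: exchange_big.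
Qed.

(** The star operator commutes with orientation preserving isometries: expand both
    sides over the frame and use multilinearity of the volume form. *)
Lemma star2_frame (G E b : 'M[R]_(3 + 1)) : orthoframe G E ->
  E *m star2 G b *m E^T = star2 1%:M (E *m b *m E^T).
Proof.
move=> oE; pose V u v w z := vol G [:: u; v; w; z].
have lin1 (u v w z : 'rV[R]_(3 + 1)) : \sum_k u 0 k * V (delta_mx 0 k) v w z = V u v w z.
  apply: (@vol_row_linear _ G (fun u => [:: u; v; w; z]) (@Ordinal 4 0 isT) u) => //.
  by move=> ? ? [[|[|[|[|]]]]].
have lin2 (u v w z : 'rV[R]_(3 + 1)) : \sum_k v 0 k * V u (delta_mx 0 k) w z = V u v w z.
  apply: (@vol_row_linear _ G (fun v => [:: u; v; w; z]) (@Ordinal 4 1 isT) v) => //.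
  by move=> ? ? [[|[|[|[|]]]]].
have lin3 (u v w z : 'rV[R]_(3 + 1)) : \sum_k w 0 k * V u v (delta_mx 0 k) z = V u v w z.
  apply: (@vol_row_linear _ G (fun w => [:: u; v; w; z]) (@Ordinal 4 2 isT) w) => //.
  by move=> ? ? [[|[|[|[|]]]]].
have lin4 (u v w z : 'rV[R]_(3 + 1)) : \sum_k z 0 k * V u v w (delta_mx 0 k) = V u v w z.
  apply: (@vol_row_linear _ G (fun z => [:: u; v; w; z]) (@Ordinal 4 3 isT) z) => //.
  by move=> ? ? [[|[|[|[|]]]]].
have VE i j k l : V (row i E) (row j E) (row k E) (row l E)
    = vol 1%:M [:: delta_mx 0 i; delta_mx 0 j; delta_mx 0 k; delta_mx 0 l].
  rewrite /V (vol_frame oE (Y := \matrix_r nth 0 [:: delta_mx 0 i; delta_mx 0 j; delta_mx 0 k; delta_mx 0 l] r)).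
    by rewrite /vol det1 sqrtr1 mul1r.
  by apply/row_matrixP => r; rewrite row_mul !rowK; case: r => [[|[|[|[|]]]]] //= _; rewrite -rowE.
have inv1 : invmx (1%:M : 'M[R]_(3 + 1)) = 1%:M by exact: invmx1.
apply/matrixP => c d; rewrite [RHS]mxE inv1 mul1mx trmx1 mulmx1.
under [X in _ = _ * X]eq_bigr do under eq_bigr do rewrite -VE.
transitivity (2^-1 * \sum_i \sum_j (invmx G *m b *m (invmx G)^T) i j *
   V (delta_mx 0 j) (delta_mx 0 i) (row c E) (row d E)).
  rewrite mxE; under eq_bigr do rewrite !mxE mulr_suml.
  transitivity (\sum_l \sum_k E c k * E d l * (2^-1 * \sum_i \sum_j (invmx G *m b *m (invmx G)^T) i j *
     V (delta_mx 0 j) (delta_mx 0 i) (delta_mx 0 k) (delta_mx 0 l))).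
    by apply: eq_bigr => l _; apply: eq_bigr => k _; rewrite !mxE mulrAC.
  under eq_bigr do under eq_bigr do rewrite mulrCA mulr_sumr.
  under eq_bigr do rewrite -mulr_sumr exchange_big /=.
  rewrite -mulr_sumr exchange_big /=; congr (_ * _); apply: eq_bigr => i _.
  under eq_bigr do under eq_bigr do rewrite mulr_sumr.
  under eq_bigr do rewrite exchange_big /=.
  rewrite exchange_big /=; apply: eq_bigr => j _.
  rewrite -[in RHS]lin3 mulr_sumr exchange_big /=; apply: eq_bigr => k _.
  rewrite -[in RHS]lin4 !mulr_sumr; apply: eq_bigr => l _.
  by rewrite !mxE; ring.
congr (_ * _); rewrite (invmx_frame oE).
have -> : E^T *m E *m b *m (E^T *m E)^T = E^T *m (E *m b *m E^T) *m E.
  by rewrite trmx_mul trmxK !mulmxA.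
move: (E *m b *m E^T) => b'.
transitivity (\sum_i \sum_j \sum_q \sum_p E p i * b' p q * E q j *
   V (delta_mx 0 j) (delta_mx 0 i) (row c E) (row d E)).
  apply: eq_bigr => i _; apply: eq_bigr => j _; rewrite mxE mulr_suml.
  apply: eq_bigr => q _; rewrite !mxE !mulr_suml; apply: eq_bigr => p _.
  by rewrite mxE.
rewrite sum4_exchange; apply: eq_bigr => p _; apply: eq_bigr => q _.
rewrite -[in RHS]lin2 mulr_sumr; apply: eq_bigr => i _.
rewrite -[in RHS]lin1 !mulr_sumr; apply: eq_bigr => j _.
by rewrite !mxE; ring.
Qed.

Lemma star1_frame (G E : 'M[R]_3) (a : 'rV[R]_3) : orthoframe G E ->
  E *m star1 G a *m E^T = star1 1%:M (a *m E^T).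
Proof.
move=> oE; pose V u w z := vol G [:: u; w; z].
have lin1 (u w z : 'rV[R]_3) : \sum_k u 0 k * V (delta_mx 0 k) w z = V u w z.
  apply: (@vol_row_linear _ G (fun u => [:: u; w; z]) (@Ordinal 3 0 isT) u) => //.
  by move=> ? ? [[|[|[|]]]].
have lin2 (u w z : 'rV[R]_3) : \sum_k w 0 k * V u (delta_mx 0 k) z = V u w z.
  apply: (@vol_row_linear _ G (fun w => [:: u; w; z]) (@Ordinal 3 1 isT) w) => //.
  by move=> ? ? [[|[|[|]]]].
have lin3 (u w z : 'rV[R]_3) : \sum_k z 0 k * V u w (delta_mx 0 k) = V u w z.
  apply: (@vol_row_linear _ G (fun z => [:: u; w; z]) (@Ordinal 3 2 isT) z) => //.
  by move=> ? ? [[|[|[|]]]].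
apply/matrixP => c d.
have -> : star1 1%:M (a *m E^T) c d = V ((a *m E^T) *m E) (row c E) (row d E).
  rewrite mxE invmx1 mulmx1.
  rewrite /V (vol_frame oE (Y := \matrix_r nth 0 [:: a *m E^T; delta_mx 0 c; delta_mx 0 d] r)).
    by rewrite /vol det1 sqrtr1 mul1r.
  by apply/row_matrixP => r; rewrite row_mul !rowK; case: r => [[|[|[|]]]] //= _; rewrite -?rowE.
rewrite mxE -lin3; apply: eq_bigr => l _.
rewrite !mxE mulr_suml -lin2 mulr_sumr; apply: eq_bigr => k _.
rewrite !mxE (invmx_frame oE) mulmxA; rewrite /V; ring.
Qed.

End Frames.

(** * Components in dimensions three and four *)

Section Components.
Context {R : realType}.

Lemma ord3P (P : 'I_3 -> Prop) : P o0 -> P o1 -> P o2 -> forall i, P i.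
Proof. by move=> P0 P1 P2 [[|[|[|]]]] // i; rewrite (bool_irrelevance i isT). Qed.

Lemma sum3 (V : nmodType) (F : 'I_3 -> V) : \sum_i F i = F o0 + F o1 + F o2.
Proof.
rewrite !big_ord_recl big_ord0 addr0 addrA.
by congr (_ + _ + _); congr F; apply/val_inj.
Qed.

Lemma sum4 (V : nmodType) (F : 'I_(3 + 1) -> V) :
  \sum_i F i = F (base o0) + F (base o1) + F (base o2) + F fib.
Proof.
by rewrite big_split_ord /= sum3 big_ord1.
Qed.

Lemma det2 (A : 'M[R]_2) : \det A = A 0 0 * A 1 1 - A 0 1 * A 1 0.
Proof.
have l0 : lift 0 (0 : 'I_1) = 1 :> 'I_2 by apply/val_inj.
have l1 : lift 1 (0 : 'I_1) = 0 :> 'I_2 by apply/val_inj.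
rewrite (expand_det_row _ 0) !big_ord_recl big_ord0 /cofactor !det_mx11 !mxE.
by rewrite ?l0 ?l1 /= !(expr0, expr1); ring.
Qed.

Lemma det3 (A : 'M[R]_3) : \det A =
  A o0 o0 * (A o1 o1 * A o2 o2 - A o1 o2 * A o2 o1)
  - A o0 o1 * (A o1 o0 * A o2 o2 - A o1 o2 * A o2 o0)
  + A o0 o2 * (A o1 o0 * A o2 o1 - A o1 o1 * A o2 o0).
Proof.
have l00 : lift o0 (0 : 'I_2) = o1 by apply/val_inj.
have l01 : lift o0 (1 : 'I_2) = o2 by apply/val_inj.
have l10 : lift o1 (0 : 'I_2) = o0 by apply/val_inj.
have l11 : lift o1 (1 : 'I_2) = o2 by apply/val_inj.
have l20 : lift o2 (0 : 'I_2) = o0 by apply/val_inj.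
have l21 : lift o2 (1 : 'I_2) = o1 by apply/val_inj.
rewrite (expand_det_row _ o0) sum3 /cofactor !det2 !mxE.
rewrite l00 l01 l10 l11 l20 l21 /= -[(-1) ^+ (0 + 0)]signr_odd.
rewrite -[(-1) ^+ (0 + 1)]signr_odd -[(-1) ^+ (0 + 2)]signr_odd /=; ring.
Qed.

End Components.

Section Stars.
Context {R : realType}.

Lemma star1_1E (a : 'rV[R]_3) :
  let S := star1 1%:M a in
  [/\ S o1 o2 = a 0 o0, S o2 o0 = a 0 o1, S o0 o1 = a 0 o2 & S^T = - S].
Proof.
have E k l : star1 1%:M a k l = \det (\matrix_(r < 3) nth 0 [:: a; delta_mx 0 k; delta_mx 0 l] r).
  by rewrite mxE invmx1 mulmx1 /vol det1 sqrtr1 mul1r.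
split; rewrite ?E ?det3 ?mxE -?val_eqE /=; try ring.
apply/matrixP => i j; rewrite [LHS]mxE [RHS]mxE !E !det3.
by elim/ord3P: i; elim/ord3P: j; rewrite !mxE -?val_eqE /=; ring.
Qed.

(** The totally antisymmetric symbol, with the fibre direction last. *)
Definition eps4 (i j k l : 'I_(3 + 1)) : R :=
  \det (\matrix_(r < 3 + 1) nth 0 [:: delta_mx 0 i; delta_mx 0 j; delta_mx 0 k; delta_mx 0 l] r).

Lemma eps4_repeated i j k : [/\ eps4 i i j k = 0, eps4 i j i k = 0, eps4 i j k i = 0,
  eps4 j i i k = 0 & eps4 j i k i = 0 /\ eps4 j k i i = 0].
Proof.
have rep (i1 i2 : 'I_(3 + 1)) (A : 'M[R]_(3 + 1)) :
    i1 != i2 -> row i1 A = row i2 A -> \det A = 0.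
  move=> ne rr; apply: (determinant_alternate ne) => q.
  by have := congr1 (fun u : 'rV_ _ => u 0 q) rr; rewrite !mxE.
split; [| | | |split].
- by apply: (rep (base o0) (base o1)) => //; rewrite !rowK.
- by apply: (rep (base o0) (base o2)) => //; rewrite !rowK.
- by apply: (rep (base o0) fib) => //; rewrite !rowK.
- by apply: (rep (base o1) (base o2)) => //; rewrite !rowK.
- by apply: (rep (base o1) fib) => //; rewrite !rowK.
- by apply: (rep (base o2) fib) => //; rewrite !rowK.
Qed.

Lemma eps4_swap i j k l : [/\ eps4 j i k l = - eps4 i j k l,
  eps4 i k j l = - eps4 i j k l & eps4 i j l k = - eps4 i j k l].
Proof.
have swap (i1 i2 : 'I_(3 + 1)) (A B : 'M[R]_(3 + 1)) :
    i1 != i2 -> (forall r, row r B = row (tperm i1 i2 r) A) -> \det B = - \det A.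
  move=> ne BA; have -> : B = xrow i1 i2 A.
    by apply/row_matrixP => r; rewrite BA; apply/rowP => q; rewrite !mxE.
  by rewrite xrowE det_mulmx det_perm odd_tperm ne mulN1r.
split.
- apply: (swap (base o0) (base o1)) => // r; rewrite !rowK permE /=.
  by elim/ord4P: r => [|//]; elim/ord3P.
- apply: (swap (base o1) (base o2)) => // r; rewrite !rowK permE /=.
  by elim/ord4P: r => [|//]; elim/ord3P.
- apply: (swap (base o2) fib) => // r; rewrite !rowK permE /=.
  by elim/ord4P: r => [|//]; elim/ord3P.
Qed.

Lemma eps4_id : eps4 (base o0) (base o1) (base o2) fib = 1.
Proof.
rewrite /eps4 -[RHS](det1 R (3 + 1)); congr (\det _).
apply/row_matrixP => r; rewrite rowK row1.
by elim/ord4P: r => [|//]; elim/ord3P.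
Qed.

Lemma star2_1_eps (b : 'M[R]_(3 + 1)) k l :
  star2 1%:M b k l = 2^-1 * \sum_i \sum_j b i j * eps4 j i k l.
Proof.
rewrite mxE invmx1 mul1mx trmx1 mulmx1; congr (_ * _).
by apply: eq_bigr => i _; apply: eq_bigr => j _; rewrite /vol det1 sqrtr1 mul1r.
Qed.

(** With this convention e_1 /\ e_2 is minus the star of e_3 /\ e_fib; a selfdual
    2-form b has b(fib, c) = b(c+1, c+2). *)
Lemma star2_1E (b : 'M[R]_(3 + 1)) : b^T = - b ->
  let S := star2 1%:M b in
  [/\ [/\ S fib (base o0) = b (base o1) (base o2),
          S fib (base o1) = b (base o2) (base o0) &
          S fib (base o2) = b (base o0) (base o1)],
      [/\ S (base o1) (base o2) = b fib (base o0),
          S (base o2) (base o0) = b fib (base o1) &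
          S (base o0) (base o1) = b fib (base o2)] & S^T = - S].
Proof.
move=> bT; have sk i j : b i j = - b j i.
  by have := congr1 (fun m : 'M_(_, _) => m j i) bT; rewrite !mxE.
have rep := eps4_repeated.
have r12 i j k : eps4 i i j k = 0 by have [] := rep i j k.
have r13 i j k : eps4 i j i k = 0 by have [] := rep i j k.
have r14 i j k : eps4 i j k i = 0 by have [] := rep i j k.
have r23 i j k : eps4 j i i k = 0 by have [] := rep i j k.
have r24 i j k : eps4 j i k i = 0 by have [_ _ _ _ []] := rep i j k.
have r34 i j k : eps4 j k i i = 0 by have [_ _ _ _ []] := rep i j k.
have pair k l i j : eps4 j i k l = 1 -> [/\ i != j, i != k, i != l, j != k & j != l] ->
    (forall p, [|| p == i, p == j, p == k | p == l]) ->
    star2 1%:M b k l = b i j.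
  move=> e1 [ij ik il jk jl] all4; rewrite star2_1_eps.
  have e2 : eps4 i j k l = -1 by have [-> _ _] := eps4_swap j i k l; rewrite e1.
  have only p q : b p q * eps4 q p k l = (if (p == i) && (q == j) then b i j else 0)
      + (if (p == j) && (q == i) then b i j else 0).
    have [nij nik nil njk njl] : [/\ (j == i) = false, (k == i) = false, (l == i) = false,
        (k == j) = false & (l == j) = false].
      by rewrite !(eq_sym _ i) !(eq_sym _ j) !(negbTE ij, negbTE ik, negbTE il, negbTE jk, negbTE jl)
        eq_sym (negbTE ij).
    case/or4P: (all4 p) => /eqP->; case/or4P: (all4 q) => /eqP->;
      rewrite ?(r12, r13, r14, r23, r24, e1, e2) ?eqxx ?(nij, nik, nil, njk, njl)
        ?(negbTE ij) /=; try by rewrite ?(mulr0, mulr1, addr0).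
    by rewrite (sk j i) mulrNN mulr1 add0r.
  have indic p' q' c : \sum_p \sum_q (if (p == p') && (q == q') then c else 0) = c :> R.
    rewrite (bigD1 p') //= (bigD1 q') //= !eqxx /= !big1 ?addr0 // => p.
      by move=> pp'; apply: big1 => q _; rewrite (negbTE pp').
    by move=> /negbTE ->.
  under eq_bigr do under eq_bigr do rewrite only.
  under eq_bigr do rewrite big_split /=.
  by rewrite big_split /= !indic; lra.
have s12 i j k l : eps4 j i k l = - eps4 i j k l by have [] := eps4_swap i j k l.
have s23 i j k l : eps4 i k j l = - eps4 i j k l by have [] := eps4_swap i j k l.
have s34 i j k l : eps4 i j l k = - eps4 i j k l by have [] := eps4_swap i j k l.
split; [split|split|].
- apply: (pair fib (base o0) (base o1) (base o2)); [by rewrite s34 s23 s12 s23 !opprK eps4_id|by []|].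
  by elim/ord4P; first elim/ord3P.
- apply: (pair fib (base o1) (base o2) (base o0)); [by rewrite s34 s23 !opprK eps4_id|by []|].
  by elim/ord4P; first elim/ord3P.
- apply: (pair fib (base o2) (base o0) (base o1)); [by rewrite s34 s12 !opprK eps4_id|by []|].
  by elim/ord4P; first elim/ord3P.
- apply: (pair (base o1) (base o2) fib (base o0)); [by rewrite s23 s34 !opprK eps4_id|by []|].
  by elim/ord4P; first elim/ord3P.
- apply: (pair (base o2) (base o0) fib (base o1)); [by rewrite s34 s23 s12 s34 !opprK eps4_id|by []|].
  by elim/ord4P; first elim/ord3P.
- apply: (pair (base o0) (base o1) fib (base o2)); [by rewrite s23 s12 s34 s23 !opprK eps4_id|by []|].
  by elim/ord4P; first elim/ord3P.
apply/matrixP => k l; rewrite [LHS]mxE [RHS]mxE !star2_1_eps -mulrN -sumrN.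
congr (_ * _); apply: eq_bigr => i _; rewrite -sumrN.
by apply: eq_bigr => j _; rewrite s34 mulrN.
Qed.

End Stars.

(** * The Koszul formula *)

Section Christoffel.
Context {R : realType} {n : nat}.
Implicit Types (U : set 'rV[R]_n) (g : 'rV[R]_n -> 'M[R]_n) (a : 'rV[R]_n -> 'rV[R]_n).

Lemma christoffel_lower g a x l i j : g x \in unitmx ->
  \sum_k g x l k * christoffel g a x k i j
  = 2^-1 * (dmetric g a x i j l + dmetric g a x j i l - dmetric g a x l i j).
Proof.
move=> gu; rewrite /christoffel.
under eq_bigr do rewrite mulrCA mulr_sumr.
rewrite -mulr_sumr exchange_big /=; congr (_ * _).
transitivity (\sum_m (g x *m invmx (g x)) l m *
    (dmetric g a x i j m + dmetric g a x j i m - dmetric g a x m i j)).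
  by apply: eq_bigr => m _; rewrite mxE mulr_suml; apply: eq_bigr => k _; rewrite mulrA.
rewrite mulmxV // (bigD1 l) //= mxE eqxx mul1r big1 ?addr0 // => m ml.
by rewrite mxE eq_sym (negbTE ml) mul0r.
Qed.

Lemma dmetricC U g a x i j k : open U -> (forall y, U y -> (g y)^T = g y) -> U x ->
  dmetric g a x i j k = dmetric g a x i k j.
Proof.
move=> oU gT Ux; have sg y p q : U y -> g y p q = g y q p.
  by move=> Uy; rewrite -[in LHS](gT y Uy) mxE.
rewrite /dmetric (sg x j k) //; congr (_ + _).
by apply: (pd_eq_on _ oU _ Ux) => y Uy; exact: sg.
Qed.

Lemma christoffelC U g a x k i j : open U -> (forall y, U y -> (g y)^T = g y) -> U x ->
  christoffel g a x k i j = christoffel g a x k j i.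
Proof.
move=> oU gT Ux; rewrite /christoffel; congr (_ * _); apply: eq_bigr => l _.
by rewrite (dmetricC a l i j oU gT Ux) [dmetric _ _ _ i _ _ + _]addrC.
Qed.

(** The trace over the upper index only sees the volume form: the terms of the
    Koszul formula antisymmetric in the traced indices cancel. *)
Lemma christoffel_trace U g a x j : open U -> (forall y, U y -> (g y)^T = g y) ->
  U x -> g x \in unitmx ->
  \sum_i christoffel g a x i i j
  = 2^-1 * (\sum_i \sum_l invmx (g x) i l * pd j (fun y => g y i l) x) + n%:R * a x 0 j.
Proof.
move=> oU gT Ux gu; set H := invmx (g x).
have HT i l : H i l = H l i.
  have HH : H^T = H by rewrite /H trmx_inv gT.
  by rewrite -[in LHS]HH mxE.
pose D i l := dmetric g a x i l j.
have -> : \sum_i christoffel g a x i i j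
    = 2^-1 * \sum_i \sum_l H i l * (D i l - D l i + dmetric g a x j i l).
  rewrite mulr_sumr; apply: eq_bigr => i _; congr (_ * _); apply: eq_bigr => l _.
  by rewrite /D (dmetricC a i j l oU gT Ux); congr (_ * _); ring.
have anti : \sum_i \sum_l H i l * (D i l - D l i) = 0.
  have sw : \sum_i \sum_l H i l * D l i = \sum_i \sum_l H i l * D i l.
    rewrite exchange_big /=; apply: eq_bigr => i _; apply: eq_bigr => l _.
    by rewrite HT.
  under eq_bigr do under eq_bigr do rewrite mulrBr.
  under eq_bigr do rewrite sumrB.
  by rewrite sumrB sw subrr.
under eq_bigr do under eq_bigr do rewrite mulrDr.
under eq_bigr do rewrite big_split /=.
rewrite big_split /= anti add0r /dmetric.
under eq_bigr do under eq_bigr do rewrite mulrDr.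
under eq_bigr do rewrite big_split /=.
rewrite big_split /= mulrDr; congr (_ + _).
have -> : \sum_i \sum_l H i l * (2 * a x 0 j * g x i l) = 2 * a x 0 j * \tr (H *m g x).
  rewrite /mxtrace mulr_sumr; apply: eq_bigr => i _; rewrite mxE mulr_sumr.
  apply: eq_bigr => l _; rewrite (_ : g x i l = g x l i); first ring.
  by rewrite -[in LHS](gT x Ux) mxE.
by rewrite mulVmx // mxtrace1; field.
Qed.

End Christoffel.

(** * Metrics adapted to the projection *)

Section Adapted.
Context {R : realType}.
Implicit Types (M : set 'rV[R]_(3 + 1)) (x : 'rV[R]_(3 + 1)).

Definition fibre_form (theta : 'rV[R]_(3 + 1) -> 'rV[R]_3) x : 'rV[R]_(3 + 1) :=
  row_mx (theta x) (1%:M : 'M_1).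

(** Local form of a conformal submersion with gauges lam and rho^-1 for horizontal and
    vertical lengths; ds + theta is the connection form. *)
Record adapted M (g : 'rV[R]_(3 + 1) -> 'M[R]_(3 + 1)) (gB : 'rV[R]_3 -> 'M[R]_3)
    (lam rho : 'rV[R]_(3 + 1) -> R) (theta : 'rV[R]_(3 + 1) -> 'rV[R]_3) : Prop := Adapted {
  adapted_open : open M;
  adapted_lam : smooth M lam;
  adapted_rho : smooth M rho;
  adapted_theta : forall i, smooth M (fun x => theta x 0 i);
  adapted_gB : forall i j, smooth M (fun x => gB (pi x) i j);
  adapted_lam0 : forall x, M x -> 0 < lam x;
  adapted_rho0 : forall x, M x -> 0 < rho x;
  adapted_sym : forall x, M x -> (gB (pi x))^T = gB (pi x);
  adapted_orthoframe : forall x, M x -> exists EB, orthoframe (gB (pi x)) EB;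
  adapted_metric : forall x, M x -> g x = lam x ^+ 2 *: pullback_metric gB x
    + rho x ^- 2 *: ((fibre_form theta x)^T *m fibre_form theta x) }.

(** The frame dual to the coframe of gB completed by rho^-1 (ds + theta): horizontal
    lifts of the rows of EB followed by the unit vertical vector. *)
Definition adapted_frame (lam rho : 'rV[R]_(3 + 1) -> R)
    (theta : 'rV[R]_(3 + 1) -> 'rV[R]_3) (EB : 'M[R]_3) x : 'M[R]_(3 + 1) :=
  block_mx ((lam x)^-1 *: EB) (- ((lam x)^-1 *: (EB *m (theta x)^T))) 0 (rho x)%:M.

(** Derivative along the horizontal lift of a coordinate vector field of B. *)
Definition horiz_pd (theta : 'rV[R]_(3 + 1) -> 'rV[R]_3) (i : 'I_3) (f : 'rV[R]_(3 + 1) -> R) x : R :=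
  pd (base i) f x - theta x 0 i * pd fib f x.

Definition horiz_curvature (theta : 'rV[R]_(3 + 1) -> 'rV[R]_3) x : 'M[R]_3 :=
  \matrix_(i, j) (horiz_pd theta i (fun y => theta y 0 j) x
                - horiz_pd theta j (fun y => theta y 0 i) x).

Variables (M : set 'rV[R]_(3 + 1)) (g : 'rV[R]_(3 + 1) -> 'M[R]_(3 + 1))
  (gB : 'rV[R]_3 -> 'M[R]_3) (lam rho : 'rV[R]_(3 + 1) -> R)
  (theta : 'rV[R]_(3 + 1) -> 'rV[R]_3).
Hypothesis adM : adapted M g gB lam rho theta.
Notation th x i := (fibre_form theta x 0 i).

Lemma fibre_form_base x i : th x (base i) = theta x 0 i.
Proof. exact: row_mxEl. Qed.

Lemma fibre_form_fib x : th x fib = 1.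
Proof. by rewrite row_mxEr mxE eqxx. Qed.

Lemma adapted_frame_ortho EB x : M x -> orthoframe (gB (pi x)) EB ->
  orthoframe (g x) (adapted_frame lam rho theta EB x).
Proof.
move=> Mx [oE dE]; have l0 := adapted_lam0 adM Mx; have r0 := adapted_rho0 adM Mx.
split; last first.
  by rewrite det_ublock det_scalar1 detZ mulr_gt0 // mulr_gt0 // exprn_gt0 // invr_gt0.
rewrite (adapted_metric adM Mx); set E := adapted_frame _ _ _ _ _.
have Eth : E *m (fibre_form theta x)^T = col_mx 0 (rho x)%:M.
  rewrite tr_row_mx trmx1 mul_block_col mul0mx add0r !mulmx1; congr col_mx.
  by rewrite -scalemxAl subrr.
have Epb : E *m pullback_metric gB x *m E^T
    = block_mx ((lam x)^-1 ^+ 2 *: (EB *m gB (pi x) *m EB^T)) 0 0 0.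
  rewrite /E /adapted_frame /pullback_metric tr_block_mx !mulmx_block.
  rewrite !(mulmx0, mul0mx, addr0, trmx0) linearZ /= -!scalemxAl -scalemxAr scalerA.
  by rewrite -expr2.
rewrite mulmxDr mulmxDl -!scalemxAr -!scalemxAl Epb oE.
rewrite mulmxA -(mulmxA _ _ E^T) Eth -[fibre_form theta x *m _]trmxK trmx_mul trmxK Eth.
rewrite tr_col_mx trmx0 mul_col_row !(mul0mx, mulmx0) tr_scalar_mx -scalar_mxM.
rewrite !scale_block_mx !scaler0 !scalerA add_block_mx !(add0r, addr0).
rewrite -exprMn divff ?gt_eqF // expr1n scale1r scale_scalar_mx -expr2 mulVf; last first.
  by rewrite gt_eqF // exprn_gt0.
by rewrite -scalar_mx_block.
Qed.

Lemma adapted_unitmx x : M x -> g x \in unitmx.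
Proof.
move=> Mx; have [EB oE] := adapted_orthoframe adM Mx.
have := frame_coframe (adapted_frame_ortho Mx oE).
by rewrite mulmxA => /mulmx1_unit[].
Qed.

Lemma pullback_metric_entry i j :
  (forall x, M x -> pullback_metric gB x i j = pullback_metric gB x j i) /\
  smooth M (fun x => pullback_metric gB x i j).
Proof.
have s0 (u v : 'I_(3 + 1)) : (forall x, pullback_metric gB x u v = 0) ->
    smooth M (fun x => pullback_metric gB x u v).
  by move=> z; apply: (smooth_eq_on (adapted_open adM) _ (@smooth_cst _ _ M 0)).
split=> [x Mx|]; elim/ord4P: i => [i|]; elim/ord4P: j => [j|].
- by rewrite /pullback_metric !block_mxEul -[in LHS](adapted_sym adM Mx) mxE.
- by rewrite /pullback_metric block_mxEur block_mxEdl !mxE.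
- by rewrite /pullback_metric block_mxEur block_mxEdl !mxE.
- by [].
- apply: (smooth_eq_on (adapted_open adM) _ (adapted_gB adM i j)) => y _.
  by rewrite /pullback_metric block_mxEul.
- by apply: s0 => x; rewrite /pullback_metric block_mxEur mxE.
- by apply: s0 => x; rewrite /pullback_metric block_mxEdl mxE.
- by apply: s0 => x; rewrite /pullback_metric block_mxEdr mxE.
Qed.

Lemma pd_fib_pullback_metric i j x : pd fib (fun y => pullback_metric gB y i j) x = 0.
Proof.
have z (u v : 'I_(3 + 1)) : (forall x, pullback_metric gB x u v = 0) ->
    pd fib (fun x => pullback_metric gB x u v) x = 0.
  by move=> z; rewrite -[RHS](pd_cst 0 fib x); congr (pd fib _ x); apply/funext.
elim/ord4P: i => [i|]; elim/ord4P: j => [j|].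
- have -> : (fun y => pullback_metric gB y (base i) (base j)) = (fun y => gB (pi y) i j).
    by apply/funext => y; rewrite /pullback_metric block_mxEul.
  exact: pd_fib_lsubmx (fun b => gB b i j) x.
- by apply: z => y; rewrite /pullback_metric block_mxEur mxE.
- by apply: z => y; rewrite /pullback_metric block_mxEdl mxE.
- by apply: z => y; rewrite /pullback_metric block_mxEdr mxE.
Qed.

Lemma smooth_fibre_form i : smooth M (fun x => th x i).
Proof.
have oM := adapted_open adM; elim/ord4P: i => [i|].
  apply: (smooth_eq_on oM _ (adapted_theta adM i)) => y _.
  by rewrite fibre_form_base.
by apply: (smooth_eq_on oM _ (@smooth_cst _ _ M 1)) => y _; rewrite fibre_form_fib.
Qed.

Lemma pd_fibre_form_fib i x : pd i (fun y => th y fib) x = 0.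
Proof.
rewrite -[RHS](pd_cst 1 i x); congr (pd i _ x).
by apply/funext => y; rewrite fibre_form_fib.
Qed.

Lemma adapted_entry x i j : M x ->
  g x i j = lam x ^+ 2 * pullback_metric gB x i j + rho x ^- 2 * (th x i * th x j).
Proof.
by move=> Mx; rewrite (adapted_metric adM Mx) !mxE big_ord1 !mxE.
Qed.

Lemma adapted_entry_fib x j : M x -> g x fib j = rho x ^- 2 * th x j.
Proof.
move=> Mx; rewrite adapted_entry // fibre_form_fib mul1r.
rewrite (_ : pullback_metric gB x fib j = 0) ?mulr0 ?add0r //.
by elim/ord4P: j => [j|]; rewrite /pullback_metric ?block_mxEdl ?block_mxEdr mxE.
Qed.

Lemma adapted_symmetric x : M x -> (g x)^T = g x.
Proof.
move=> Mx; apply/matrixP => i j; rewrite mxE !adapted_entry //.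
by have [-> //] := pullback_metric_entry i j; rewrite [th x j * _]mulrC.
Qed.

Let oM : open M := adapted_open adM.
Let rho_neq0 x : M x -> rho x != 0.
Proof. by move=> Mx; rewrite gt_eqF // (adapted_rho0 adM). Qed.
Let smV2 : smooth M (fun x => rho x ^- 2).
Proof.
have rs := adapted_rho adM.
apply: (smoothV oM _ (smoothM oM rs rs)) => x Mx.
by rewrite mulf_neq0 ?rho_neq0.
Qed.

Lemma pd_rhoV2 i x : M x -> pd i (fun y => rho y ^- 2) x = - 2 * pd i rho x / rho x ^+ 3.
Proof.
move=> Mx; have rs := adapted_rho adM; have r0 := rho_neq0 Mx.
have r20 : rho x ^+ 2 != 0 by rewrite expf_neq0.
have sq : smooth M (fun y => rho y ^+ 2) by exact: smoothM.
rewrite (@pdV _ _ M) // (_ : pd i (fun y => rho y ^+ 2) x = 2 * rho x * pd i rho x).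
  by field.
by rewrite (@pdM _ _ M _ _ i x rs rs Mx); ring.
Qed.

Lemma smooth_adapted : smooth_mx M g.
Proof.
move=> i j; have ls := adapted_lam adM.
have [_ pbs] := pullback_metric_entry i j.
have := smoothD oM (smoothM oM (smoothM oM ls ls) pbs)
  (smoothM oM smV2 (smoothM oM (smooth_fibre_form i) (smooth_fibre_form j))).
by apply: smooth_eq_on => // y My; rewrite adapted_entry.
Qed.

Lemma pd_adapted_fib i j x : M x -> pd i (fun y => g y fib j) x
  = - 2 * pd i rho x / rho x ^+ 3 * th x j + rho x ^- 2 * pd i (fun y => th y j) x.
Proof.
move=> Mx; rewrite (@pd_eq_on _ _ M _ (fun y => rho y ^- 2 * th y j) i x oM) //; last first.
  by move=> y My; rewrite adapted_entry_fib.
by rewrite (pdM i smV2 (smooth_fibre_form j) Mx) pd_rhoV2.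
Qed.

Lemma pd_fib_adapted i j x : M x -> pd fib (fun y => g y i j) x
  = 2 * lam x * pd fib lam x * pullback_metric gB x i j
    - 2 * pd fib rho x / rho x ^+ 3 * (th x i * th x j)
    + rho x ^- 2 * (pd fib (fun y => th y i) x * th x j + th x i * pd fib (fun y => th y j) x).
Proof.
move=> Mx; have ls := adapted_lam adM; have [_ pbs] := pullback_metric_entry i j.
have ts i := smooth_fibre_form i.
have ls2 := smoothM oM ls ls.
rewrite (@pd_eq_on _ _ M _ (fun y => lam y * lam y * pullback_metric gB y i j
   + rho y ^- 2 * (th y i * th y j)) fib x oM) //; last first.
  by move=> y My; rewrite adapted_entry.
rewrite (pdD fib (smoothM oM ls2 pbs) (smoothM oM smV2 (smoothM oM (ts i) (ts j))) Mx).
rewrite (pdM fib ls2 pbs Mx) (pdM fib ls ls Mx) pd_fib_pullback_metric.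
rewrite (pdM fib smV2 (smoothM oM (ts i) (ts j)) Mx) (pdM fib (ts i) (ts j) Mx).
by rewrite pd_rhoV2 //; field; exact: rho_neq0.
Qed.

End Adapted.

(** * The minimal Weyl derivative *)

Lemma wedgeE (R : realType) n (a b : 'rV[R]_n) i j :
  wedge a b i j = a 0 i * b 0 j - b 0 i * a 0 j.
Proof. by rewrite !mxE !big_ord1 !mxE. Qed.

Lemma ext_dE (R : realType) n (a : 'rV[R]_n -> 'rV[R]_n) x i j :
  ext_d a x i j = pd i (fun y => a y 0 j) x - pd j (fun y => a y 0 i) x.
Proof. by rewrite mxE. Qed.

Section MinimalWeyl.
Context {R : realType}.
Variables (M : set 'rV[R]_(3 + 1)) (g : 'rV[R]_(3 + 1) -> 'M[R]_(3 + 1))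
  (gB : 'rV[R]_3 -> 'M[R]_3) (lam rho : 'rV[R]_(3 + 1) -> R)
  (theta : 'rV[R]_(3 + 1) -> 'rV[R]_3).
Hypothesis adM : adapted M g gB lam rho theta.
Notation th x i := (fibre_form theta x 0 i).
Implicit Types (x : 'rV[R]_(3 + 1)) (a : 'rV[R]_(3 + 1) -> 'rV[R]_(3 + 1)).

Let oM : open M := adapted_open adM.
Let lam_neq0 x : M x -> lam x != 0.
Proof. by move=> Mx; rewrite gt_eqF // (adapted_lam0 adM). Qed.
Let rho_neq0 x : M x -> rho x != 0.
Proof. by move=> Mx; rewrite gt_eqF // (adapted_rho0 adM). Qed.

Lemma sum_pick (F : 'I_(3 + 1) -> R) i : \sum_k (k == i)%:R * F k = F i.
Proof.
rewrite (bigD1 i) //= eqxx mul1r big1 ?addr0 // => k /negbTE ->.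
by rewrite mul0r.
Qed.

Lemma adapted_fib_fib x : M x -> g x fib fib = rho x ^- 2.
Proof. by move=> Mx; rewrite (adapted_entry_fib adM) // fibre_form_fib mulr1. Qed.

Lemma sqrt_adapted x : M x -> Num.sqrt (g x fib fib) = (rho x)^-1.
Proof.
move=> Mx; rewrite adapted_fib_fib // -exprVn sqrtr_sqr ger0_norm // invr_ge0.
exact/ltW/(adapted_rho0 adM).
Qed.

Lemma xi_adapted x : M x -> xi g x = rho x *: d_fib.
Proof. by move=> Mx; rewrite /xi sqrt_adapted // invrK. Qed.

Lemma xi_entry x k : M x -> xi g x 0 k = (k == fib)%:R * rho x.
Proof. by move=> Mx; rewrite xi_adapted // !mxE eqxx mulrC. Qed.

Lemma xi_form_adapted x i : M x -> xi_form g x 0 i = (rho x)^-1 * th x i.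
Proof.
move=> Mx; rewrite mxE; under eq_bigr do rewrite xi_entry // -mulrA.
rewrite sum_pick (adapted_entry_fib adM) //.
by field; exact: rho_neq0.
Qed.

Lemma weylD_xi a x i k : M x -> weylD_vec0 g a (xi g) x i k
  = (k == fib)%:R * (pd i rho x - a x 0 i * rho x) + christoffel g a x k i fib * rho x.
Proof.
move=> Mx; rewrite mxE xi_entry //.
under eq_bigr do rewrite xi_entry // mulrCA.
rewrite sum_pick (@pd_eq_on _ _ M _ (fun y => (k == fib)%:R * rho y) i x oM) //; last first.
  by move=> y My; rewrite xi_entry.
rewrite (@pdM _ _ M (fun=> (k == fib)%:R) _ _ _ (@smooth_cst _ _ M _) (adapted_rho adM) Mx) pd_cst.
by ring.
Qed.

(** The covector dual to the acceleration of the fibres, before the contribution of a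
    itself is subtracted; it depends on a only through its vertical component. *)
Definition minimal_acceleration a x : 'rV[R]_(3 + 1) := \row_l
  (a x 0 fib * th x l + (pd l rho x - pd fib rho x * th x l) / rho x
   + pd fib (fun y => th y l) x).

(** Multiplying by g lowers the index, so that only Christoffel symbols of the first
    kind occur and the inverse metric is avoided. *)
Lemma xi_weylD_xi a x : M x ->
  xi g x *m weylD_vec0 g a (xi g) x *m g x = minimal_acceleration a x - a x.
Proof.
move=> Mx; apply/rowP => l.
have -> : (minimal_acceleration a x - a x) 0 l = a x 0 fib * th x l
    + (pd l rho x - pd fib rho x * th x l) / rho x + pd fib (fun y => th y l) x - a x 0 l.
  by rewrite !mxE.
rewrite [LHS]mxE.
have -> : \sum_j (xi g x *m weylD_vec0 g a (xi g) x) 0 j * g x j l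
   = rho x * ((pd fib rho x - a x 0 fib * rho x) * g x fib l
     + rho x * \sum_k g x l k * christoffel g a x k fib fib).
  rewrite mulrDr mulr_sumr -[X in X + _](sum_pick (fun k => rho x *
    ((pd fib rho x - a x 0 fib * rho x) * g x k l)) fib) mulr_sumr -big_split /=.
  apply: eq_bigr => k _.
  rewrite mxE (bigD1 fib) //= [X in _ + X]big1 ?addr0; last first.
    by move=> j /negbTE jf; rewrite xi_entry // jf !mul0r.
  have sym : g x l k = g x k l by rewrite -[in LHS](adapted_symmetric adM Mx) mxE.
  rewrite xi_entry // eqxx mul1r weylD_xi // sym; ring.
rewrite christoffel_lower ?(adapted_unitmx adM) // /dmetric.
rewrite !(pd_adapted_fib adM) // !(adapted_entry_fib adM) // !fibre_form_fib.
rewrite pd_fibre_form_fib; field; exact: rho_neq0.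
Qed.

(** The divergence of the fibres is the logarithmic derivative of the horizontal volume
    lam^3 along them. *)
Lemma trace_weylD_xi a x : M x ->
  \tr (weylD_vec0 g a (xi g) x) = 3 * rho x * (pd fib lam x / lam x + a x 0 fib).
Proof.
move=> Mx; rewrite /mxtrace; under eq_bigr do rewrite weylD_xi //.
rewrite big_split /= sum_pick -mulr_suml.
have gu := adapted_unitmx adM Mx.
have gT := adapted_symmetric adM.
rewrite (christoffel_trace a fib oM gT Mx gu); set H := invmx (g x).
have HT i l : H i l = H l i.
  have HH : H^T = H by rewrite /H trmx_inv gT.
  by rewrite -[in LHS]HH mxE.
have Hth i : \sum_l H i l * th x l = rho x ^+ 2 * (i == fib)%:R.
  have -> : (i == fib)%:R = (H *m g x) i fib by rewrite mulVmx // mxE.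
  rewrite mxE mulr_sumr; apply: eq_bigr => l _.
  rewrite (_ : g x l fib = g x fib l); last by rewrite -[in LHS](gT x Mx) mxE.
  by rewrite (adapted_entry_fib adM) //; field; exact: rho_neq0.
pose Q (F : 'I_(3 + 1) -> 'I_(3 + 1) -> R) := \sum_i \sum_l H i l * F i l.
have QD F G : Q (fun i l => F i l + G i l) = Q F + Q G.
  rewrite /Q -big_split; apply: eq_bigr => i _ /=; rewrite -big_split.
  by apply: eq_bigr => l _ /=; rewrite mulrDr.
have QZ c F : Q (fun i l => c * F i l) = c * Q F.
  rewrite /Q mulr_sumr; apply: eq_bigr => i _; rewrite mulr_sumr.
  by apply: eq_bigr => l _; rewrite mulrCA.
have Qth u : Q (fun i l => u i * th x l) = rho x ^+ 2 * u fib.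
  rewrite -(sum_pick u fib) mulr_sumr; apply: eq_bigr => i _.
  under eq_bigr do rewrite mulrCA.
  by rewrite -mulr_sumr Hth; ring.
have Qth' u : Q (fun i l => th x i * u l) = rho x ^+ 2 * u fib.
  rewrite -Qth /Q exchange_big; apply: eq_bigr => i _; apply: eq_bigr => l _ /=.
  by rewrite HT; ring.
have Qeq F G : (forall i l, F i l = G i l) -> Q F = Q G.
  by move=> FG; apply: eq_bigr => i _; apply: eq_bigr => l _; rewrite FG.
have Qpb : Q (fun i l => pullback_metric gB x i l) = 3 / lam x ^+ 2.
  have tr4 : Q (fun i l => g x i l) = 4.
    have <- : \tr (H *m g x) = 4 by rewrite mulVmx // mxtrace1.
    apply: eq_bigr => i _; rewrite mxE; apply: eq_bigr => l _.
    by rewrite -[in LHS](gT x Mx) mxE.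
  move: tr4; rewrite (Qeq _ _ (fun i l => adapted_entry adM i l Mx)) QD !QZ Qth fibre_form_fib.
  move=> tr4; have r20 : rho x ^+ 2 != 0 by rewrite expf_neq0 ?rho_neq0.
  have l20 : lam x ^+ 2 != 0 by rewrite expf_neq0 ?lam_neq0.
  move: tr4; rewrite mulr1 mulVf // => tr4.
  by apply: (mulfI l20); rewrite mulrCA mulfV // mulr1; lra.
rewrite -/(Q (fun i l => pd fib (fun y => g y i l) x)).
pose th' i := pd fib (fun y => th y i) x.
have -> : Q (fun i l => pd fib (fun y => g y i l) x) = Q (fun i l =>
    2 * lam x * pd fib lam x * pullback_metric gB x i l
    + (- 2 * pd fib rho x / rho x ^+ 3 * (th x i * th x l)
    + rho x ^- 2 * (th' i * th x l + th x i * th' l))).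
  by apply: Qeq => i l; rewrite (pd_fib_adapted adM) // /th'; ring.
rewrite !(QD, QZ) Qpb !Qth Qth' /th' fibre_form_fib pd_fibre_form_fib.
by field; rewrite lam_neq0 ?rho_neq0.
Qed.

Definition minimal_form x : 'rV[R]_(3 + 1) := \row_l
  (- (pd fib lam x / lam x) * th x l + (pd l rho x - pd fib rho x * th x l) / rho x
   + pd fib (fun y => th y l) x).

(** The trace condition fixes the vertical component of a, and the geodesic condition
    then fixes the remaining ones. *)
Lemma minimal_weylP a x : M x ->
  (xi g x *m weylD_vec0 g a (xi g) x = 0 /\ \tr (weylD_vec0 g a (xi g) x) = 0)
  <-> a x = minimal_form x.
Proof.
move=> Mx; have gu := adapted_unitmx adM Mx.
have r0 := rho_neq0 Mx; have l0 := lam_neq0 Mx.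
rewrite trace_weylD_xi //; have acc := xi_weylD_xi a Mx.
have fib_part : pd fib lam x / lam x + a x 0 fib = 0 <-> a x 0 fib = - (pd fib lam x / lam x).
  by split=> [/eqP|->]; [rewrite addrC addr_eq0 => /eqP|rewrite subrr].
split=> [[geo tr0]|aE].
  have /fib_part af : pd fib lam x / lam x + a x 0 fib = 0.
    by apply/eqP; move/eqP: tr0; rewrite !mulf_eq0 (negbTE r0) pnatr_eq0.
  move: acc; rewrite geo mul0mx => /esym/subr0_eq <-.
  by apply/rowP => l; rewrite !mxE af.
have af : a x 0 fib = - (pd fib lam x / lam x).
  rewrite aE mxE fibre_form_fib pd_fibre_form_fib.
  by rewrite !mulr1 subrr mul0r !addr0.
split; last by rewrite (fib_part.2 af) mulr0.
have acc0 : minimal_acceleration a x - a x = 0.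
  by apply/eqP; rewrite subr_eq0 aE; apply/eqP/rowP => l; rewrite !mxE af.
move: acc; rewrite acc0 => /(congr1 (fun m => m *m invmx (g x))).
by rewrite mul0mx mulmxK.
Qed.

Lemma smooth_minimal_form : smooth_rV M minimal_form.
Proof.
have ls := adapted_lam adM; have rs := adapted_rho adM => l.
have ts := smooth_fibre_form adM.
have lV := smoothV oM lam_neq0 ls; have rV := smoothV oM rho_neq0 rs.
have := smoothD oM (smoothD oM
  (smoothM oM (smoothN oM (smoothM oM (smooth_pd fib ls) lV)) (ts l))
  (smoothM oM (smoothB oM (smooth_pd l rs) (smoothM oM (smooth_pd fib rs) (ts l))) rV))
  (smooth_pd fib (ts l)).
by apply: (smooth_eq_on oM) => y My; rewrite [RHS]mxE.
Qed.

Lemma minimal_weyl_form : minimal_weyl M g minimal_form.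
Proof.
split; first exact: smooth_minimal_form.
by move=> x Mx; apply/minimal_weylP.
Qed.

(** The fibres are geodesics of D^0, so d^D xi has no vertical components; what is left
    is the curvature of the horizontal distribution. *)
Lemma weyl_ext_d_xi x : M x -> weyl_ext_d minimal_form (xi_form g) x
  = block_mx ((rho x)^-1 *: horiz_curvature theta x) 0 0 0.
Proof.
move=> Mx; have r0 := rho_neq0 Mx; have l0 := lam_neq0 Mx.
have rs := adapted_rho adM; have ts := smooth_fibre_form adM.
have dxi i j : pd i (fun y => xi_form g y 0 j) x
    = - pd i rho x / rho x ^+ 2 * th x j + (rho x)^-1 * pd i (fun y => th y j) x.
  rewrite (@pd_eq_on _ _ M _ (fun y => (rho y)^-1 * th y j) i x oM) //; last first.
    by move=> y My; rewrite xi_form_adapted.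
  by rewrite (pdM i (smoothV oM rho_neq0 rs) (ts j) Mx) (@pdV _ _ M).
have tb i : (fun y => th y (base i)) = (fun y => theta y 0 i).
  by apply/funext => y; rewrite fibre_form_base.
have entry i j : weyl_ext_d minimal_form (xi_form g) x i j =
    pd i (fun y => xi_form g y 0 j) x - pd j (fun y => xi_form g y 0 i) x
    + (minimal_form x 0 i * xi_form g x 0 j - minimal_form x 0 j * xi_form g x 0 i).
  by rewrite mxE ext_dE wedgeE [xi_form _ _ _ i * _]mulrC.
apply/matrixP => i j; rewrite entry !dxi !xi_form_adapted // ![minimal_form _ _ _]mxE.
elim/ord4P: i => [i|]; elim/ord4P: j => [j|];
  rewrite ?pd_fibre_form_fib ?fibre_form_fib ?fibre_form_base ?tb.
- have entryZ (P : 'M[R]_3) : ((rho x)^-1 *: P) i j = (rho x)^-1 * P i j by rewrite mxE.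
  rewrite block_mxEul entryZ [horiz_curvature theta x i j]mxE /horiz_pd.
  move: (pd _ _ x) (pd _ _ x) (pd _ _ x) (pd _ _ x) => *; field.
  by rewrite r0 l0.
- rewrite block_mxEur (_ : (0 : 'cV[R]_3) i ord0 = 0); last by rewrite mxE.
  by do !move: (pd _ _ x); move=> *; field; rewrite r0 l0.
- rewrite block_mxEdl (_ : (0 : 'rV[R]_3) ord0 j = 0); last by rewrite mxE.
  by do !move: (pd _ _ x); move=> *; field; rewrite r0 l0.
- rewrite block_mxEdr [RHS]mxE; ring.
Qed.

End MinimalWeyl.

(** * The Weyl derivative induced on the base *)

Lemma skew3_eq (R : realType) (A B : 'M[R]_3) : A^T = - A -> B^T = - B ->
  A o1 o2 = B o1 o2 -> A o2 o0 = B o2 o0 -> A o0 o1 = B o0 o1 -> A = B.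
Proof.
move=> AT BT e12 e20 e01.
have sk (C : 'M[R]_3) i j : C^T = - C -> C i j = - C j i.
  by move=> CT; have := congr1 (fun m : 'M_(_, _) => m j i) CT; rewrite !mxE.
have dg (C : 'M[R]_3) i : C^T = - C -> C i i = 0.
  by move=> CT; have := sk C i i CT; lra.
by apply/matrixP; elim/ord3P; elim/ord3P; rewrite ?dg ?e12 ?e20 ?e01 // sk // [RHS]sk // ?e12 ?e20 ?e01.
Qed.

Section InducedWeyl.
Context {R : realType}.
Variables (M : set 'rV[R]_(3 + 1)) (g : 'rV[R]_(3 + 1) -> 'M[R]_(3 + 1))
  (gB : 'rV[R]_3 -> 'M[R]_3) (lam rho : 'rV[R]_(3 + 1) -> R)
  (theta : 'rV[R]_(3 + 1) -> 'rV[R]_3).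
Hypothesis adM : adapted M g gB lam rho theta.
Implicit Types (x : 'rV[R]_(3 + 1)).

Let lam_neq0 x : M x -> lam x != 0.
Proof. by move=> Mx; rewrite gt_eqF // (adapted_lam0 adM). Qed.
Let rho_neq0 x : M x -> rho x != 0.
Proof. by move=> Mx; rewrite gt_eqF // (adapted_rho0 adM). Qed.

Lemma frame_horizontal_2form EB (b : 'M[R]_3) x :
  let E := adapted_frame lam rho theta EB x in
  E *m block_mx b 0 0 0 *m E^T = block_mx ((lam x)^-1 ^+ 2 *: (EB *m b *m EB^T)) 0 0 0.
Proof.
rewrite /= /adapted_frame tr_block_mx !mulmx_block.
rewrite !(mulmx0, mul0mx, addr0, trmx0) linearZ /= -!scalemxAl -scalemxAr scalerA.
by rewrite -expr2.
Qed.

Lemma row_fib_frame EB x : M x -> row fib (adapted_frame lam rho theta EB x) = xi g x.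
Proof.
move=> Mx; apply/rowP => j; rewrite (xi_entry adM) // [LHS]mxE.
elim/ord4P: j => [j|]; rewrite /adapted_frame.
  by rewrite block_mxEdl mxE eq_lrshift mul0r.
by rewrite block_mxEdr mxE !eqxx mul1r.
Qed.

Lemma row_mx_frame EB (a : 'rV[R]_3) x :
  row_mx a 0 *m (adapted_frame lam rho theta EB x)^T
  = row_mx ((lam x)^-1 *: (a *m EB^T)) 0.
Proof.
rewrite /adapted_frame tr_block_mx mul_row_block !mul0mx !addr0 trmx0 mulmx0.
by rewrite linearZ /= -scalemxAr.
Qed.

Lemma horiz_curvature_skew x : (horiz_curvature theta x)^T = - horiz_curvature theta x.
Proof. by apply/matrixP => i j; rewrite !mxE; ring. Qed.

(** The horizontal part of the derivative of the relative length scale, corrected by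
    the vertical derivative of the connection form. *)
Definition scale_form x : 'rV[R]_3 := \row_i
  (horiz_pd theta i (fun y => rho y * lam y) x
   + rho x * lam x * pd fib (fun y => theta y 0 i) x).

Lemma minimal_form_scale x : M x ->
  minimal_form lam rho theta x + (lam x)^-1 *: dfun lam x
  = row_mx ((rho x * lam x)^-1 *: scale_form x) 0.
Proof.
move=> Mx; have r0 := rho_neq0 Mx; have l0 := lam_neq0 Mx.
have ls := adapted_lam adM; have rs := adapted_rho adM.
have tb i : (fun y => fibre_form theta y 0 (base i)) = (fun y => theta y 0 i).
  by apply/funext => y; rewrite fibre_form_base.
apply/rowP; elim/ord4P => [i|]; rewrite [LHS]mxE ?row_mxEl ?row_mxEr.
  rewrite [X in X + _]mxE [X in _ + X]mxE [X in _ + _ * X]mxE [RHS]mxE [X in _ = _ * X]mxE.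
  rewrite fibre_form_base tb /horiz_pd !(pdM _ rs ls Mx).
  by field; rewrite r0 l0.
rewrite [X in X + _]mxE [X in _ + X]mxE [X in _ + _ * X]mxE [RHS]mxE.
rewrite fibre_form_fib pd_fibre_form_fib.
by field; rewrite r0 l0.
Qed.

(** In an orthonormal frame the 1-form omega is, up to the scale rho, the
    3-dimensional dual of the curvature of the horizontal distribution. *)
Lemma induced_weylP (h : 'rV[R]_3 -> 'rV[R]_3) x : M x ->
  (minimal_form lam rho theta x + omega g (minimal_form lam rho theta) x
     + (lam x)^-1 *: dfun lam x = pullback h x)
  <-> star1 (gB (pi x)) (scale_form x - (rho x * lam x) *: h (pi x))
      = horiz_curvature theta x.
Proof.
move=> Mx; have r0 := rho_neq0 Mx; have l0 := lam_neq0 Mx.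
have [EB oEB] := adapted_orthoframe adM Mx.
have oE := adapted_frame_ortho adM Mx oEB.
set E := adapted_frame lam rho theta EB x in oE.
have unitE n (G F : 'M[R]_n) : orthoframe G F -> F \in unitmx.
  by move=> [_ d]; rewrite unitmxE unitfE gt_eqF.
have Eu : E^T \in unitmx by rewrite unitmx_tr (unitE _ _ _ oE).
have EBu := unitE _ _ _ oEB.
set Psi := horiz_curvature theta x; pose P := EB *m Psi *m EB^T.
have PT : P^T = - P.
  rewrite /P !trmx_mul trmxK mulmxA horiz_curvature_skew.
  by rewrite mulmxN mulNmx.
have omegaE : omega g (minimal_form lam rho theta) x *m E^T
    = - row fib (star2 1%:M (block_mx ((lam x)^-1 ^+ 2 * (rho x)^-1 *: P) 0 0 0)).
  rewrite /omega (weyl_ext_d_xi adM) // mulNmx -(row_fib_frame EB Mx) -/E.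
  congr (- _); rewrite -!row_mul star2_frame // /E.
  by rewrite frame_horizontal_2form -/E /P -!scalemxAr -!scalemxAl scalerA.
set u := scale_form x - (rho x * lam x) *: h (pi x).
set s2P := (_ *: P) in omegaE.
have s2T : (block_mx s2P 0 0 (0 : 'M_1))^T = - block_mx s2P 0 0 0.
  rewrite tr_block_mx !trmx0 /s2P linearZ /= PT opp_block_mx !oppr0 scalerN.
  by [].
have [[S0 S1 S2] _ ST] := star2_1E s2T.
set S := star2 1%:M _ in S0 S1 S2 ST omegaE.
have S3 : S fib fib = 0.
  by have := congr1 (fun m : 'M_(_, _) => m fib fib) ST; rewrite !mxE; lra.
pose dual : 'rV[R]_3 := \row_c S fib (base c).
have omega_dual : omega g (minimal_form lam rho theta) x *m E^T = row_mx (- dual) 0.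
  rewrite omegaE; apply/rowP; elim/ord4P => [c|].
    by rewrite row_mxEl [LHS]mxE [X in - X = _]mxE [RHS]mxE [X in _ = - X]mxE.
  by rewrite row_mxEr [LHS]mxE [X in - X = _]mxE S3 [RHS]mxE oppr0.
have P_dual : P = star1 1%:M (u *m EB^T) <-> dual = ((lam x)^-1 ^+ 2 * (rho x)^-1) *: (u *m EB^T).
  have [U0 U1 U2 UT] := star1_1E (u *m EB^T).
  have c0 : (lam x)^-1 ^+ 2 * (rho x)^-1 != 0 by rewrite mulf_neq0 ?expf_neq0 ?invr_eq0.
  have dE : [/\ dual 0 o0 = (lam x)^-1 ^+ 2 * (rho x)^-1 * P o1 o2,
     dual 0 o1 = (lam x)^-1 ^+ 2 * (rho x)^-1 * P o2 o0 &
     dual 0 o2 = (lam x)^-1 ^+ 2 * (rho x)^-1 * P o0 o1].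
    by split; rewrite mxE ?S0 ?S1 ?S2 block_mxEul [LHS]mxE.
  have [d0 d1 d2] := dE.
  split=> [PE|dual_u].
    apply/rowP; elim/ord3P; rewrite [RHS]mxE.
    - by rewrite d0 PE U0.
    - by rewrite d1 PE U1.
    - by rewrite d2 PE U2.
  apply: skew3_eq => //; rewrite ?U0 ?U1 ?U2; apply: (mulfI c0).
  - by rewrite -d0 dual_u mxE.
  - by rewrite -d1 dual_u mxE.
  - by rewrite -d2 dual_u mxE.
have star_P : star1 (gB (pi x)) u = Psi <-> P = star1 1%:M (u *m EB^T).
  rewrite -(star1_frame u oEB) /P; split=> [->//|].
  have EBTu : EB^T \in unitmx by rewrite unitmx_tr.
  by move=> /(congr1 (fun m => m *m invmx EB^T)); rewrite !mulmxK // =>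
     /(congr1 (fun m => invmx EB *m m)); rewrite !mulKmx.
apply: iff_trans (iff_sym star_P); apply: iff_trans (iff_sym P_dual).
rewrite [minimal_form _ _ _ _ + _]addrC -addrA minimal_form_scale // /pullback.
have r1 : rho x * lam x != 0 by rewrite mulf_neq0.
have -> : (omega g (minimal_form lam rho theta) x
     + row_mx ((rho x * lam x)^-1 *: scale_form x) 0 = row_mx (h (pi x)) 0)
  <-> omega g (minimal_form lam rho theta) x = row_mx (- ((rho x * lam x)^-1 *: u)) 0.
  have -> : row_mx (- ((rho x * lam x)^-1 *: u)) (0 : 'M_1)
      = row_mx (h (pi x)) 0 - row_mx ((rho x * lam x)^-1 *: scale_form x) 0.
    rewrite opp_row_mx add_row_mx subrr /u scalerBr scalerA mulVf // scale1r opprB.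
    by [].
  by split=> [<-|->]; rewrite ?addrK ?subrK.
have -> : (omega g (minimal_form lam rho theta) x = row_mx (- ((rho x * lam x)^-1 *: u)) 0)
  <-> row_mx (- dual) 0 = row_mx (- ((rho x * lam x)^-1 *: u)) (0 : 'M_1) *m E^T.
  rewrite -omega_dual; split=> [->//|].
  by move=> /(congr1 (fun m => m *m invmx E^T)); rewrite !mulmxK.
rewrite row_mx_frame.
have -> : (lam x)^-1 *: (- ((rho x * lam x)^-1 *: u) *m EB^T)
   = - (((lam x)^-1 ^+ 2 * (rho x)^-1) *: (u *m EB^T)).
  rewrite mulNmx scalerN -scalemxAl scalerA; congr (- (_ *: _)).
  by field; rewrite l0 r0.
by split=> [/eq_row_mx[/oppr_inj]|->].
Qed.

End InducedWeyl.

(** * Smooth Gram-Schmidt orthonormalization *)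

Section GramSchmidt.
Context {R : realType}.
Implicit Type G : 'M[R]_3.

Definition minor2 G : R := G o0 o0 * G o1 o1 - G o0 o1 ^+ 2.

(** The rows are the first coordinate vector, a multiple of the second one corrected to be
    orthogonal to it, and the last row of the adjugate, which is orthogonal to both. *)
Definition gram_rows G : 'M[R]_3 := \matrix_(i, j) nth 0 (nth [::]
  [:: [:: 1; 0; 0]; [:: - G o0 o1; G o0 o0; 0];
      [:: G o0 o1 * G o1 o2 - G o0 o2 * G o1 o1;
          G o0 o1 * G o0 o2 - G o0 o0 * G o1 o2; minor2 G]] i) j.

Definition gram_norms G : 'rV[R]_3 := \row_i nth 0
  [:: G o0 o0; G o0 o0 * minor2 G; minor2 G * \det G] i.

(** An explicit formula for the orthonormal frame, built from square roots of the leading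
    minors, makes its smooth dependence on the metric visible. *)
Definition gram_schmidt G : 'M[R]_3 :=
  \matrix_(i, j) ((Num.sqrt (gram_norms G 0 i))^-1 * gram_rows G i j).

Lemma gram_rowsE G : G^T = G -> gram_rows G *m G *m (gram_rows G)^T = diag_mx (gram_norms G).
Proof.
move=> GT; have sym i j : G i j = G j i by rewrite -[in LHS]GT mxE.
apply/matrixP => i j; elim/ord3P: i; elim/ord3P: j;
  rewrite [LHS]mxE sum3 ![(gram_rows G *m G) _ _]mxE !sum3 !mxE -?val_eqE /= ?det3 /minor2
    ?(sym o1 o0) ?(sym o2 o0) ?(sym o2 o1); ring.
Qed.

Lemma ip_rows n (H A : 'M[R]_n) k l : ip H (row k A) (row l A) = (A *m H *m A^T) k l.
Proof.
rewrite /ip -row_mul [LHS]mxE [RHS]mxE; apply: eq_bigr => j _.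
by congr (_ * _); [rewrite mxE|rewrite !mxE].
Qed.

Definition posdef n (G : 'M[R]_n) : Prop := forall v : 'rV[R]_n, v != 0 -> 0 < ip G v v.

Lemma gram_norm_pos G i : G^T = G -> posdef G -> 0 < gram_norms G 0 i.
Proof.
move=> GT pG.
have normE k : gram_norms G 0 k = ip G (row k (gram_rows G)) (row k (gram_rows G)).
  by rewrite ip_rows gram_rowsE // [RHS]mxE eqxx mulr1n.
have pos k j : gram_rows G k j != 0 -> 0 < gram_norms G 0 k.
  move=> kj; rewrite normE; apply: pG; apply: contraNneq kj => k0.
  by have := congr1 (fun m : 'rV_3 => m 0 j) k0; rewrite !mxE => ->.
have G0 : 0 < G o0 o0.
  have := pos o0 o0; rewrite !mxE /=; apply; exact: oner_neq0.
have m0 : 0 < minor2 G.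
  have := pos o1 o1; rewrite !mxE /= => /(_ (lt0r_neq0 G0)).
  by rewrite pmulr_rgt0.
elim/ord3P: i; first by rewrite mxE.
  by rewrite mxE /= mulr_gt0.
by apply: (pos o2 o2); rewrite mxE /= lt0r_neq0.
Qed.

Lemma gram_schmidt_orthoframe G : G^T = G -> posdef G -> orthoframe G (gram_schmidt G).
Proof.
move=> GT pG; pose S := diag_mx (\row_i (Num.sqrt (gram_norms G 0 i))^-1).
have gsE : gram_schmidt G = S *m gram_rows G.
  by apply/matrixP => i j; rewrite mul_diag_mx !mxE.
have n0 i := gram_norm_pos i GT pG.
split.
  have -> : gram_schmidt G *m G *m (gram_schmidt G)^T
      = S *m (gram_rows G *m G *m (gram_rows G)^T) *m S^T.
    by rewrite gsE trmx_mul !mulmxA.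
  rewrite gram_rowsE // /S tr_diag_mx !mulmx_diag; move: (gram_norms G) n0 => N n0.
  apply/matrixP => i j; rewrite !mxE.
  case: eqP => [->|//]; rewrite ?mulr1n ?mulr0n //.
  rewrite mulrAC -expr2 exprVn sqr_sqrtr; last exact: ltW.
  by rewrite mulVf // lt0r_neq0.
rewrite gsE det_mulmx det_diag mulr_gt0 //.
  by apply: prodr_gt0 => i _; rewrite mxE invr_gt0 sqrtr_gt0.
have := n0 o0; have := n0 o1; rewrite det3 !mxE /= => n1 G0.
rewrite !(mul0r, mulr0, subr0, addr0, mul1r) pmulr_rgt0 //.
by move: n1; rewrite pmulr_rgt0.
Qed.

Lemma smooth_det3 m (U : set 'rV[R]_m) (F : 'rV[R]_m -> 'M[R]_3) : open U ->
  (forall i j, smooth U (fun x => F x i j)) -> smooth U (fun x => \det (F x)).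
Proof.
move=> oU Fs.
pose s2 i j k l := smoothB oU (smoothM oU (Fs i j) (Fs k l)) (smoothM oU (Fs i l) (Fs k j)).
have := smoothD oU (smoothB oU (smoothM oU (Fs o0 o0) (s2 o1 o1 o2 o2))
  (smoothM oU (Fs o0 o1) (s2 o1 o0 o2 o2))) (smoothM oU (Fs o0 o2) (s2 o1 o0 o2 o1)).
by apply: (smooth_eq_on oU) => y _; rewrite det3.
Qed.

Lemma smooth_gram_schmidt m (U : set 'rV[R]_m) (F : 'rV[R]_m -> 'M[R]_3) : open U ->
  (forall i j, smooth U (fun x => F x i j)) ->
  (forall x, U x -> (F x)^T = F x /\ posdef (F x)) ->
  forall i j, smooth U (fun x => gram_schmidt (F x) i j).
Proof.
move=> oU Fs Fp i j.
have ms : smooth U (fun x => minor2 (F x)).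
  exact: (smoothB oU (smoothM oU (Fs _ _) (Fs _ _)) (smoothM oU (Fs _ _) (Fs _ _))).
have c0 : smooth U (fun=> 0 : R) by exact: smooth_cst.
have c1 : smooth U (fun=> 1 : R) by exact: smooth_cst.
have ns : smooth U (fun x => gram_norms (F x) 0 i).
  have := smoothM oU ms (smooth_det3 oU Fs); have := smoothM oU (Fs o0 o0) ms.
  elim/ord3P: i => s1 s2; [have := Fs o0 o0|move: s1|move: s2];
    apply: (smooth_eq_on oU) => y _; by rewrite mxE.
have rs : smooth U (fun x => gram_rows (F x) i j).
  have s2 a b c d e f g h := smoothB oU (smoothM oU (Fs a b) (Fs c d)) (smoothM oU (Fs e f) (Fs g h)).
  elim/ord3P: i {ns}; elim/ord3P: j;
   [move: c1|move: c0|move: c0|have := smoothN oU (Fs o0 o1)|have := Fs o0 o0|move: c0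
    |have := s2 o0 o1 o1 o2 o0 o2 o1 o1|have := s2 o0 o1 o0 o2 o0 o0 o1 o2|move: ms];
   apply: (smooth_eq_on oU) => y _; by rewrite mxE.
have n0 x : U x -> 0 < gram_norms (F x) 0 i.
  by move=> /Fp[FT pF]; exact: gram_norm_pos.
have sn0 x : U x -> Num.sqrt (gram_norms (F x) 0 i) != 0.
  by move=> Ux; rewrite lt0r_neq0 // sqrtr_gt0 n0.
have := smoothM oU (smoothV oU sn0 (smooth_sqrt oU n0 ns)) rs.
by apply: (smooth_eq_on oU) => y _; rewrite [RHS]mxE.
Qed.

End GramSchmidt.

(** * Conformal submersions are adapted *)

Section Submersion.
Context {R : realType}.

Lemma rank_one_entry n (A : 'M[R]_n) (f : 'rV[R]_n) c d i j :
  (c *: A + d *: (f^T *m f)) i j = c * A i j + d * (f 0 i * f 0 j).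
Proof. by rewrite !mxE big_ord1 !mxE. Qed.

Lemma ip_delta n (H : 'M[R]_n) i j : ip H (delta_mx 0 i) (delta_mx 0 j) = H i j.
Proof. by rewrite /ip -rowE trmx_delta -colE !mxE. Qed.

Lemma ip_subr n (H : 'M[R]_n) u w z b : ip H u (w - b *: z) = ip H u w - b * ip H u z.
Proof. by rewrite /ip linearB linearZ /= mulmxBr -scalemxAr !mxE. Qed.

Lemma ip_subl n (H : 'M[R]_n) u w z b : ip H (w - b *: z) u = ip H w u - b * ip H z u.
Proof. by rewrite /ip !mulmxBl -!scalemxAl !mxE. Qed.

Lemma ipZl n (H : 'M[R]_n) u v a : ip H (a *: u) v = a * ip H u v.
Proof. by rewrite /ip -!scalemxAl mxE. Qed.

Variables (M : set 'rV[R]_(3 + 1)) (g : 'rV[R]_(3 + 1) -> 'M[R]_(3 + 1))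
  (B : set 'rV[R]_3) (gB : 'rV[R]_3 -> 'M[R]_3) (lam : 'rV[R]_(3 + 1) -> R).
Hypothesis csM : conformal_submersion M B g gB lam.

Definition vert_scale (g' : 'rV[R]_(3 + 1) -> 'M[R]_(3 + 1)) x : R := (Num.sqrt (g' x fib fib))^-1.

Definition horiz_form (g' : 'rV[R]_(3 + 1) -> 'M[R]_(3 + 1)) x : 'rV[R]_3 :=
  \row_i (g' x (base i) fib / g' x fib fib).

Lemma lsubmx_d_fib : pi (d_fib : 'rV[R]_(3 + 1)) = 0.
Proof. exact: lsubmx_fib. Qed.

Lemma vertical_scale (v : 'rV[R]_(3 + 1)) : pi v = 0 -> v = v 0 fib *: d_fib.
Proof.
move=> v0; have := @eq_pi_fib R 0 v; rewrite v0 linear0 => /(_ erefl).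
by rewrite add0r mxE subr0.
Qed.

Lemma horizontal_lift x i : g x fib fib != 0 -> (g x)^T = g x ->
  horizontal g x (delta_mx 0 (base i) - horiz_form g x 0 i *: d_fib).
Proof.
move=> gff gT V /vertical_scale ->; rewrite ipZl ip_subr /d_fib !ip_delta.
have sym : g x fib (base i) = g x (base i) fib by rewrite -[in LHS]gT mxE.
by rewrite sym [horiz_form _ _ _ _]mxE divfK // subrr mulr0.
Qed.

Lemma d_fib_neq0 : d_fib != 0 :> 'rV[R]_(3 + 1).
Proof.
apply/eqP => /(congr1 (fun u : 'rV_(3 + 1) => u 0 fib)); rewrite !mxE !eqxx.
exact/eqP/oner_neq0.
Qed.

(** The horizontal lift of the coordinate vector i is e_i - theta_i d/ds with
    theta_i = g(e_i, d/ds) / g(d/ds, d/ds); conformality compares g on lifts with gB. *)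
Lemma submersion_adapted : adapted M g gB lam (vert_scale g) (horiz_form g).
Proof.
have [[oM gs gp] [oB gBs gBp] piM ls lP] := csM.
have Bpi x : M x -> B (pi x) by move=> Mx; rewrite -piM; exists x.
have gff0 x : M x -> 0 < g x fib fib.
  by move=> /gp[_ /(_ d_fib d_fib_neq0)]; rewrite ip_delta.
have gff x : M x -> g x fib fib != 0 by move=> /gff0/lt0r_neq0.
have sq0 x : M x -> Num.sqrt (g x fib fib) != 0.
  by move=> /gff0 g0; rewrite lt0r_neq0 // sqrtr_gt0.
split; [exact: oM|exact: ls| | | | | | | |].
- exact: smoothV oM sq0 (smooth_sqrt oM gff0 (gs fib fib)).
- move=> i; have := smoothM oM (gs (base i) fib) (smoothV oM gff (gs fib fib)).
  by apply: (smooth_eq_on oM) => y _; rewrite mxE.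
- move=> i j; have := smooth_lsubmx oB (gBs i j).
  exact: smooth_subset.
- by move=> x /lP[].
- by move=> x /gff0 g0; rewrite invr_gt0 sqrtr_gt0.
- by move=> x /Bpi/gBp[].
- move=> x /Bpi/gBp[gT gpos]; exists (gram_schmidt (gB (pi x))).
  exact: gram_schmidt_orthoframe.
move=> x Mx; have [gT gpos] := gp x Mx; have [l0 lE] := lP x Mx.
have sym i j : g x i j = g x j i by rewrite -[in LHS]gT mxE.
have rho2 : vert_scale g x ^- 2 = g x fib fib.
  by rewrite exprVn invrK sqr_sqrtr // ltW // gff0.
have lift i : pi (delta_mx 0 (base i) - horiz_form g x 0 i *: d_fib) = delta_mx 0 i.
  by rewrite linearB /= linearZ /= lsubmx_base lsubmx_d_fib scaler0 subr0.
have hl i := horizontal_lift i (gff x Mx) gT.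
have gb i j : g x (base i) (base j) = lam x ^+ 2 * gB (pi x) i j
    + g x fib fib * (horiz_form g x 0 i * horiz_form g x 0 j).
  have := lE _ _ (hl i) (hl j); rewrite !lift ip_delta => <-.
  rewrite ip_subl !ip_subr /d_fib !ip_delta ![horiz_form _ _ _ _]mxE (sym fib (base j)); field.
  exact: gff.
apply/matrixP => i j; rewrite rho2.
have -> : (lam x ^+ 2 *: pullback_metric gB x + g x fib fib *:
   ((fibre_form (horiz_form g) x)^T *m fibre_form (horiz_form g) x)) i j
  = lam x ^+ 2 * pullback_metric gB x i j + g x fib fib *
     (fibre_form (horiz_form g) x 0 i * fibre_form (horiz_form g) x 0 j).
  exact: rank_one_entry.
elim/ord4P: i => [i|]; elim/ord4P: j => [j|]; rewrite ?fibre_form_base ?fibre_form_fib.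
- by rewrite gb /pullback_metric block_mxEul.
- rewrite /pullback_metric block_mxEur mxE mulr0 add0r mxE.
  field; exact: gff.
- rewrite /pullback_metric block_mxEdl mxE mulr0 add0r mxE sym.
  field; exact: gff.
- by rewrite /pullback_metric block_mxEdr mxE mulr0 add0r !mulr1.
Qed.

Lemma star1_linear (G : 'M[R]_3) c (a b : 'rV[R]_3) :
  star1 G (c *: a + b) = c *: star1 G a + star1 G b.
Proof.
have S (u : 'rV[R]_3) k l : star1 G u k l
    = \sum_m (u *m invmx G) 0 m * vol G [:: delta_mx 0 m; delta_mx 0 k; delta_mx 0 l].
  rewrite mxE.
  rewrite (@vol_row_linear _ _ G (fun u => [:: u; delta_mx 0 k; delta_mx 0 l]) o0) //.
  by move=> ? ? [[|[|[|]]]].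
have entry p q (A C : 'M[R]_(p, q)) i j : (c *: A + C) i j = c * A i j + C i j.
  by rewrite !mxE.
apply/matrixP => k l; rewrite entry !S mulr_sumr -big_split.
by apply: eq_bigr => m _ /=; rewrite mulmxDl -scalemxAl entry; ring.
Qed.

Lemma star1Z (G : 'M[R]_3) c (a : 'rV[R]_3) : star1 G (c *: a) = c *: star1 G a.
Proof.
have z : star1 G 0 = 0.
  have := star1_linear G 1 0 0; rewrite scaler0 addr0 scale1r => /eqP.
  by rewrite -subr_eq0 opprD addNKr oppr_eq0 => /eqP.
by have := star1_linear G c a 0; rewrite z !addr0.
Qed.

(** The vector field dual to dt is parallel when dt is. *)
Lemma fibre_parallel_inv (N : set 'rV[R]_(3 + 1)) gam t : affine_coordinate N gam t ->
  open N -> fibre_parallel N gam (fun x => (pd fib t x)^-1).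
Proof.
move=> [ts tP] oN x Nx; have [s0 s'] := tP x Nx.
rewrite /fibre_nabla (@pdV _ _ N) //; [|exact: lt0r_neq0|exact: smooth_pd].
have -> : pd fib (pd fib t) x = gam x * pd fib t x by apply/eqP; rewrite -subr_eq0 s'.
by field; exact: lt0r_neq0.
Qed.

End Submersion.

(** * An affine fibre coordinate *)

Section AffineCoordinate.
Context {R : realType}.
Variables (M : set 'rV[R]_(3 + 1)) (g : 'rV[R]_(3 + 1) -> 'M[R]_(3 + 1))
  (B : set 'rV[R]_3) (gB : 'rV[R]_3 -> 'M[R]_3) (lam gam t : 'rV[R]_(3 + 1) -> R).
Hypotheses (csM : conformal_submersion M B g gB lam)
  (affM : affine_submersion M B g lam gam) (tM : affine_coordinate M gam t).
Implicit Types (x : 'rV[R]_(3 + 1)) (i j : 'I_3).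

Let adM := submersion_adapted csM.
Let oM : open M := adapted_open adM.
Let th i x : R := horiz_form g x 0 i.
Let s := pd fib t.

Definition unit_scale x : R := vert_scale g x * lam x.
(** The relative length scale measured by dt, and its would-be Taylor coefficients in t. *)
Definition coord_weight x : R := unit_scale x * s x.
Definition coord_weight1 x : R := pd fib unit_scale x + gam x * unit_scale x.
Definition coord_weight0 x : R := coord_weight x - t x * coord_weight1 x.

(** Writing s for the derivative of t along the fibre, s (dx_fib + theta)
    equals dt + coord_form: this is the connection form in the coordinate t. *)
Definition coord_form i x : R := s x * th i x - pd (base i) t x.
Definition coord_form1 i x : R := gam x * th i x + pd fib (th i) x - pd (base i) s x / s x.
Definition coord_form0 i x : R := coord_form i x - t x * coord_form1 i x.

Let ts : smooth M t. Proof. by case: tM. Qed.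
Let ss : smooth M s. Proof. exact: smooth_pd. Qed.
Let s0 x : M x -> 0 < s x. Proof. by case: tM => _ tP /tP[]. Qed.
Let sn0 x : M x -> s x != 0. Proof. by move=> /s0/lt0r_neq0. Qed.
Let s' x : M x -> pd fib s x = gam x * s x.
Proof. by case: tM => _ tP /tP[_ /eqP]; rewrite subr_eq0 => /eqP. Qed.
Let gs : smooth M gam. Proof. by case: affM. Qed.
Let rs : smooth M unit_scale. Proof. exact: smoothM oM (adapted_rho adM) (adapted_lam adM). Qed.
Let hs i : smooth M (th i). Proof. exact: adapted_theta adM i. Qed.
Lemma coord_weight1_smooth : smooth M coord_weight1.
Proof. exact: smoothD oM (smooth_pd fib rs) (smoothM oM gs rs). Qed.
Let Ws : smooth M coord_weight. Proof. exact: smoothM oM rs ss. Qed.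
Lemma coord_weight0_smooth : smooth M coord_weight0. Proof. exact: smoothB oM Ws (smoothM oM ts coord_weight1_smooth). Qed.
Let As i : smooth M (coord_form i).
Proof. exact: smoothB oM (smoothM oM ss (hs i)) (smooth_pd _ ts). Qed.
Lemma coord_form1_smooth i : smooth M (coord_form1 i).
Proof.
exact: smoothB oM (smoothD oM (smoothM oM gs (hs i)) (smooth_pd fib (hs i)))
  (smoothM oM (smooth_pd _ ss) (smoothV oM sn0 ss)).
Qed.
Lemma coord_form0_smooth i : smooth M (coord_form0 i).
Proof. exact: smoothB oM (As i) (smoothM oM ts (coord_form1_smooth i)). Qed.

Lemma rel_scaleE x : rel_scale g lam x = unit_scale x.
Proof. exact: mulrC. Qed.

(** This is the affine condition on the length scale, tested on a constant section of L_B. *)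
Lemma coord_weight1_fib x : M x -> pd fib coord_weight1 x = 0.
Proof.
move=> Mx; have [_ _ /(_ (fun=> 1) (@smooth_cst _ _ B 1) x Mx)] := affM.
have -> : (fun y => 1 * rel_scale g lam y) = unit_scale.
  by apply/funext => y; rewrite mul1r rel_scaleE.
by [].
Qed.

Lemma coord_weight0_fib x : M x -> pd fib coord_weight0 x = 0.
Proof.
move=> Mx; rewrite (pdB fib Ws (smoothM oM ts coord_weight1_smooth) Mx) (pdM fib rs ss Mx).
rewrite (pdM fib ts coord_weight1_smooth Mx) coord_weight1_fib // s' // /coord_weight1 -/s.
by move: (pd fib unit_scale x) => ?; ring.
Qed.

(** The affine condition on the horizontal bundle, applied to the parallel field dual to dt:
    its bracket with a horizontal lift is coord_form1 times this field. *)
Lemma coord_form1_fib i x : M x -> pd fib (coord_form1 i) x = 0.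
Proof.
move=> Mx; have [_ affH _] := affM.
pose Xt (y : 'rV[R]_(3 + 1)) : 'rV[R]_(3 + 1) := delta_mx 0 (base i) - th i y *: d_fib.
pose u (y : 'rV[R]_(3 + 1)) := (s y)^-1.
have us : smooth M u by exact: smoothV oM sn0 ss.
have [] := affH (fun=> delta_mx 0 i) Xt _ _ u us (fibre_parallel_inv tM oM).
- by move=> j; exact: smooth_cst.
- move=> y My; split.
    by rewrite linearB /= linearZ /= lsubmx_base lsubmx_d_fib scaler0 subr0.
  have [[_ _ gp] _ _ _ _] := csM; have [gT gpos] := gp y My.
  apply: horizontal_lift => //; apply: lt0r_neq0.
  by have := gpos _ d_fib_neq0; rewrite ip_delta.
move=> _ /(_ x Mx).
have Xb y k : Xt y 0 k = (k == base i)%:R - th i y * (k == fib)%:R.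
  by rewrite mxE [X in X + _]mxE [X in _ + X]mxE [X in _ - X]mxE [X in _ - _ * X]mxE !eqxx.
have Xf : (fun y => Xt y 0 fib) = (fun y => - th i y).
  by apply/funext => y; rewrite Xb eqxx mulr1 eq_rlshift sub0r.
have uf : (fun y => (u y *: d_fib) 0 fib) = u.
  by apply/funext => y; rewrite !mxE !eqxx mulr1.
have ub y k : (u y *: d_fib) 0 k = u y * (k == fib)%:R by rewrite !mxE eqxx.
(* The field u d/ds is dual to dt, so its bracket with the horizontal lift is
   computed from the derivatives of the connection form along the fibre. *)
have Zf y : M y -> bracket Xt (fun x0 => u x0 *: d_fib) y 0 fib = coord_form1 i y * u y.
  move=> My; rewrite mxE uf Xf.
  transitivity (\sum_k ((k == base i)%:R * pd k u y + (k == fib)%:R *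
      (- th i y * pd k u y - u y * pd k (fun y => - th i y) y))).
    by apply: eq_bigr => k _; rewrite Xb ub; case: (k == fib) => /=; ring.
  rewrite big_split /= !sum_pick (@pdV _ _ M) ?sn0 // (@pdV _ _ M) ?sn0 //.
  rewrite (pdN fib (hs i) My) s' // /coord_form1 /u.
  by field; exact: sn0.
move=> nabZ; have : pd fib (fun y => coord_form1 i y * u y) x
    + gam x * (coord_form1 i x * u x) = 0.
  by rewrite -(Zf x Mx) -(pd_eq_on fib oM Zf Mx).
rewrite (pdM fib (coord_form1_smooth i) us Mx) (@pdV _ _ M) ?sn0 // s' // /u => Z0.
have : (pd fib (coord_form1 i) x) / s x = 0 by rewrite -Z0; field; exact: sn0.
by move/eqP; rewrite mulf_eq0 invr_eq0 (negbTE (sn0 Mx)) orbF => /eqP.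
Qed.

Lemma coord_form0_fib i x : M x -> pd fib (coord_form0 i) x = 0.
Proof.
move=> Mx; rewrite (pdB fib (As i) (smoothM oM ts (coord_form1_smooth i)) Mx).
rewrite (pdB fib (smoothM oM ss (hs i)) (smooth_pd (base i) ts) Mx).
rewrite (pdM fib ss (hs i) Mx) (pdM fib ts (coord_form1_smooth i) Mx) coord_form1_fib // s' //.
rewrite (pdC fib (base i) oM ts Mx) -/s /coord_form1.
move: (pd fib (th i) x) (pd (base i) s x) => a b.
by field; exact: sn0.
Qed.

(** Rewriting the left-hand side of the equation of the induced Weyl derivative as
    a polynomial in t whose coefficients are the forms in the monopole equations. *)
Lemma coord_monopole_form (h : 'rV[R]_3) x i : M x ->
  s x * (scale_form lam (vert_scale g) (horiz_form g) x - unit_scale x *: h) 0 i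
  = t x * (pd (base i) coord_weight1 x - coord_weight1 x * h 0 i)
    + (pd (base i) coord_weight0 x - coord_weight0 x * h 0 i
       + coord_weight0 x * coord_form1 i x - coord_weight1 x * coord_form0 i x).
Proof.
move=> Mx; rewrite mxE [X in X + _]mxE [X in _ + X]mxE [X in _ - X]mxE /horiz_pd.
rewrite -/unit_scale -/(th i x) -/(th i).
rewrite (pdB (base i) Ws (smoothM oM ts coord_weight1_smooth) Mx) (pdM (base i) ts coord_weight1_smooth Mx).
rewrite (pdM (base i) rs ss Mx) /coord_weight0 /coord_form0 /coord_form1 /coord_form.
rewrite /coord_weight /coord_weight1 -/(unit_scale x).
move: (pd fib unit_scale x) (pd (base i) unit_scale x) (pd fib (th i) x) => a b c.
move: (pd (base i) s x) (pd (base i) t x) (pd (base i) _ x) => d e f.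
by field; exact: sn0.
Qed.

(** The companion identity for the curvature of the horizontal distribution. *)
Lemma coord_monopole_curvature x i j : M x ->
  s x * horiz_curvature (horiz_form g) x i j
  = t x * (pd (base i) (coord_form1 j) x - pd (base j) (coord_form1 i) x)
    + (pd (base i) (coord_form0 j) x - pd (base j) (coord_form0 i) x
       + (coord_form1 i x * coord_form0 j x - coord_form0 i x * coord_form1 j x)).
Proof.
move=> Mx; rewrite mxE /horiz_pd -!/(th _ _) -!/(th _).
have dA0 k l : pd (base k) (coord_form0 l) x = pd (base k) s x * th l x
     + s x * pd (base k) (th l) x - pd (base k) (pd (base l) t) x
     - (pd (base k) t x * coord_form1 l x + t x * pd (base k) (coord_form1 l) x).
  rewrite (pdB (base k) (As l) (smoothM oM ts (coord_form1_smooth l)) Mx).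
  rewrite (pdB (base k) (smoothM oM ss (hs l)) (smooth_pd (base l) ts) Mx).
  by rewrite (pdM (base k) ss (hs l) Mx) (pdM (base k) ts (coord_form1_smooth l) Mx).
rewrite !dA0 (pdC (base j) (base i) oM ts Mx).
move: (pd (base i) (coord_form1 j) x) (pd (base j) (coord_form1 i) x) => a b.
move: (pd (base i) (pd (base j) t) x) => c.
rewrite /coord_form0 /coord_form1 /coord_form.
move: (pd fib (th i) x) (pd fib (th j) x) (pd (base i) (th j) x) (pd (base j) (th i) x) => d e f k.
move: (pd (base i) s x) (pd (base j) s x) (pd (base i) t x) (pd (base j) t x) => l m n p.
by field; exact: sn0.
Qed.

End AffineCoordinate.

(** * From affine submersions to monopoles *)

Section DirectHalf.
Context {R : realType}.

Lemma fibre_constant_descent (N : set 'rV[R]_(3 + 1)) (F : 'rV[R]_(3 + 1) -> R) : open N ->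
  (forall b : 'rV[R]_3, connected (N `&` [set x | lsubmx x = b])) ->
  smooth N F -> (forall x, N x -> pd fib F x = 0) ->
  exists v : 'rV[R]_3 -> R, (forall x, N x -> F x = v (pi x)) /\ smooth (image_pi N) v.
Proof.
move=> oN cN Fs F0.
(* Outside the image of N the value of v is that of F at the default point 0. *)
pose v (b : 'rV[R]_3) := F (xget 0 [set x | N x /\ pi x = b]).
have vE x : N x -> F x = v (pi x).
  move=> Nx; have [Ny yx] : [set y | N y /\ pi y = pi x] (xget 0 [set y | N y /\ pi y = pi x]).
    by apply: xgetPex; exists x.
  exact: fibre_constant oN cN Fs F0 _ _ Nx Ny (esym yx).
by exists v; split=> //; exact: smooth_descent oN vE Fs.
Qed.

Lemma fibre_constant_descent_rV (N : set 'rV[R]_(3 + 1)) (F : 'I_3 -> 'rV[R]_(3 + 1) -> R) :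
  open N -> (forall b : 'rV[R]_3, connected (N `&` [set x | lsubmx x = b])) ->
  (forall i, smooth N (F i)) -> (forall i x, N x -> pd fib (F i) x = 0) ->
  exists v : 'rV[R]_3 -> 'rV[R]_3, (forall x i, N x -> F i x = v (pi x) 0 i)
    /\ smooth_rV (image_pi N) v.
Proof.
move=> oN cN Fs F0.
have [v vP] := choice (fun i => fibre_constant_descent oN cN (Fs i) (F0 i)).
exists (fun b => \row_i v i b); split=> [x i Nx|i].
  by rewrite mxE; exact: (vP i).1.
have -> : (fun x => (\row_j v j x) 0 i) = v i by apply/funext => b; rewrite mxE.
exact: (vP i).2.
Qed.

(** The monopole equations are the coefficients of one equation that is affine in
    t, and every fibre carries two values of t. *)
Lemma affine_coefficients (V : lmodType R) (a b c d : V) (t1 t2 : R) : t1 != t2 ->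
  t1 *: a + b = t1 *: c + d -> t2 *: a + b = t2 *: c + d -> a = c /\ b = d.
Proof.
move=> t12 e1 e2.
have diff (u v : V) : t1 *: u + v - (t2 *: u + v) = (t1 - t2) *: u.
  by rewrite opprD addrACA subrr addr0 scalerBl.
have ac : a = c.
  have t0 : t1 - t2 != 0 by rewrite subr_eq0.
  by apply: (scalerI t0); rewrite -(diff a b) -(diff c d) e1 e2.
by split=> //; move: e1; rewrite ac => /addrI.
Qed.

(** The equation for the induced Weyl derivative holds at every point of a fibre with
    the same forms on B, hence coefficientwise in t. *)
Lemma monopole_direct (M : set 'rV[R]_(3 + 1)) (g : 'rV[R]_(3 + 1) -> 'M[R]_(3 + 1))
    (B : set 'rV[R]_3) (gB : 'rV[R]_3 -> 'M[R]_3) (aB : 'rV[R]_3 -> 'rV[R]_3)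
    (lam gam t : 'rV[R]_(3 + 1) -> R) :
  conformal_submersion M B g gB lam -> affine_submersion M B g lam gam ->
  induced_weyl M g lam aB -> affine_coordinate M gam t ->
  forall N : set 'rV[R]_(3 + 1), open N -> N `<=` M ->
    (forall b : 'rV[R]_3, connected (N `&` [set x | lsubmx x = b])) ->
    exists (w0 w1 : 'rV[R]_3 -> R) (A0 A1 : 'rV[R]_3 -> 'rV[R]_3),
      affine_monopole (image_pi N) gB aB w0 w1 A0 A1 /\
      forall x, N x ->
        0 < affine_weight w0 w1 t x /\
        g x = lam x ^+ 2 *: affine_metric gB w0 w1 A0 A1 t x.
Proof.
move=> csM affM iwM tM N oN NM cN.
have adM := submersion_adapted csM.
have sub F : smooth M F -> smooth N F by exact: smooth_subset.
pose W1 := coord_weight1 g lam gam; pose W0 := coord_weight0 g lam gam t.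
pose A1 i := coord_form1 g gam t i; pose A0 i := coord_form0 g gam t i.
have W1s : smooth N W1 by apply/sub/(coord_weight1_smooth csM affM).
have W0s : smooth N W0 by apply/sub/(coord_weight0_smooth csM affM tM).
have A1s i : smooth N (A1 i) by apply/sub/(coord_form1_smooth csM affM tM).
have A0s i : smooth N (A0 i) by apply/sub/(coord_form0_smooth csM affM tM).
have [w1 [w1E w1s]] := fibre_constant_descent oN cN W1s
  (fun x Nx => coord_weight1_fib affM (NM x Nx)).
have [w0 [w0E w0s]] := fibre_constant_descent oN cN W0s
  (fun x Nx => coord_weight0_fib csM affM tM (NM x Nx)).
have [v1 [v1E v1s]] := fibre_constant_descent_rV oN cN A1s
  (fun i x Nx => coord_form1_fib csM affM tM i (NM x Nx)).
have [v0 [v0E v0s]] := fibre_constant_descent_rV oN cN A0s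
  (fun i x Nx => coord_form0_fib csM affM tM i (NM x Nx)).
have [ts tP] := tM.
have s0 x : N x -> 0 < pd fib t x by move=> /NM/tP[].
have r0 x : N x -> 0 < unit_scale g lam x.
  by move=> /NM Mx; apply: mulr_gt0; [exact: adapted_rho0 adM _ Mx|exact: adapted_lam0 adM _ Mx].
have weightE x : N x -> affine_weight w0 w1 t x = unit_scale g lam x * pd fib t x.
  move=> Nx; rewrite /affine_weight -w1E // -w0E // /W0 /coord_weight0 -/W1.
  by rewrite addrC subrK.
exists w0, w1, v0, v1; split; last first.
  move=> x Nx; split; first by rewrite weightE // mulr_gt0 // ?s0 ?r0.
  have form : affine_form v0 v1 t x = pd fib t x *: fibre_form (horiz_form g) x.
    apply/rowP => j; rewrite [RHS]mxE.
    have -> : affine_form v0 v1 t x 0 j = pd j t x + t x * pullback v1 x 0 j + pullback v0 x 0 j.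
      by rewrite /affine_form; move: (pullback v1 x) (pullback v0 x) => p q; rewrite !mxE.
    elim/ord4P: j => [j|].
      rewrite fibre_form_base /pullback !row_mxEl -v1E // -v0E // /A0 /A1 /coord_form0 /coord_form.
      by ring.
    by rewrite fibre_form_fib /pullback !row_mxEr !mxE; ring.
  rewrite (adapted_metric adM (NM x Nx)) /affine_metric weightE // form.
  have sq c (f : 'rV[R]_(3 + 1)) : (c *: f)^T *m (c *: f) = (c * c) *: (f^T *m f).
    have tr_scale : (c *: f)^T = c *: f^T by rewrite linearZ.
    by rewrite tr_scale -scalemxAl -scalemxAr scalerA.
  rewrite sq scalerDr !scalerA; congr (_ + _ *: _).
  have := r0 x Nx; have := s0 x Nx; rewrite /unit_scale.
  move: (pd fib t x) (vert_scale g x) (lam x) => s r l /lt0r_neq0 sn rl.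
  have : r * l != 0 by exact: lt0r_neq0.
  rewrite mulf_eq0 negb_or => /andP[rn ln].
  by field; rewrite sn rn ln.
split=> // _ [x Nx <-].
pose D1 := weylD_Lm1 aB w1 (pi x).
pose D0 := weylD_Lm1 aB w0 (pi x) + w0 (pi x) *: v1 (pi x) - w1 (pi x) *: v0 (pi x).
pose E1 := ext_d v1 (pi x); pose E0 := ext_d v0 (pi x) + wedge (v1 (pi x)) (v0 (pi x)).
have monopole y : N y -> pi y = pi x -> star1 (gB (pi x)) (t y *: D1 + D0) = t y *: E1 + E0.
  move=> Ny yx; have My := NM y Ny.
  have [a0 [_ a0P] iw] := iwM.
  have a0E : a0 y = minimal_form lam (vert_scale g) (horiz_form g) y.
    exact/(minimal_weylP adM a0 My)/a0P.
  have omE : omega g a0 y = omega g (minimal_form lam (vert_scale g) (horiz_form g)) y.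
    by rewrite /omega /weyl_ext_d a0E.
  have := iw y My; rewrite omE a0E => /(induced_weylP adM aB My).
  move=> /(congr1 (fun m => pd fib t y *: m)).
  rewrite -star1Z -yx => star_y.
  have formE : pd fib t y *: (scale_form lam (vert_scale g) (horiz_form g) y
      - (vert_scale g y * lam y) *: aB (pi y)) = t y *: D1 + D0.
    apply/rowP => i; rewrite [LHS]mxE (coord_monopole_form csM affM tM (aB (pi y)) i My).
    rewrite -/W1 -/W0 -/(A1 i) -/(A0 i) (w1E y Ny) (w0E y Ny) (v1E y i Ny) (v0E y i Ny).
    rewrite -(pd_descent i oN w1E Ny) -(pd_descent i oN w0E Ny) /D1 /D0 -yx /weylD_Lm1.
    by rewrite /dfun; move: (aB (pi y)) (v1 (pi y)) (v0 (pi y)) => p q r; rewrite !mxE; ring.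
  have curvE : pd fib t y *: horiz_curvature (horiz_form g) y = t y *: E1 + E0.
    apply/matrixP => i j; rewrite [LHS]mxE (coord_monopole_curvature csM affM tM i j My).
    have dv1 k l : pd k (fun b => v1 b 0 l) (pi y) = pd (base k) (A1 l) y.
      by apply: (pd_descent k oN _ Ny) => z Nz; exact: v1E.
    have dv0 k l : pd k (fun b => v0 b 0 l) (pi y) = pd (base k) (A0 l) y.
      by apply: (pd_descent k oN _ Ny) => z Nz; exact: v0E.
    rewrite -!/(A1 _) -!/(A0 _) -!dv1 -!dv0 !(v1E y _ Ny) !(v0E y _ Ny) /E1 /E0 -yx.
    have entry (A C D : 'M[R]_3) : (t y *: A + (C + D)) i j = t y * A i j + (C i j + D i j).
      by rewrite !mxE.
    by rewrite entry !ext_dE wedgeE.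
  by rewrite -formE -curvE.
(* A second point of the fibre through x inside N; t takes a different value there
   by the mean value theorem. *)
have [d d0 dN] : exists2 d, 0 < d & forall u, 0 <= u <= d -> N (x + u *: delta_mx 0 fib).
  have /nbhs_ballP[e e0 eN] : nbhs x N by exact: open_nbhs_nbhs.
  pose n1 : R := `|delta_mx 0 fib : 'rV[R]_(3 + 1)| + 1.
  have n0 : 0 < n1 by rewrite ltr_wpDl.
  exists (e / (2 * n1)); first by rewrite divr_gt0 // mulr_gt0.
  move=> u /andP[u0 ue]; apply: eN; rewrite -ball_normE /= opprD addrA subrr sub0r normrN.
  rewrite normrZ ger0_norm //; apply: (@le_lt_trans _ _ (u * n1)).
    by apply: ler_wpM2l => //; rewrite lerDl.
  apply: (@le_lt_trans _ _ (e / 2)); last by rewrite gtr_pMr // invf_lt1 // ltr1n.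
  rewrite -ler_pdivlMr //; apply: (le_trans ue); rewrite invfM mulrA; exact: lexx.
have dd : 0 <= d <= d by rewrite lexx ltW.
have [|u ud Ed] := MVT_line (f := t) (e := delta_mx 0 fib) d0 (x := x).
  by move=> u /dN Nu; exact: (smooth_derivable ts (NM _ Nu)).
have px : pi (x + d *: delta_mx 0 fib) = pi x.
  by rewrite addrC lsubmx_shift lsubmx_fib scaler0 add0r.
have tx : t (x + d *: delta_mx 0 fib) != t x.
  rewrite -subr_eq0 Ed mulf_neq0 //; last exact: lt0r_neq0.
  exact: (lt0r_neq0 (s0 _ (dN u ud))).
have m1 := monopole _ (dN d dd) px; have m2 := monopole _ Nx (erefl _).
rewrite star1_linear in m1; rewrite star1_linear in m2.
exact: affine_coefficients tx m1 m2.
Qed.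

End DirectHalf.

(** * Moving frames *)

Section MovingFrames.
Context {R : realType} {n : nat}.
Implicit Types (U : set 'rV[R]_n) (F G : 'rV[R]_n -> 'M[R]_n) (x : 'rV[R]_n).

Definition pd_mx i F x : 'M[R]_n := \matrix_(p, q) pd i (fun y => F y p q) x.

Lemma pd_mx_eq_on U F G i x : open U -> (forall y, U y -> F y = G y) -> U x ->
  pd_mx i F x = pd_mx i G x.
Proof.
move=> oU FG Ux; apply/matrixP => p q; rewrite !mxE.
by apply: (pd_eq_on _ oU _ Ux) => y /FG ->.
Qed.

Lemma smooth_mxM U F G : open U -> smooth_mx U F -> smooth_mx U G ->
  smooth_mx U (fun x => F x *m G x).
Proof.
move=> oU Fs Gs i j.
have := smooth_sum (index_enum 'I_n) oU (fun k (_ : true) => smoothM oU (Fs i k) (Gs k j)).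
by apply: (smooth_eq_on oU) => y _; rewrite mxE.
Qed.

Lemma smooth_mxD U F G : open U -> smooth_mx U F -> smooth_mx U G ->
  smooth_mx U (fun x => F x + G x).
Proof.
move=> oU Fs Gs i j; have := smoothD oU (Fs i j) (Gs i j).
by apply: (smooth_eq_on oU) => y _; rewrite mxE.
Qed.

Lemma smooth_pd_mx U F i : open U -> smooth_mx U F -> smooth_mx U (pd_mx i F).
Proof.
move=> oU Fs p q; have := smooth_pd i (Fs p q).
by apply: (smooth_eq_on oU) => y _; rewrite mxE.
Qed.

Lemma smooth_mxT U F : open U -> smooth_mx U F -> smooth_mx U (fun x => (F x)^T).
Proof.
by move=> oU Fs p q; have := Fs q p; apply: (smooth_eq_on oU) => y _; rewrite mxE.
Qed.

Lemma pd_mxM U F G i x : open U -> smooth_mx U F -> smooth_mx U G -> U x ->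
  pd_mx i (fun y => F y *m G y) x = pd_mx i F x *m G x + F x *m pd_mx i G x.
Proof.
move=> oU Fs Gs Ux; apply/matrixP => p q.
rewrite [LHS]mxE [RHS]mxE [X in X + _]mxE [X in _ + X]mxE -big_split /=.
transitivity (pd i (fun y => \sum_k F y p k * G y k q) x).
  by congr (pd i _ x); apply/funext => y; rewrite mxE.
rewrite (pd_sum (index_enum 'I_n) i oU (fun k (_ : true) => smoothM oU (Fs p k) (Gs k q)) Ux).
by apply: eq_bigr => k _; rewrite (pdM i (Fs p k) (Gs k q) Ux) !mxE.
Qed.

Lemma pd_mxD U F G i x : smooth_mx U F -> smooth_mx U G -> U x ->
  pd_mx i (fun y => F y + G y) x = pd_mx i F x + pd_mx i G x.
Proof.
move=> Fs Gs Ux; apply/matrixP => p q; rewrite !mxE -(pdD i (Fs p q) (Gs p q) Ux).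
by congr (pd i _ x); apply/funext => y; rewrite mxE.
Qed.

Lemma pd_mxT F i x : pd_mx i (fun y => (F y)^T) x = (pd_mx i F x)^T.
Proof.
apply/matrixP => p q; rewrite !mxE; congr (pd i _ x).
by apply/funext => y; rewrite mxE.
Qed.

Lemma pd_mx_cst (m : 'M[R]_n) i x : pd_mx i (fun=> m) x = 0.
Proof. by apply/matrixP => p q; rewrite !mxE pd_cst. Qed.

Lemma pd_mxC U F i j x : open U -> smooth_mx U F -> U x ->
  pd_mx i (pd_mx j F) x = pd_mx j (pd_mx i F) x.
Proof.
move=> oU Fs Ux; apply/matrixP => p q; rewrite [LHS]mxE [RHS]mxE.
transitivity (pd i (pd j (fun y => F y p q)) x).
  by congr (pd i _ x); apply/funext => y; rewrite mxE.
rewrite (pdC i j oU (Fs p q) Ux).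
by congr (pd j _ x); apply/funext => y; rewrite mxE.
Qed.

(** The curvature of d + T, with T i the endomorphism along coordinate i. *)
Definition curvature_mx (T : 'I_n -> 'rV[R]_n -> 'M[R]_n) i j x : 'M[R]_n :=
  pd_mx i (T j) x - pd_mx j (T i) x + (T i x *m T j x - T j x *m T i x).

(** The curvature of a linear connection does not depend on the frame in which
    it is computed; equality of mixed derivatives of the frame makes the
    inhomogeneous terms cancel. *)
Lemma curvature_change_frame U F (Gam Th : 'I_n -> 'rV[R]_n -> 'M[R]_n) :
  open U -> smooth_mx U F -> (forall i, smooth_mx U (Gam i)) -> (forall i, smooth_mx U (Th i)) ->
  (forall i y, U y -> pd_mx i F y + Gam i y *m F y = F y *m Th i y) ->
  forall i j x, U x -> curvature_mx Gam i j x *m F x = F x *m curvature_mx Th i j x.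
Proof.
move=> oU Fs Gs Ts FT i j x Ux.
have dF k y : U y -> pd_mx k F y = F y *m Th k y - Gam k y *m F y.
  by move=> /FT <-; rewrite addrK.
have ddF k l : pd_mx k (pd_mx l F) x =
    pd_mx k F x *m Th l x + F x *m pd_mx k (Th l) x
    - (pd_mx k (Gam l) x *m F x + Gam l x *m pd_mx k F x).
  have dlF : pd_mx k (fun y => pd_mx l F y + Gam l y *m F y) x = pd_mx k (fun y => F y *m Th l y) x.
    exact: (pd_mx_eq_on k oU (FT l) Ux).
  rewrite (pd_mxD k (smooth_pd_mx l oU Fs) (smooth_mxM oU (Gs l) Fs) Ux) in dlF.
  rewrite (pd_mxM k oU (Gs l) Fs Ux) (pd_mxM k oU Fs (Ts l) Ux) in dlF.
  by rewrite -dlF addrK.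
have := pd_mxC i j oU Fs Ux; rewrite !ddF !dF // /curvature_mx.
move: (F x) (Gam i x) (Gam j x) (Th i x) (Th j x) => f gi gj ti tj.
move: (pd_mx i (Th j) x) (pd_mx j (Th i) x) (pd_mx i (Gam j) x) (pd_mx j (Gam i) x).
move=> dti dtj dgi dgj.
rewrite !(mulmxDl, mulmxDr, mulmxBl, mulmxBr, mulNmx, mulmxN, mulmxA).
move=> /eqP; rewrite -subr_eq0 => /eqP E; apply/eqP; rewrite -subr_eq0 -oppr_eq0 -E; apply/eqP.
move: (f *m ti *m tj) (f *m tj *m ti) (gi *m f *m tj) (gj *m f *m ti).
move: (gi *m gj *m f) (gj *m gi *m f) (f *m dti) (f *m dtj) (dgi *m f) (dgj *m f).
by move=> *; apply/matrixP => p q; rewrite !mxE; ring.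
Qed.

Definition christoffel_mx (g : 'rV[R]_n -> 'M[R]_n) a i x : 'M[R]_n :=
  \matrix_(k, j) christoffel g a x k i j.

Lemma curvature_christoffel g a l k i j x :
  curvature g a x l k i j = curvature_mx (christoffel_mx g a) i j x l k.
Proof.
have entry (A B C D : 'M[R]_n) : (A - B + (C - D)) l k = A l k - B l k + (C l k - D l k).
  by rewrite !mxE.
rewrite /curvature_mx entry /curvature; congr (_ - _ + _).
- by rewrite mxE; congr (pd i _ x); apply/funext => y; rewrite mxE.
- by rewrite mxE; congr (pd j _ x); apply/funext => y; rewrite mxE.
- rewrite [X in _ = X - _]mxE [X in _ = _ - X]mxE -sumrB.
  by apply: eq_bigr => m _; rewrite !mxE.
Qed.

Lemma mulmx_symmetric (f : 'M[R]_n) (h : 'I_n -> 'M[R]_n) :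
  (forall p q b, h p b q = h q b p) -> forall p k q, (f *m h p) k q = (f *m h q) k p.
Proof. by move=> hC p k q; rewrite !mxE; apply: eq_bigr => b _; rewrite hC. Qed.

(** The algebra behind the Koszul formula: a tensor symmetric in its outer indices is
    determined by its symmetrization in the last two. *)
Lemma koszul_solution (K : 'I_n -> 'M[R]_n) (d : 'I_n -> 'I_n -> 'I_n -> R) :
  (forall k l j, d k l j = K k l j + K k j l) -> (forall k l j, K k l j = K j l k) ->
  forall i l j, K i l j = 2^-1 * (d i j l + d j i l - d l i j).
Proof.
move=> dK KC i l j; rewrite !dK (KC j l i) (KC l i j) (KC l j i).
by move: (K i j l) (K i l j) (K j i l) => p q r; lra.
Qed.

Section OrthonormalFrame.
Variables (U : set 'rV[R]_n) (g : 'rV[R]_n -> 'M[R]_n) (a : 'rV[R]_n -> 'rV[R]_n)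
  (E : 'rV[R]_n -> 'M[R]_n).
Hypotheses (oU : open U) (gs : smooth_mx U g) (gT : forall x, U x -> (g x)^T = g x)
  (as_ : smooth_rV U a) (Es : smooth_mx U E) (oE : forall x, U x -> orthoframe (g x) (E x)).

Definition coframe x : 'M[R]_n := E x *m g x.

Let F x := (E x)^T.
Let Gam := christoffel_mx g a.
Let Fs : smooth_mx U F. Proof. exact: smooth_mxT. Qed.
Let Cs : smooth_mx U coframe. Proof. exact: smooth_mxM. Qed.
Let CF x : U x -> coframe x *m F x = 1%:M. Proof. by move=> Ux; exact: coframeK (oE Ux). Qed.
Let FC x : U x -> F x *m coframe x = 1%:M. Proof. by move=> Ux; exact: frame_coframe (oE Ux). Qed.
Let gu x : U x -> g x \in unitmx.
Proof. by move=> /FC; rewrite /coframe mulmxA => /mulmx1_unit[]. Qed.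

Lemma coframe_metric x : U x -> (coframe x)^T *m coframe x = g x.
Proof.
move=> Ux; rewrite {1}/coframe trmx_mul gT // -mulmxA -/(F x).
by rewrite (_ : F x *m coframe x = 1%:M) ?mulmx1 ?FC.
Qed.

Lemma smooth_christoffel_mx i : smooth_mx U (Gam i).
Proof.
move=> k j.
have invs p q : smooth U (fun x => invmx (g x) p q).
  have := smooth_mxM oU Fs Es p q.
  by apply: (smooth_eq_on oU) => y Uy; rewrite (invmx_frame (oE Uy)).
have dms p q r : smooth U (fun x => dmetric g a x p q r).
  exact: smoothD oU (smooth_pd p (gs q r))
    (smoothM oU (smoothM oU (@smooth_cst _ _ U 2) (as_ p)) (gs q r)).
have := smoothM oU (@smooth_cst _ _ U 2^-1) (smooth_sum (index_enum 'I_n) oU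
  (fun l (_ : true) => smoothM oU (invs k l)
     (smoothB oU (smoothD oU (dms i j l) (dms j i l)) (dms l i j)))).
by apply: (smooth_eq_on oU) => y Uy; rewrite mxE.
Qed.

Lemma christoffel_compat i x : U x ->
  g x *m Gam i x + (g x *m Gam i x)^T = pd_mx i g x + (2 * a x 0 i) *: g x.
Proof.
move=> Ux; apply/matrixP => l j.
have low p q : (g x *m Gam i x) p q
    = 2^-1 * (dmetric g a x i q p + dmetric g a x q i p - dmetric g a x p i q).
  rewrite -christoffel_lower ?gu // mxE.
  by apply: eq_bigr => k _; rewrite mxE.
have entry (A : 'M[R]_n) c (B : 'M[R]_n) : (A + c *: B) l j = A l j + c * B l j.
  by rewrite !mxE.
have entryT (A : 'M[R]_n) : (A + A^T) l j = A l j + A j l by rewrite !mxE.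
have -> : (pd_mx i g x + (2 * a x 0 i) *: g x) l j = dmetric g a x i l j.
  by rewrite entry mxE.
rewrite entryT !low (dmetricC a i j l oU gT Ux).
move: (dmetric g a x i l j) (dmetric g a x j i l) (dmetric g a x l i j) => p q r.
lra.
Qed.

Lemma pd_coframe i x : U x -> pd_mx i coframe x = - (coframe x *m pd_mx i F x *m coframe x).
Proof.
move=> Ux; have := pd_mxM i oU Cs Fs Ux.
rewrite (@pd_mx_eq_on U _ (fun=> 1%:M)) // pd_mx_cst => /esym/eqP.
rewrite addr_eq0 => /eqP dC.
by rewrite -[LHS]mulmx1 -(FC Ux) mulmxA dC mulNmx.
Qed.

(** The change of frame expressed in the vectors of the frame and in the dual coframe;
    antisymmetrized, the latter is the first structure equation. *)
Lemma coframe_christoffel i x (T G : 'M[R]_n) : U x ->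
  (pd_mx i F x + G *m F x = F x *m T) <-> (coframe x *m G = T *m coframe x + pd_mx i coframe x).
Proof.
move=> Ux; rewrite pd_coframe //; have cf := CF Ux; have fc := FC Ux.
move: (coframe x) (F x) (pd_mx i F x) cf fc => c f d cf fc; split=> [eq1|eq1].
  have -> : T = c *m (d + G *m f) by rewrite eq1 mulmxA cf mul1mx.
  by rewrite mulmxDr mulmxDl !mulmxA -(mulmxA (c *m G)) fc mulmx1 addrC addKr.
have -> : T = (c *m G + c *m d *m c) *m f.
  by rewrite eq1 subrK -mulmxA cf mulmx1.
by rewrite mulmxDl mulmxDr -!mulmxA cf mulmx1 !mulmxA fc !mul1mx addrC.
Qed.

(** The first structure equation: the exterior derivative of the coframe is minus the
    wedge product with the connection matrix. *)
Definition torsion_free (Th : 'I_n -> 'rV[R]_n -> 'M[R]_n) : Prop :=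
  forall x i j, U x -> forall b,
    (Th i x *m coframe x + pd_mx i coframe x) b j
    = (Th j x *m coframe x + pd_mx j coframe x) b i.

Definition compatible (Th : 'I_n -> 'rV[R]_n -> 'M[R]_n) : Prop :=
  forall x i, U x -> Th i x + (Th i x)^T = (2 * a x 0 i)%:M.

Definition frame_connection i x : 'M[R]_n :=
  coframe x *m (pd_mx i F x + Gam i x *m F x).

Lemma frame_connectionE i x : U x ->
  pd_mx i F x + Gam i x *m F x = F x *m frame_connection i x.
Proof. by move=> Ux; rewrite /frame_connection mulmxA FC // mul1mx. Qed.

Lemma smooth_frame_connection i : smooth_mx U (frame_connection i).
Proof.
exact: smooth_mxM oU Cs (smooth_mxD oU (smooth_pd_mx i oU Fs)
  (smooth_mxM oU (smooth_christoffel_mx i) Fs)).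
Qed.

(** Metric compatibility in the chart and skewness in an orthonormal frame
    differ by the derivative of g = C^T C. *)
Lemma metric_frame_identity i x (T : 'M[R]_n) : U x ->
  let G := F x *m (T *m coframe x + pd_mx i coframe x) in
  g x *m G + (g x *m G)^T = (coframe x)^T *m (T + T^T) *m coframe x + pd_mx i g x.
Proof.
move=> Ux /=.
have dg : pd_mx i g x = (pd_mx i coframe x)^T *m coframe x + (coframe x)^T *m pd_mx i coframe x.
  rewrite -pd_mxT -(pd_mxM i oU (smooth_mxT oU Cs) Cs Ux).
  by apply: (pd_mx_eq_on i oU _ Ux) => y Uy; rewrite coframe_metric.
have gF : g x *m F x = (coframe x)^T by rewrite /coframe trmx_mul gT.
rewrite mulmxA gF dg; move: (coframe x) (pd_mx i coframe x) => c d.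
have trD : (T *m c + d)^T = c^T *m T^T + d^T by rewrite raddfD /= trmx_mul.
rewrite trmx_mul trmxK trD !(mulmxDr, mulmxDl) !mulmxA.
by rewrite addrACA [c^T *m d + _]addrC.
Qed.

Lemma frame_connection_compatible : compatible frame_connection.
Proof.
move=> x i Ux; have /(coframe_christoffel i _ _ Ux) CG := frame_connectionE i Ux.
have GE : Gam i x = F x *m (frame_connection i x *m coframe x + pd_mx i coframe x).
  by rewrite -CG mulmxA FC // mul1mx.
have := christoffel_compat i Ux; rewrite GE metric_frame_identity // => /(canRL (addrK _)).
rewrite [pd_mx i g x + _]addrC addrK => eqC; have cf := CF Ux.
have cancel (c f T : 'M[R]_n) : c *m f = 1%:M -> T = f^T *m (c^T *m T *m c) *m f.
  move=> cf1; have fcT : f^T *m c^T = 1%:M by rewrite -trmx_mul cf1 trmx1.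
  by rewrite !mulmxA fcT mul1mx -mulmxA cf1 mulmx1.
have Eg : (F x)^T *m g x *m F x = 1%:M by rewrite /F trmxK.
by rewrite [LHS](cancel _ _ _ cf) eqC -scalemxAr -scalemxAl Eg scalemx1.
Qed.

Lemma frame_connection_torsion_free : torsion_free frame_connection.
Proof.
move=> x i j Ux b.
have CG k := (coframe_christoffel k _ _ Ux).1 (frame_connectionE k Ux).
rewrite -!CG; apply: (@mulmx_symmetric (coframe x) (fun k => Gam k x)) => p q k; rewrite [LHS]mxE [RHS]mxE.
exact: (christoffelC a k p q oU gT Ux).
Qed.

(** The fundamental lemma of Riemannian geometry, for Weyl connections: a
    compatible torsion-free connection is the one given by the Koszul formula. *)
Lemma connection_unique (Th : 'I_n -> 'rV[R]_n -> 'M[R]_n) :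
  compatible Th -> torsion_free Th ->
  forall i x, U x -> pd_mx i F x + Gam i x *m F x = F x *m Th i x.
Proof.
move=> compT torT i x Ux; apply/(coframe_christoffel i _ _ Ux).
pose H k := Th k x *m coframe x + pd_mx k coframe x.
pose G k := F x *m H k.
have GC p k q : G p k q = G q k p.
  by apply: (@mulmx_symmetric (F x) H) => p' q' b; exact: torT.
have gG k : g x *m G k + (g x *m G k)^T = pd_mx k g x + (2 * a x 0 k) *: g x.
  rewrite /G /H metric_frame_identity // compT // addrC; congr (_ + _).
  by rewrite mul_mx_scalar -scalemxAl coframe_metric.
have dmG k l j : dmetric g a x k l j = (g x *m G k) l j + (g x *m G k) j l.
  have := congr1 (fun m : 'M_n => m l j) (gG k).
  have entry (A B : 'M[R]_n) c : (A + c *: B) l j = A l j + c * B l j by rewrite !mxE.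
  have entryT (A : 'M[R]_n) : (A + A^T) l j = A l j + A j l by rewrite !mxE.
  by rewrite entry entryT => ->; rewrite mxE.
have gGC := @mulmx_symmetric (g x) G (fun p q b => GC p b q).
have -> : Gam i x = G i.
  suff : g x *m Gam i x = g x *m G i.
    by move=> /(congr1 (fun m => invmx (g x) *m m)); rewrite !mulKmx ?gu.
  apply/matrixP => l j; rewrite (koszul_solution dmG gGC) -christoffel_lower ?gu //.
  by rewrite mxE; apply: eq_bigr => k _; rewrite mxE.
by rewrite /G mulmxA CF // mul1mx.
Qed.

Lemma frame_curvature (Th : 'I_n -> 'rV[R]_n -> 'M[R]_n) :
  (forall i, smooth_mx U (Th i)) ->
  (forall i x, U x -> pd_mx i F x + Gam i x *m F x = F x *m Th i x) ->
  forall i j x, U x ->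
  coframe x *m curvature_mx Gam i j x *m (E x)^T = curvature_mx Th i j x.
Proof.
move=> Ts FT i j x Ux.
have := curvature_change_frame oU Fs smooth_christoffel_mx Ts FT i j Ux.
by rewrite -/(F x) -mulmxA => ->; rewrite mulmxA CF // mul1mx.
Qed.

End OrthonormalFrame.
End MovingFrames.

(** * Algebraic curvature tensors in dimension four *)

Section AlgebraicWeyl.
Context {R : realType}.
Notation q0 := (base o0).
Notation q1 := (base o1).
Notation q2 := (base o2).
Notation idx := 'I_(3 + 1).
Variable K : idx -> idx -> idx -> idx -> R.

(** The components of the antiselfdual part of a 2-form, up to a factor. *)
Definition asd_comp (b : idx -> idx -> R) (n : 'I_3) : R :=
  nth 0 [:: b fib q0 - b q1 q2; b fib q1 - b q2 q0; b fib q2 - b q0 q1] n.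

Definition asd_block (m n : 'I_3) : R := asd_comp (fun c d => asd_comp (fun a b => K a b c d) m) n.

Definition frame_ricci (c d : idx) : R := \sum_a K a d a c.

Definition frame_schouten (c d : idx) : R :=
  2^-1 * (frame_ricci c d - (\sum_a frame_ricci a a) / 6 * (c == d)%:R).

(** The Weyl tensor of an algebraic curvature tensor K, all indices down. *)
Definition frame_weyl (a b c d : idx) : R :=
  K a b c d - ((c == a)%:R * frame_schouten d b + (d == b)%:R * frame_schouten c a
    - (c == b)%:R * frame_schouten d a - (d == a)%:R * frame_schouten c b).

Hypotheses (skl : forall a b c d, K a b c d = - K b a c d)
  (skr : forall a b c d, K a b c d = - K a b d c)
  (bianchi : forall a b c d, K a b c d + K a c d b + K a d b c = 0).

Lemma pair_symmetry a b c d : K a b c d = K c d a b.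
Proof.
have := bianchi a b c d; have := bianchi b c d a; have := bianchi c d a b.
have := bianchi d a b c.
rewrite (skr a c d b) (skr b c d a) (skl b a c d) (skl c a b d) (skl c b d a) (skr b c d a).
rewrite (skl d a b c) (skl d b c a) (skr b d c a) (skl d c a b).
move: (K a b c d) (K c d a b) (K a c b d) (K b d a c) (K a d b c) (K b c a d).
by move=> *; lra.
Qed.

(** The antiselfdual part of the Weyl tensor is the symmetric tracefree part of
    the antiselfdual block of the curvature operator: the Ricci terms only
    contribute a multiple of the identity to that block, and the block
    mixing the two eigenspaces of the star operator is pure Ricci. *)
Lemma frame_weyl_selfdual :
  (forall m n, m != n -> asd_block m n + asd_block n m = 0) ->
  asd_block o0 o0 = asd_block o1 o1 -> asd_block o1 o1 = asd_block o2 o2 ->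
  forall a b n, asd_comp (frame_weyl a b) n = 0.
Proof.
move=> off d01 d12.
have off01 : asd_block o0 o1 + asd_block o1 o0 = 0 by exact: off.
have off12 : asd_block o1 o2 + asd_block o2 o1 = 0 by exact: off.
have off20 : asd_block o2 o0 + asd_block o0 o2 = 0 by exact: off.
have z a c d : K a a c d = 0 by have := skl a a c d; lra.
have z' a b c : K a b c c = 0 by have := skr a b c c; lra.
have l c d : [/\ K q0 fib c d = - K fib q0 c d, K q1 fib c d = - K fib q1 c d,
   K q2 fib c d = - K fib q2 c d, K q2 q1 c d = - K q1 q2 c d &
   K q0 q2 c d = - K q2 q0 c d /\ K q1 q0 c d = - K q0 q1 c d].
  by split; last split; exact: skl.
have r c d : [/\ K c d q0 fib = - K c d fib q0, K c d q1 fib = - K c d fib q1,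
   K c d q2 fib = - K c d fib q2, K c d q2 q1 = - K c d q1 q2 &
   K c d q0 q2 = - K c d q2 q0 /\ K c d q1 q0 = - K c d q0 q1].
  by split; last split; exact: skr.
have l1 c d : K q0 fib c d = - K fib q0 c d by case: (l c d).
have l2 c d : K q1 fib c d = - K fib q1 c d by case: (l c d).
have l3 c d : K q2 fib c d = - K fib q2 c d by case: (l c d).
have l4 c d : K q2 q1 c d = - K q1 q2 c d by case: (l c d).
have l5 c d : K q0 q2 c d = - K q2 q0 c d by case: (l c d) => _ _ _ _ [].
have l6 c d : K q1 q0 c d = - K q0 q1 c d by case: (l c d) => _ _ _ _ [].
have r1 c d : K c d q0 fib = - K c d fib q0 by case: (r c d).
have r2 c d : K c d q1 fib = - K c d fib q1 by case: (r c d).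
have r3 c d : K c d q2 fib = - K c d fib q2 by case: (r c d).
have r4 c d : K c d q2 q1 = - K c d q1 q2 by case: (r c d).
have r5 c d : K c d q0 q2 = - K c d q2 q0 by case: (r c d) => _ _ _ _ [].
have r6 c d : K c d q1 q0 = - K c d q0 q1 by case: (r c d) => _ _ _ _ [].
have cyc := bianchi fib q0 q1 q2.
pose sym := pair_symmetry.
have S1 := sym fib q1 fib q0; have S2 := sym fib q2 fib q0; have S3 := sym fib q2 fib q1.
have S4 := sym q1 q2 fib q0; have S5 := sym q1 q2 fib q1; have S6 := sym q1 q2 fib q2.
have S7 := sym q2 q0 fib q0; have S8 := sym q2 q0 fib q1; have S9 := sym q2 q0 fib q2.
have S10 := sym q0 q1 fib q0; have S11 := sym q0 q1 fib q1; have S12 := sym q0 q1 fib q2.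
have S13 := sym q2 q0 q1 q2; have S14 := sym q0 q1 q1 q2; have S15 := sym q0 q1 q2 q0.
move: cyc d01 d12 off01 off12 off20.
rewrite /asd_block /asd_comp /= !(S1, S2, S3, S4, S5, S6, S7, S8, S9, S10, S11, S12, S13, S14, S15).
move=> cyc d01 d12 off01 off12 off20.
have ricE c d : frame_ricci c d = K q0 d q0 c + K q1 d q1 c + K q2 d q2 c + K fib d fib c.
  by rewrite /frame_ricci sum4.
have scalE : \sum_a frame_ricci a a = 2 * (K fib q0 fib q0 + K fib q1 fib q1 + K fib q2 fib q2
    + K q1 q2 q1 q2 + K q2 q0 q2 q0 + K q0 q1 q0 q1).
  by rewrite sum4 !ricE !(l1, l2, l3, l4, l5, l6, z) !(r1, r2, r3, r4, r5, r6, z'); lra.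
(* Each component is a linear consequence of the hypotheses on the antiselfdual
   block, the pair symmetries and the Bianchi identity. *)
have on_pairs (a b : idx) (ab : (a, b) \in [:: (fib, q0); (fib, q1); (fib, q2); (q1, q2); (q2, q0); (q0, q1)]) n :
    asd_comp (frame_weyl a b) n = 0.
  move: ab; rewrite !inE => /or4P[|||/or3P[||]] /eqP[-> ->]; elim/ord3P: n;
    rewrite /asd_comp /= /frame_weyl /frame_schouten scalE !ricE -?val_eqE /=;
    rewrite ?(l1, l2, l3, l4, l5, l6, z) ?(r1, r2, r3, r4, r5, r6, z');
    rewrite ?(S1, S2, S3, S4, S5, S6, S7, S8, S9, S10, S11, S12, S13, S14, S15);
    move: cyc d01 d12 off01 off12 off20;
    move: (K fib q0 fib q0) (K fib q0 fib q1) (K fib q0 fib q2) (K fib q1 fib q1)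
      (K fib q1 fib q2) (K fib q2 fib q2) (K fib q0 q1 q2) (K fib q0 q2 q0) (K fib q0 q0 q1);
    move: (K fib q1 q1 q2) (K fib q1 q2 q0) (K fib q1 q0 q1) (K fib q2 q1 q2)
      (K fib q2 q2 q0) (K fib q2 q0 q1) (K q1 q2 q1 q2) (K q1 q2 q2 q0) (K q1 q2 q0 q1);
    move: (K q2 q0 q2 q0) (K q2 q0 q0 q1) (K q0 q1 q0 q1); clear;
    move=> *; lra.
have wskew a b c d : frame_weyl a b c d = - frame_weyl b a c d.
  by rewrite /frame_weyl (skl a b); ring.
have askew a b n : asd_comp (frame_weyl a b) n = - asd_comp (frame_weyl b a) n.
  rewrite /asd_comp; elim/ord3P: n => /=; rewrite (wskew a b) (wskew a b _ _); ring.
move=> a b n; change (asd_comp (frame_weyl a b) n = 0).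
have [ab|nab] := boolP ((a, b) \in [:: (fib, q0); (fib, q1); (fib, q2);
    (q1, q2); (q2, q0); (q0, q1)]); first exact: on_pairs.
have [ba|nba] := boolP ((b, a) \in [:: (fib, q0); (fib, q1); (fib, q2);
    (q1, q2); (q2, q0); (q0, q1)]); first by rewrite (askew a b n) (on_pairs b a ba n) oppr0.
have -> : a = b.
  by move: nab nba; elim/ord4P: a => [a|]; elim/ord4P: b => [b|]; try (elim/ord3P: a);
    try (elim/ord3P: b).
by have := askew b b n; move: (asd_comp _ _) => w ww; lra.
Qed.
End AlgebraicWeyl.

(** * Curvature in an orthonormal frame *)

Section FrameComponents.
Context {R : realType} {n : nat}.
Variables (U : set 'rV[R]_n) (g : 'rV[R]_n -> 'M[R]_n) (a : 'rV[R]_n -> 'rV[R]_n)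
  (E : 'rV[R]_n -> 'M[R]_n) (x : 'rV[R]_n).
Hypotheses (oU : open U) (gT : forall y, U y -> (g y)^T = g y) (Ux : U x)
  (oE : orthoframe (g x) (E x)).

Let C := coframe g E x.
Let Rm i j := curvature_mx (christoffel_mx g a) i j x.

(** frame_curv p q r s is g(R(e_r, e_s) e_q, e_p) in the orthonormal frame. *)
Definition frame_form p q : 'M[R]_n := \matrix_(i, j) (C *m Rm i j *m (E x)^T) p q.
Definition frame_curv p q r s : R := (E x *m frame_form p q *m (E x)^T) r s.

Lemma mx_entry3 (A B D : 'M[R]_n) r s :
  (A *m B *m D^T) r s = \sum_i \sum_j A r i * D s j * B i j.
Proof.
rewrite mxE exchange_big /=; apply: eq_bigr => j _; rewrite [X in X * _]mxE mulr_suml.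
by apply: eq_bigr => i _; rewrite !mxE; ring.
Qed.

Lemma sum_frame_coframe i j : \sum_p E x p i * C p j = (i == j)%:R.
Proof.
have := congr1 (fun m : 'M_(_, _) => m i j) (frame_coframe oE); rewrite [in RHS]mxE => <-.
by rewrite mxE; apply: eq_bigr => p _; rewrite [in RHS]mxE.
Qed.

Lemma frame_curv_sum p q r s : frame_curv p q r s
  = \sum_i \sum_j \sum_l \sum_k E x r i * E x s j * (C p l * E x q k) * curvature g a x l k i j.
Proof.
rewrite /frame_curv mx_entry3; apply: eq_bigr => i _; apply: eq_bigr => j _.
rewrite mxE mx_entry3 mulr_sumr; apply: eq_bigr => l _; rewrite mulr_sumr.
by apply: eq_bigr => k _; rewrite -curvature_christoffel; ring.
Qed.

Lemma curvature_skew l k i j : curvature g a x l k i j = - curvature g a x l k j i.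
Proof. by rewrite !curvature_christoffel /curvature_mx !mxE; ring. Qed.

Lemma frame_curv_skew p q r s : frame_curv p q r s = - frame_curv p q s r.
Proof.
rewrite !frame_curv_sum [X in _ = - X]exchange_big -sumrN; apply: eq_bigr => i _.
rewrite -sumrN; apply: eq_bigr => j _; rewrite -sumrN; apply: eq_bigr => l _.
by rewrite -sumrN; apply: eq_bigr => k _; rewrite curvature_skew; ring.
Qed.

Lemma curvature_bianchi l i j k :
  curvature g a x l k i j + curvature g a x l i j k + curvature g a x l j k i = 0.
Proof.
have chC p q r y : U y -> christoffel g a y p q r = christoffel g a y p r q.
  by move=> Uy; exact: christoffelC oU gT Uy.
have dchC s p q r : pd s (fun y => christoffel g a y p q r) x
    = pd s (fun y => christoffel g a y p r q) x.
  by apply: (pd_eq_on s oU _ Ux) => y; exact: chC.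
pose S p q r := \sum_m christoffel g a x l p m * christoffel g a x m q r.
have SC p q r : S p q r = S p r q by apply: eq_bigr => m _; rewrite (chC m q r x Ux).
have curvE k' i' j' : curvature g a x l k' i' j' =
   pd i' (fun y => christoffel g a y l j' k') x - pd j' (fun y => christoffel g a y l i' k') x
   + (S i' j' k' - S j' i' k') by rewrite /curvature sumrB.
rewrite !curvE (dchC i l k j) (dchC j l i k) (dchC k l j i).
rewrite (SC i k j) (SC j i k) (SC k j i); ring.
Qed.

(** The first Bianchi identity is the symmetry of the Christoffel symbols together with
    the cancellation of the quadratic terms over cyclic permutations. *)
Lemma frame_curv_bianchi p q r s :
  frame_curv p q r s + frame_curv p r s q + frame_curv p s q r = 0.
Proof.
have sumE u v w : frame_curv p u v w = \sum_l \sum_k \sum_i \sum_j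
    C p l * (E x u k * E x v i * E x w j) * curvature g a x l k i j.
  rewrite frame_curv_sum.
  transitivity (\sum_i \sum_l \sum_k \sum_j
     C p l * (E x u k * E x v i * E x w j) * curvature g a x l k i j).
    apply: eq_bigr => i _; rewrite exchange_big; apply: eq_bigr => l _ /=.
    rewrite exchange_big; apply: eq_bigr => k _; apply: eq_bigr => j _ /=; ring.
  by rewrite exchange_big; apply: eq_bigr => l _; exact: exchange_big.
have rot (F : 'I_n -> 'I_n -> 'I_n -> R) :
    \sum_k \sum_i \sum_j F k i j = \sum_k \sum_i \sum_j F i j k.
  by rewrite [RHS]exchange_big; apply: eq_bigr => k _; exact: exchange_big.
rewrite !sumE -!big_split; apply: big1 => l _ /=.
rewrite [X in _ + X + _]rot [X in _ + X]rot [X in _ + X]rot -!big_split.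
apply: big1 => k _ /=; rewrite -!big_split; apply: big1 => i _ /=.
rewrite -!big_split; apply: big1 => j _ /=.
have := curvature_bianchi l i j k.
move: (curvature g a x l k i j) (curvature g a x l i j k) (curvature g a x l j k i) => u v w uvw.
have -> : w = - u - v by apply/eqP; rewrite -subr_eq0 -uvw; apply/eqP; ring.
ring.
Qed.

Lemma frame_ricciE r s : (E x *m ricci g a x *m (E x)^T) r s = \sum_p frame_curv p s p r.
Proof.
under [RHS]eq_bigr do rewrite frame_curv_sum.
rewrite mx_entry3.
transitivity (\sum_j \sum_k \sum_i \sum_l (i == l)%:R * (E x r j * E x s k * curvature g a x l k i j)).
  apply: eq_bigr => j _; apply: eq_bigr => k _; rewrite mxE mulr_sumr; apply: eq_bigr => i _.
  rewrite (bigD1 i) //= eqxx mul1r big1 ?addr0 // => l.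
  by rewrite eq_sym => /negbTE ->; rewrite mul0r.
transitivity (\sum_j \sum_k \sum_i \sum_l \sum_p
   E x p i * E x r j * (C p l * E x s k) * curvature g a x l k i j).
  do 4![apply: eq_bigr => ? _]; rewrite -sum_frame_coframe mulr_suml.
  by apply: eq_bigr => p _; ring.
transitivity (\sum_j \sum_p \sum_i \sum_l \sum_k
   E x p i * E x r j * (C p l * E x s k) * curvature g a x l k i j).
  apply: eq_bigr => j _.
  transitivity (\sum_k \sum_p \sum_i \sum_l
     E x p i * E x r j * (C p l * E x s k) * curvature g a x l k i j).
    apply: eq_bigr => k _; rewrite [RHS]exchange_big; apply: eq_bigr => i _.
    exact: exchange_big.
  rewrite exchange_big; apply: eq_bigr => p _; rewrite exchange_big; apply: eq_bigr => i _.
  exact: exchange_big.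
by rewrite exchange_big; apply: eq_bigr => p _; exact: exchange_big.
Qed.

End FrameComponents.

(** * Selfduality in an orthonormal frame *)

(** Both sides may be conjugated into the frame, where selfduality is a matter of
    components. *)
Lemma star2_fixed (R : realType) (G E b : 'M[R]_(3 + 1)) : orthoframe G E ->
  let b' := E *m b *m E^T in b'^T = - b' ->
  b' fib (base o0) = b' (base o1) (base o2) -> b' fib (base o1) = b' (base o2) (base o0) ->
  b' fib (base o2) = b' (base o0) (base o1) -> star2 G b = b.
Proof.
move=> oE b' b'T e0 e1 e2.
have [[S0 S1 S2] [T0 T1 T2] ST] := star2_1E b'T.
have Eu : E \in unitmx by case: oE => _ d; rewrite unitmxE unitfE gt_eqF.
have ETu : E^T \in unitmx by rewrite unitmx_tr.
have cancel (A : 'M[R]_(3 + 1)) : A = invmx E *m (E *m A *m E^T) *m invmx E^T.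
  by rewrite -!mulmxA mulmxV // mulmx1 mulKmx.
rewrite [LHS]cancel [RHS]cancel star2_frame // -/b'; congr (_ *m _ *m _).
move: b' b'T e0 e1 e2 S0 S1 S2 T0 T1 T2 ST => b' b'T e0 e1 e2.
set S := star2 _ _ => S0 S1 S2 T0 T1 T2 ST.
have sk (A : 'M[R]_(3 + 1)) i j : A^T = - A -> A i j = - A j i.
  by move=> AT; have := congr1 (fun m : 'M_(_, _) => m j i) AT; rewrite !mxE.
have dg (A : 'M[R]_(3 + 1)) i : A^T = - A -> A i i = 0.
  by move=> AT; have := sk A i i AT; move: (A i i) => u; lra.
apply/matrixP => i j; elim/ord4P: i => [i|]; elim/ord4P: j => [j|].
- elim/ord3P: i; elim/ord3P: j;
    rewrite ?(dg S) ?(dg b') // ?T0 ?T1 ?T2 ?e0 ?e1 ?e2 //;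
    rewrite (sk S) // (sk b') // ?T0 ?T1 ?T2 ?e0 ?e1 ?e2 //.
- rewrite (sk S) // (sk b') //; congr (- _).
  by elim/ord3P: i; rewrite ?S0 ?S1 ?S2 ?e0 ?e1 ?e2.
- by elim/ord3P: j; rewrite ?S0 ?S1 ?S2 ?e0 ?e1 ?e2.
- by rewrite (dg S) // (dg b').
Qed.

Section WeylInFrames.
Context {R : realType}.
Variables (g E : 'rV[R]_(3 + 1) -> 'M[R]_(3 + 1)) (x : 'rV[R]_(3 + 1)).
Hypothesis oE : orthoframe (g x) (E x).
Notation idx := 'I_(3 + 1).

Let K := frame_curv g (fun=> 0) E x.
Let C := coframe g E x.

Lemma frame_schoutenE c d : (E x *m schouten g x *m (E x)^T) c d = frame_schouten K c d.
Proof.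
have [orth _] := oE.
have trE : \tr (invmx (g x) *m ricci g (fun=> 0) x) = \sum_r frame_ricci K r r.
  rewrite (invmx_frame oE) -mulmxA mxtrace_mulC /mxtrace; apply: eq_bigr => r _.
  by rewrite frame_ricciE.
rewrite /schouten /frame_schouten trE -scalemxAr -scalemxAl mulmxBr mulmxBl.
rewrite -scalemxAr -scalemxAl orth.
have entry (A B : 'M[R]_(3 + 1)) u v : (u *: (A - v *: B)) c d = u * (A c d - v * B c d).
  by rewrite !mxE.
rewrite entry frame_ricciE // [(1%:M : 'M_(3 + 1)) c d]mxE; congr (_ * (_ - _ * _)).
  by congr (_^-1); rewrite -natrB.
by congr (_ / _); rewrite -[1]/(1%:R) -natrB // -natrM.
Qed.

Lemma sum4_prod (u v w z : idx -> R) (A B : idx -> idx -> R) :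
  \sum_l \sum_k \sum_i \sum_j u l * v k * w i * z j * (A i l * B j k)
  = (\sum_i \sum_l w i * u l * A i l) * (\sum_j \sum_k z j * v k * B j k).
Proof.
rewrite [X in _ = X * _]exchange_big [X in _ = _ * X]exchange_big mulr_suml.
apply: eq_bigr => l _; rewrite mulr_sumr; apply: eq_bigr => k _ /=.
rewrite mulr_suml; apply: eq_bigr => i _; rewrite mulr_sumr.
by apply: eq_bigr => j _; ring.
Qed.

Lemma sum_swap_lk (F : idx -> idx -> idx -> idx -> R) :
  \sum_l \sum_k \sum_i \sum_j F l k i j = \sum_l \sum_k \sum_i \sum_j F k l i j.
Proof. exact: exchange_big. Qed.

Lemma frame_weylE p q c d :
  \sum_l \sum_k \sum_i \sum_j E x p l * E x q k * E x c i * E x d j * weyl g x l k i j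
  = frame_weyl K p q c d.
Proof.
have [orth _] := oE.
have gE c' p' : \sum_i \sum_l E x c' i * E x p' l * g x i l = (c' == p')%:R.
  by rewrite -mx_entry3 orth mxE.
have PE c' p' : \sum_i \sum_l E x c' i * E x p' l * schouten g x i l = frame_schouten K c' p'.
  by rewrite -mx_entry3 frame_schoutenE.
pose T (F : idx -> idx -> idx -> idx -> R) :=
  \sum_l \sum_k \sum_i \sum_j E x p l * E x q k * E x c i * E x d j * F l k i j.
have TB F G : T (fun l k i j => F l k i j - G l k i j) = T F - T G.
  rewrite /T -sumrB; apply: eq_bigr => l _; rewrite -sumrB; apply: eq_bigr => k _.
  rewrite -sumrB; apply: eq_bigr => i _; rewrite -sumrB; apply: eq_bigr => j _.
  by rewrite mulrBr.
have TD F G : T (fun l k i j => F l k i j + G l k i j) = T F + T G.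
  rewrite /T -big_split; apply: eq_bigr => l _; rewrite -big_split; apply: eq_bigr => k _ /=.
  rewrite -big_split; apply: eq_bigr => i _; rewrite -big_split; apply: eq_bigr => j _ /=.
  by rewrite mulrDr.
have T1 A B : T (fun l k i j => A i l * B j k)
    = (\sum_i \sum_l E x c i * E x p l * A i l) * (\sum_j \sum_k E x d j * E x q k * B j k).
  exact: sum4_prod.
have T2 A B : T (fun l k i j => A i k * B j l)
    = (\sum_i \sum_l E x c i * E x q l * A i l) * (\sum_j \sum_k E x d j * E x p k * B j k).
  rewrite /T sum_swap_lk -sum4_prod; apply: eq_bigr => l _; apply: eq_bigr => k _.
  by apply: eq_bigr => i _; apply: eq_bigr => j _; ring.
rewrite -/(T _) /weyl.
have -> : T (fun l k i j => \sum_m g x l m * curvature g (fun=> 0) x m k i j -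
      (g x i l * schouten g x j k + g x j k * schouten g x i l -
       g x i k * schouten g x j l - g x j l * schouten g x i k))
  = T (fun l k i j => \sum_m g x l m * curvature g (fun=> 0) x m k i j) -
    (T (fun l k i j => g x i l * schouten g x j k) + T (fun l k i j => schouten g x i l * g x j k)
     - T (fun l k i j => g x i k * schouten g x j l) - T (fun l k i j => schouten g x i k * g x j l)).
  rewrite TB TB TB TD; congr (_ - (_ + _ - _ - _)).
    by do 4![apply: eq_bigr => ? _]; rewrite [g x _ _ * schouten _ _ _ _]mulrC.
  by do 4![apply: eq_bigr => ? _]; rewrite [g x _ _ * schouten _ _ _ _]mulrC.
rewrite !T1 !T2 !gE !PE /frame_weyl; congr (_ - _); last by ring.
rewrite /K frame_curv_sum.
transitivity (\sum_k \sum_i \sum_j \sum_m \sum_l E x p l * E x q k * E x c i * E x d j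
    * (g x l m * curvature g (fun=> 0) x m k i j)).
  rewrite /T exchange_big; apply: eq_bigr => k _ /=; rewrite exchange_big; apply: eq_bigr => i _ /=.
  rewrite exchange_big; apply: eq_bigr => j _ /=; rewrite [RHS]exchange_big; apply: eq_bigr => l _ /=.
  by rewrite mulr_sumr.
rewrite exchange_big; apply: eq_bigr => i _ /=; rewrite exchange_big; apply: eq_bigr => j _ /=.
rewrite exchange_big; apply: eq_bigr => m _ /=; apply: eq_bigr => k _.
rewrite /coframe [(E x *m g x) p m]mxE !(mulr_sumr, mulr_suml); apply: eq_bigr => l _.
by ring.
Qed.

(** Resolution of the identity in the two endomorphism indices, which leaves the two
    form indices in the chart. *)
Lemma weyl_coframe l k i j : weyl g x l k i j
  = \sum_p \sum_q C p l * C q k * (\sum_l' \sum_k' E x p l' * E x q k' * weyl g x l' k' i j).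
Proof.
transitivity (\sum_l' \sum_k' (l' == l)%:R * (k' == k)%:R * weyl g x l' k' i j).
  rewrite (bigD1 l) //= (bigD1 k) //= !eqxx !mul1r !big1 ?addr0 //.
    by move=> l' /negbTE ll; apply: big1 => k' _; rewrite ll !mul0r.
  by move=> k' /negbTE kk; rewrite kk mulr0 mul0r.
transitivity (\sum_l' \sum_k' \sum_p \sum_q C p l * C q k * (E x p l' * E x q k' * weyl g x l' k' i j)).
  apply: eq_bigr => l' _; apply: eq_bigr => k' _.
  rewrite -!(sum_frame_coframe oE) !mulr_suml; apply: eq_bigr => p _.
  by rewrite mulr_sumr mulr_suml; apply: eq_bigr => q _; rewrite /C; ring.
rewrite sum4_exchange exchange_big /=; apply: eq_bigr => p _; apply: eq_bigr => q _.
by rewrite mulr_sumr; apply: eq_bigr => l' _; rewrite mulr_sumr.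
Qed.

(** Selfduality is linear in the endomorphism indices, which may therefore be taken in the
    frame; the form indices are treated by star2_fixed. *)
Lemma asd_part_weyl : (forall p q n, asd_comp (frame_weyl K p q) n = 0) ->
  forall l k, asd_part (g x) (\matrix_(i, j) weyl g x l k i j) = 0.
Proof.
move=> asd0 l k; set b := \matrix_(i, j) _.
have bE c d : (E x *m b *m (E x)^T) c d
    = \sum_p \sum_q C p l * C q k * frame_weyl K p q c d.
  rewrite mx_entry3.
  under eq_bigr do under eq_bigr do rewrite mxE weyl_coframe.
  transitivity (\sum_i \sum_j \sum_p \sum_q C p l * C q k * (E x c i * E x d j *
      \sum_l' \sum_k' E x p l' * E x q k' * weyl g x l' k' i j)).
    apply: eq_bigr => i _; apply: eq_bigr => j _; rewrite mulr_sumr; apply: eq_bigr => p _.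
    by rewrite mulr_sumr; apply: eq_bigr => q _; ring.
  rewrite sum4_exchange exchange_big /=; apply: eq_bigr => p _; apply: eq_bigr => q _.
  rewrite -frame_weylE sum4_exchange.
  rewrite [X in _ = _ * X]exchange_big mulr_sumr; apply: eq_bigr => i _ /=.
  rewrite mulr_sumr; apply: eq_bigr => j _; rewrite !mulr_sumr; apply: eq_bigr => l' _.
  by rewrite !mulr_sumr; apply: eq_bigr => k' _; ring.
pose b' := E x *m b *m (E x)^T.
have wskew p q c d : frame_weyl K p q c d = - frame_weyl K p q d c.
  by rewrite /frame_weyl /K (frame_curv_skew _ _ _ _ p q c d); ring.
have b'T : b'^T = - b'.
  apply/matrixP => c d; rewrite mxE [RHS]mxE !bE -sumrN; apply: eq_bigr => p _.
  by rewrite -sumrN; apply: eq_bigr => q _; rewrite wskew mulrN.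
have asd_lin c1 d1 c2 d2 : (forall p q, frame_weyl K p q c1 d1 = frame_weyl K p q c2 d2) ->
    b' c1 d1 = b' c2 d2.
  by move=> eqw; rewrite !bE; apply: eq_bigr => p _; apply: eq_bigr => q _; rewrite eqw.
have e0 : b' fib (base o0) = b' (base o1) (base o2).
  by apply: asd_lin => p q; have /eqP := asd0 p q o0; rewrite subr_eq0 => /eqP.
have e1 : b' fib (base o1) = b' (base o2) (base o0).
  by apply: asd_lin => p q; have /eqP := asd0 p q o1; rewrite subr_eq0 => /eqP.
have e2 : b' fib (base o2) = b' (base o0) (base o1).
  by apply: asd_lin => p q; have /eqP := asd0 p q o2; rewrite subr_eq0 => /eqP.
have starb : star2 (g x) b = b by exact: star2_fixed oE b'T e0 e1 e2.
by rewrite /asd_part starb subrr scaler0.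
Qed.

End WeylInFrames.

(** * The conformal structure of an affine monopole *)

Section Monopole.
Context {R : realType}.
Variables (B : set 'rV[R]_3) (gB : 'rV[R]_3 -> 'M[R]_3) (aB : 'rV[R]_3 -> 'rV[R]_3)
  (w0 w1 : 'rV[R]_3 -> R) (A0 A1 : 'rV[R]_3 -> 'rV[R]_3) (M : set 'rV[R]_(3 + 1)).
Hypotheses (cmB : conformal_manifold B gB)
  (monoB : affine_monopole B gB aB w0 w1 A0 A1) (oM : open M)
  (MB : image_pi M `<=` B)
  (wpos : forall x, M x -> 0 < affine_weight w0 w1 (fun y : 'rV[R]_(3 + 1) => y 0 fib) x).
Implicit Types (x : 'rV[R]_(3 + 1)).

Let t x : R := x 0 fib.
Let w : 'rV[R]_(3 + 1) -> R := affine_weight w0 w1 t.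
Let g := affine_metric gB w0 w1 A0 A1 t.
Let lam (x : 'rV[R]_(3 + 1)) : R := 1.

(** The connection form in the coordinate t, restricted to the base directions. *)
Definition affine_theta (x : 'rV[R]_(3 + 1)) : 'rV[R]_3 := t x *: A1 (pi x) + A0 (pi x).
Let theta := affine_theta.

Let oB : open B. Proof. by case: cmB. Qed.
Let w1s : smooth B w1. Proof. by case: monoB. Qed.
Let w0s : smooth B w0. Proof. by case: monoB. Qed.
Let A1s : smooth_rV B A1. Proof. by case: monoB. Qed.
Let A0s : smooth_rV B A0. Proof. by case: monoB. Qed.
Let BM x : M x -> B (pi x). Proof. by move=> Mx; apply: MB; exists x. Qed.
Let lift v : smooth B v -> smooth M (fun x => v (pi x)).
Proof. by move=> /(smooth_lsubmx oB); exact: smooth_subset. Qed.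
Let ts : smooth M t. Proof. exact: smooth_coord. Qed.
Let ws : smooth M w. Proof. exact: smoothD oM (smoothM oM ts (lift w1s)) (lift w0s). Qed.

Lemma affine_theta_entry i x : theta x 0 i = t x * A1 (pi x) 0 i + A0 (pi x) 0 i.
Proof. by rewrite !mxE. Qed.

Let thetas i : smooth M (fun x => theta x 0 i).
Proof.
have := smoothD oM (smoothM oM ts (lift (A1s i))) (lift (A0s i)).
by apply: (smooth_eq_on oM) => y _; rewrite affine_theta_entry.
Qed.

Lemma pd_t_base i x : pd (base i) t x = 0.
Proof. by rewrite /t pd_coord eq_lrshift. Qed.

Lemma pd_t_fib x : pd fib t x = 1.
Proof. by rewrite /t pd_coord eqxx. Qed.

Lemma affine_formE x : affine_form A0 A1 t x = fibre_form theta x.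
Proof.
have entry j : affine_form A0 A1 t x 0 j = pd j t x + t x * pullback A1 x 0 j + pullback A0 x 0 j.
  by rewrite /affine_form; move: (pullback A1 x) (pullback A0 x) => p q; rewrite !mxE.
apply/rowP; elim/ord4P => [i|]; rewrite entry.
  by rewrite fibre_form_base /pullback !row_mxEl pd_t_base add0r affine_theta_entry.
by rewrite fibre_form_fib /pullback !row_mxEr pd_t_fib !mxE mulr0 !addr0.
Qed.

Lemma monopole_adapted : adapted M g gB lam w theta.
Proof.
have [_ gBs gBp] := cmB.
split; [exact: oM|exact: smooth_cst|exact: ws|exact: thetas| | |exact: wpos| | |].
- by move=> i j; exact: lift (gBs i j).
- by move=> x _; exact: ltr01.
- by move=> x /BM/gBp[].
- move=> x /BM/gBp[gT gpos]; exists (gram_schmidt (gB (pi x))).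
  exact: gram_schmidt_orthoframe.
- move=> x Mx; rewrite /g /affine_metric affine_formE /lam expr1n scale1r.
  by [].
Qed.

Lemma pd_base_w i x : M x ->
  pd (base i) w x = t x * pd i w1 (pi x) + pd i w0 (pi x).
Proof.
move=> Mx; rewrite (pdD (base i) (smoothM oM ts (lift w1s)) (lift w0s) Mx).
rewrite (pdM (base i) ts (lift w1s) Mx) pd_t_base mul0r add0r.
by rewrite (pd_base_lsubmx w1) (pd_base_lsubmx w0).
Qed.

Lemma pd_fib_w x : M x -> pd fib w x = w1 (pi x).
Proof.
move=> Mx; rewrite (pdD fib (smoothM oM ts (lift w1s)) (lift w0s) Mx).
rewrite (pdM fib ts (lift w1s) Mx) pd_t_fib mul1r.
by rewrite (pd_fib_lsubmx w1) (pd_fib_lsubmx w0) mulr0 !addr0.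
Qed.

Lemma pd_base_theta i j x : M x -> pd (base i) (fun y => theta y 0 j) x
  = t x * pd i (fun b => A1 b 0 j) (pi x) + pd i (fun b => A0 b 0 j) (pi x).
Proof.
move=> Mx; have -> : (fun y => theta y 0 j) = (fun y => t y * A1 (pi y) 0 j + A0 (pi y) 0 j).
  by apply/funext => y; exact: affine_theta_entry.
rewrite (pdD (base i) (smoothM oM ts (lift (A1s j))) (lift (A0s j)) Mx).
rewrite (pdM (base i) ts (lift (A1s j)) Mx) pd_t_base mul0r add0r.
by rewrite (pd_base_lsubmx (fun b => A1 b 0 j)) (pd_base_lsubmx (fun b => A0 b 0 j)).
Qed.

Lemma pd_fib_theta j x : M x -> pd fib (fun y => theta y 0 j) x = A1 (pi x) 0 j.
Proof.
move=> Mx; have -> : (fun y => theta y 0 j) = (fun y => t y * A1 (pi y) 0 j + A0 (pi y) 0 j).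
  by apply/funext => y; exact: affine_theta_entry.
rewrite (pdD fib (smoothM oM ts (lift (A1s j))) (lift (A0s j)) Mx).
rewrite (pdM fib ts (lift (A1s j)) Mx) pd_t_fib mul1r.
by rewrite (pd_fib_lsubmx (fun b => A1 b 0 j)) (pd_fib_lsubmx (fun b => A0 b 0 j)) mulr0 !addr0.
Qed.

(** The coefficient of t, and then the constant coefficient, of the form whose star
    enters the monopole equations. *)
Definition mono_form1 (b : 'rV[R]_3) := weylD_Lm1 aB w1 b.
Definition mono_form0 (b : 'rV[R]_3) := weylD_Lm1 aB w0 b + w0 b *: A1 b - w1 b *: A0 b.
Definition mono_form x : 'rV[R]_3 := t x *: mono_form1 (pi x) + mono_form0 (pi x).

Lemma mono_form1_entry b i : mono_form1 b 0 i = pd i w1 b - w1 b * aB b 0 i.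
Proof. by rewrite !mxE. Qed.

Lemma mono_form0_entry b i : mono_form0 b 0 i
  = pd i w0 b - w0 b * aB b 0 i + w0 b * A1 b 0 i - w1 b * A0 b 0 i.
Proof. by rewrite !mxE. Qed.

(** For the metric of a monopole the left-hand side of the induced Weyl equation is
    linear in t with the monopole forms as coefficients. *)
Lemma scale_form_mono x : M x ->
  scale_form lam w theta x - (w x * lam x) *: aB (pi x) = mono_form x.
Proof.
move=> Mx; apply/rowP => i.
have -> : (scale_form lam w theta x - (w x * lam x) *: aB (pi x)) 0 i
   = horiz_pd theta i (fun y => w y * lam y) x
     + w x * lam x * pd fib (fun y => theta y 0 i) x - w x * lam x * aB (pi x) 0 i.
  by move: (aB (pi x)) => q; rewrite !mxE.
have -> : mono_form x 0 i = t x * mono_form1 (pi x) 0 i + mono_form0 (pi x) 0 i.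
  by rewrite /mono_form; move: (mono_form1 _) (mono_form0 _) => p q; rewrite !mxE.
rewrite mono_form1_entry mono_form0_entry /horiz_pd.
have -> : (fun y => w y * lam y) = w by apply/funext => y; rewrite mulr1.
rewrite pd_base_w // pd_fib_w // pd_fib_theta // affine_theta_entry /lam /w /affine_weight.
ring.
Qed.

Lemma horiz_curvature_mono x : M x -> horiz_curvature theta x
  = t x *: ext_d A1 (pi x) + (ext_d A0 (pi x) + wedge (A1 (pi x)) (A0 (pi x))).
Proof.
move=> Mx; apply/matrixP => i j; rewrite mxE /horiz_pd.
have entry (P Q S : 'M[R]_3) : (t x *: P + (Q + S)) i j = t x * P i j + (Q i j + S i j).
  by rewrite !mxE.
rewrite entry !ext_dE wedgeE !pd_base_theta // !pd_fib_theta // !affine_theta_entry.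
ring.
Qed.

(** The monopole equations added up with weights t and 1. *)
Lemma monopole_star x : M x -> star1 (gB (pi x)) (mono_form x) = horiz_curvature theta x.
Proof.
move=> Mx; have [_ _ _ _ /(_ _ (BM Mx))[eq1 eq0]] := monoB.
by rewrite /mono_form star1_linear horiz_curvature_mono // -eq1 -eq0.
Qed.

Lemma monopole_induced_weyl : induced_weyl M g lam aB.
Proof.
exists (minimal_form lam w theta); first exact: minimal_weyl_form monopole_adapted.
move=> x Mx; apply/(induced_weylP monopole_adapted aB Mx).
by rewrite scale_form_mono // monopole_star.
Qed.

End Monopole.

Lemma orthoframe_posdef (R : realType) n (G E : 'M[R]_n) : G^T = G -> orthoframe G E -> posdef G.
Proof.
move=> GT oE v v0; set C := E *m G.
have CE : C *m E^T = 1%:M by exact: coframeK oE.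
have EC : E^T *m C = 1%:M by exact: frame_coframe oE.
have GC : G = C^T *m C.
  by rewrite /C trmx_mul GT -[RHS]mulmxA -/C EC mulmx1.
pose y := v *m C^T.
have y0 : y != 0.
  apply: contraNneq v0 => yz; have := congr1 (fun m => m *m E) yz.
  have CTE : C^T *m E = 1%:M by apply: trmx_inj; rewrite trmx_mul trmxK trmx1.
  by rewrite /y -mulmxA CTE mulmx1 mul0mx => /eqP.
have ipE : ip G v v = \sum_i y 0 i ^+ 2.
  have yT : C *m v^T = y^T by rewrite trmx_mul trmxK.
  rewrite /ip GC mulmxA -/y -mulmxA yT mxE.
  by apply: eq_bigr => i _; rewrite [X in _ * X]mxE expr2.
have [i yi] : exists i, y 0 i != 0.
  by apply: contrapT => /forallNP y00; case/eqP: y0; apply/rowP => i;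
     rewrite [RHS]mxE; apply/eqP/negPn/negP/y00.
rewrite ipE (bigD1 i) //= ltr_pwDl // ?exprn_even_gt0 //.
by apply: sumr_ge0 => k _; exact: sqr_ge0.
Qed.

Section MonopoleSubmersion.
Context {R : realType}.
Variables (B : set 'rV[R]_3) (gB : 'rV[R]_3 -> 'M[R]_3) (aB : 'rV[R]_3 -> 'rV[R]_3)
  (w0 w1 : 'rV[R]_3 -> R) (A0 A1 : 'rV[R]_3 -> 'rV[R]_3) (M : set 'rV[R]_(3 + 1)).
Hypotheses (cmB : conformal_manifold B gB)
  (monoB : affine_monopole B gB aB w0 w1 A0 A1) (oM : open M)
  (MB : image_pi M `<=` B)
  (wpos : forall x, M x -> 0 < affine_weight w0 w1 (fun y : 'rV[R]_(3 + 1) => y 0 fib) x).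
Implicit Types (x : 'rV[R]_(3 + 1)).

Let t x : R := x 0 fib.
Let w : 'rV[R]_(3 + 1) -> R := affine_weight w0 w1 t.
Let g := affine_metric gB w0 w1 A0 A1 t.
Let lam (x : 'rV[R]_(3 + 1)) : R := 1.
Let theta := affine_theta A0 A1.
Let adM : adapted M g gB lam w theta := monopole_adapted cmB monoB oM MB wpos.

Lemma ip_affine_metric x (X Y : 'rV[R]_(3 + 1)) : ip (g x) X Y
  = ip (gB (pi x)) (pi X) (pi Y)
    + w x ^- 2 * (X *m (fibre_form theta x)^T) 0 0 * (Y *m (fibre_form theta x)^T) 0 0.
Proof.
rewrite /ip /g /affine_metric affine_formE mulmxDr mulmxDl mxE; congr (_ + _).
  have block (a b : 'rV[R]_3) (r s : 'rV[R]_1) (G : 'M[R]_3) :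
      row_mx a r *m block_mx G 0 0 0 *m (row_mx b s)^T = a *m G *m b^T.
    by rewrite mul_row_block !mulmx0 !addr0 tr_row_mx mul_row_col mul0mx addr0.
  by have := block (pi X) (pi Y) (rsubmx X) (rsubmx Y) (gB (pi x)); rewrite !hsubmxK => <-.
rewrite -scalemxAr -scalemxAl mxE -mulrA; congr (_ * _).
move: (fibre_form theta x) => f.
have -> : X *m (f^T *m f) *m Y^T = (X *m f^T) *m (Y *m f^T)^T.
  by rewrite trmx_mul trmxK !mulmxA.
by rewrite mxE big_ord1 [X in _ * X]mxE.
Qed.

Lemma horizontalP x X : M x ->
  horizontal g x X <-> X *m (affine_form A0 A1 t x)^T = 0.
Proof.
move=> Mx; rewrite affine_formE -/theta; have wx : w x != 0 by rewrite lt0r_neq0 // wpos.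
have dform : (d_fib *m (fibre_form theta x)^T) 0 0 = 1.
  by rewrite /d_fib -rowE mxE mxE fibre_form_fib.
split=> [hX|X0 V V0].
  have := hX d_fib lsubmx_fib; rewrite ip_affine_metric lsubmx_fib dform mulr1.
  rewrite {1}/ip !mul0mx mxE add0r => /eqP.
  rewrite mulf_eq0 invr_eq0 expf_eq0 (negbTE wx) andbF orFb => /eqP X0.
  by apply/matrixP => i j; rewrite !ord1 X0 mxE.
by rewrite ip_affine_metric V0 X0 {1}/ip !mul0mx !mxE mulr0 addr0.
Qed.

Lemma monopole_conformal_submersion : conformal_submersion M (image_pi M) g gB lam.
Proof.
have [oB gBs gBp] := cmB.
have gT := adapted_symmetric adM.
split.
- split; [exact: oM|exact: smooth_adapted adM|move=> x Mx; split; first exact: gT].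
  have [EB oEB] := adapted_orthoframe adM Mx.
  exact: (orthoframe_posdef (gT x Mx) (adapted_frame_ortho adM Mx oEB)).
- split; first exact: open_image_pi.
    by move=> i j; apply: smooth_subset (gBs i j).
  by move=> b /MB/gBp.
- by [].
- exact: smooth_cst.
move=> x Mx; split; first exact: ltr01.
move=> X Y /(horizontalP _ Mx) X0 /(horizontalP _ Mx) Y0.
rewrite affine_formE in X0; rewrite ip_affine_metric X0 [X in _ * X * _]mxE.
by rewrite mulr0 mul0r addr0 expr1n mul1r.
Qed.

Lemma monopole_rel_scale x : M x -> rel_scale g lam x = w x.
Proof. by move=> Mx; rewrite /rel_scale (sqrt_adapted adM) // invrK mul1r. Qed.

(** In the coordinate t the trivial connection on the fibres works: length scale
    and connection form are affine in t by construction. *)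
Lemma monopole_affine_submersion : affine_submersion M (image_pi M) g lam (fun=> 0).
Proof.
have oN := open_image_pi oM.
have lift v : smooth (image_pi M) v -> smooth M (fun x => v (pi x)).
  by move=> /(smooth_lsubmx oN); apply: smooth_subset => x Mx; exists x.
have [_ w1s A0s A1s _] : affine_monopole B gB aB w0 w1 A0 A1 := monoB.
have w1s' : smooth M (fun x => w1 (pi x)).
  by apply: lift; exact: smooth_subset MB w1s.
have ws := adapted_rho adM.
split; first exact: smooth_cst.
- move=> X Xt Xs XtP u us up.
  have u' x : M x -> pd fib u x = 0.
    by move=> /up; rewrite /fibre_nabla mul0r addr0.
  have Xb x i : M x -> Xt x 0 (base i) = X (pi x) 0 i.
    move=> /XtP[Xp _]; have := congr1 (fun v : 'rV_3 => v 0 i) Xp.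
    by rewrite mxE.
  have Xf x : M x -> Xt x 0 fib = - \sum_i X (pi x) 0 i * theta x 0 i.
    move=> Mx; have [_ /(horizontalP _ Mx)] := XtP x Mx.
    rewrite affine_formE => /(congr1 (fun m : 'M_1 => m 0 0)).
    rewrite mxE big_split_ord big_ord1 /= [(fibre_form _ _)^T _ _ in X in _ + X]mxE.
    rewrite [X in _ + _ * X]fibre_form_fib mulr1 [RHS]mxE addrC => /eqP.
    rewrite addr_eq0 => /eqP ->; congr (- _); apply: eq_bigr => i _.
    by rewrite Xb // mxE fibre_form_base.
  have ub y k : (u y *: d_fib) 0 k = (k == fib)%:R * u y.
    by rewrite !mxE eqxx mulrC.
  have Zk k x : M x -> bracket Xt (fun x0 => u x0 *: d_fib) x 0 k
      = (k == fib)%:R * (\sum_i Xt x 0 i * pd i u x) - u x * pd fib (fun y => Xt y 0 k) x.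
    move=> Mx; rewrite mxE mulr_sumr.
    rewrite -[X in _ = _ - X](sum_pick (fun i => u x * pd i (fun y => Xt y 0 k) x) fib) -sumrB.
    apply: eq_bigr => i _; rewrite ub.
    have -> : (fun y => (u y *: d_fib) 0 k) = (fun y => (k == fib)%:R * u y).
      by apply/funext => y; exact: ub.
    rewrite (@pdM _ _ M (fun=> (k == fib)%:R) _ _ _ (@smooth_cst _ _ M _) us Mx) pd_cst.
    by ring.
  have Xbs i : smooth M (fun x => X (pi x) 0 i) by exact: lift (Xs i).
  have ths i := adapted_theta adM i.
  have Zf x : M x -> bracket Xt (fun x0 => u x0 *: d_fib) x 0 fib
      = \sum_i (X (pi x) 0 i * pd (base i) u x + u x * (X (pi x) 0 i * A1 (pi x) 0 i)).
    move=> Mx; rewrite Zk // eqxx mul1r big_split_ord big_ord1 /= -/fib u' // mulr0 addr0.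
    rewrite (@pd_eq_on _ _ M _ (fun y => - \sum_i X (pi y) 0 i * theta y 0 i) fib x oM) //.
    have XTs i : smooth M (fun y => X (pi y) 0 i * theta y 0 i) by exact: smoothM oM (Xbs i) (ths i).
    rewrite (pdN fib (smooth_sum (index_enum 'I_3) oM (fun i (_ : true) => XTs i)) Mx).
    rewrite (pd_sum (index_enum 'I_3) fib oM (fun i (_ : true) => XTs i) Mx).
    rewrite mulrN opprK mulr_sumr -big_split; apply: eq_bigr => i _ /=.
    rewrite Xb // (pdM fib (Xbs i) (ths i) Mx) (pd_fib_lsubmx (fun b => X b 0 i)).
    by rewrite (pd_fib_theta cmB monoB oM MB) // mul0r add0r.
  split=> [x Mx|x Mx].
    apply/rowP => k; rewrite mxE Zk // eq_lrshift mul0r sub0r [RHS]mxE.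
    rewrite (@pd_eq_on _ _ M _ (fun y => X (pi y) 0 k) fib x oM) //; last by move=> y; exact: Xb.
    by rewrite (pd_fib_lsubmx (fun b => X b 0 k)) mulr0 oppr0.
  rewrite /fibre_nabla mul0r addr0.
  have A1M i : smooth M (fun x => A1 (pi x) 0 i).
    by apply: (lift (fun b => A1 b 0 i)); exact: smooth_subset MB (A1s i).
  have Ts i : smooth M (fun x => X (pi x) 0 i * pd (base i) u x + u x * (X (pi x) 0 i * A1 (pi x) 0 i)).
    exact: smoothD oM (smoothM oM (Xbs i) (smooth_pd _ us)) (smoothM oM us (smoothM oM (Xbs i) (A1M i))).
  rewrite (pd_eq_on fib oM Zf Mx) (pd_sum (index_enum 'I_3) fib oM (fun i (_ : true) => Ts i) Mx).
  apply: big1 => i _.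
  rewrite (pdD fib (smoothM oM (Xbs i) (smooth_pd _ us)) (smoothM oM us (smoothM oM (Xbs i) (A1M i))) Mx).
  rewrite (pdM fib (Xbs i) (smooth_pd _ us) Mx) (pdM fib us (smoothM oM (Xbs i) (A1M i)) Mx).
  rewrite (pdM fib (Xbs i) (A1M i) Mx) u' // (pdC fib (base i) oM us Mx).
  rewrite (pd_fib_lsubmx (fun b => X b 0 i)) (pd_fib_lsubmx (fun b => A1 b 0 i)).
  rewrite (@pd_eq_on _ _ M (pd fib u) (fun=> 0) (base i) x oM u' Mx) pd_cst.
  by rewrite !(mul0r, mulr0, addr0).
move=> f fs x Mx.
have fM : smooth M (fun x => f (pi x)) by exact: lift.
have nablaE y : M y -> fibre_nabla (fun=> 0) (fun x => f (pi x) * rel_scale g lam x) y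
    = f (pi y) * w1 (pi y).
  move=> My; rewrite /fibre_nabla mul0r addr0.
  rewrite (@pd_eq_on _ _ M _ (fun y => f (pi y) * w y) fib y oM) //; last first.
    by move=> z Mz; rewrite monopole_rel_scale.
  rewrite (pdM fib fM ws My) (pd_fib_lsubmx f) mul0r add0r.
  by rewrite (pd_fib_w cmB monoB oM MB).
rewrite (pd_eq_on fib oM nablaE Mx) (pdM fib fM w1s' Mx).
by rewrite (pd_fib_lsubmx f) (pd_fib_lsubmx w1) mul0r mulr0 addr0.
Qed.

End MonopoleSubmersion.

(** * Selfduality of the vertical field *)

(** A 2-form with its components with respect to an adapted frame; the fibre direction
    contributes the correction by the connection form. *)
Lemma frame_change_block (R : realType) (EB bB : 'M[R]_3) (th beta : 'rV[R]_3) r :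
  block_mx EB (- (EB *m th^T)) 0 (r%:M : 'M_1) *m block_mx bB (- beta^T) beta 0
    *m (block_mx EB (- (EB *m th^T)) 0 r%:M)^T
  = block_mx (EB *m (bB - th^T *m beta + beta^T *m th) *m EB^T)
      (- ((r *: beta) *m EB^T)^T) ((r *: beta) *m EB^T) 0.
Proof.
have trE : (- (EB *m th^T))^T = - (th *m EB^T) by rewrite linearN /= trmx_mul trmxK.
rewrite tr_block_mx trE trmx0 tr_scalar_mx !mulmx_block !(mul0mx, mulmx0, add0r, addr0).
rewrite mul_scalar_mx; congr block_mx.
- by rewrite !(mulmxDr, mulmxDl, mulmxN, mulNmx, opprK, mulmxA).
- rewrite mul_mx_scalar mulmxN scalerN -[(r *: beta) *m _]scalemxAl.
  have trZ (v : 'rV[R]_3) : (r *: v)^T = r *: v^T by rewrite linearZ.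
  by rewrite trZ trmx_mul trmxK.
Qed.

Section MonopoleFaraday.
Context {R : realType}.
Variables (B : set 'rV[R]_3) (gB : 'rV[R]_3 -> 'M[R]_3) (aB : 'rV[R]_3 -> 'rV[R]_3)
  (w0 w1 : 'rV[R]_3 -> R) (A0 A1 : 'rV[R]_3 -> 'rV[R]_3) (M : set 'rV[R]_(3 + 1)).
Hypotheses (cmB : conformal_manifold B gB)
  (monoB : affine_monopole B gB aB w0 w1 A0 A1) (oM : open M)
  (MB : image_pi M `<=` B)
  (wpos : forall x, M x -> 0 < affine_weight w0 w1 (fun y : 'rV[R]_(3 + 1) => y 0 fib) x).
Implicit Types (x : 'rV[R]_(3 + 1)).

Let t x : R := x 0 fib.
Let w : 'rV[R]_(3 + 1) -> R := affine_weight w0 w1 t.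
Let g := affine_metric gB w0 w1 A0 A1 t.
Let lam (x : 'rV[R]_(3 + 1)) : R := 1.
Let theta := affine_theta A0 A1.
Let adM : adapted M g gB lam w theta := monopole_adapted cmB monoB oM MB wpos.
Let BM x : M x -> B (pi x). Proof. by move=> Mx; apply: MB; exists x. Qed.
Let oB : open B. Proof. by case: cmB. Qed.
Let lift v : smooth B v -> smooth M (fun x => v (pi x)).
Proof. by move=> /(smooth_lsubmx oB); exact: smooth_subset. Qed.
Let ts : smooth M t. Proof. exact: smooth_coord. Qed.
Let ws : smooth M w := adapted_rho adM.
Let ths := adapted_theta adM.
Let wn0 x : M x -> w x != 0. Proof. by move=> /wpos/lt0r_neq0. Qed.
Let w1s : smooth B w1. Proof. by case: monoB. Qed.
Let w0s : smooth B w0. Proof. by case: monoB. Qed.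
Let A1s : smooth_rV B A1. Proof. by case: monoB. Qed.

(** The derivative of w along the horizontal lift of a coordinate vector field; divided
    by w it is the part of D^0 that involves the length scale. *)
Definition log_pd i x : R := t x * pd i w1 (pi x) + pd i w0 (pi x) - theta x 0 i * w1 (pi x).
Definition minimal_base i x : R := A1 (pi x) 0 i + (w x)^-1 * log_pd i x.

Lemma minimal_form_mono x : M x ->
  minimal_form lam w theta x = row_mx (\row_i minimal_base i x) 0.
Proof.
move=> Mx; have := minimal_form_scale adM Mx.
have -> : dfun lam x = 0 by apply/rowP => i; rewrite !mxE; exact: pd_cst.
rewrite scaler0 addr0 => ->; congr row_mx; apply/rowP => i.
have lw : (fun y => w y * lam y) = w by apply/funext => y; rewrite mulr1.
rewrite !mxE /horiz_pd lw (pd_base_w cmB monoB oM MB) // (pd_fib_w cmB monoB oM MB) //.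
rewrite (pd_fib_theta cmB monoB oM MB) // /minimal_base /log_pd /lam.
by rewrite !mulr1 -/(t x); field; exact: wn0.
Qed.

Let nS i : smooth M (log_pd i).
Proof.
exact: smoothB oM (smoothD oM (smoothM oM ts (lift (smooth_pd i w1s)))
  (lift (smooth_pd i w0s))) (smoothM oM (ths i) (lift w1s)).
Qed.

Lemma pd_minimal_base k i x : M x -> pd k (minimal_base i) x
  = pd k (fun y => A1 (pi y) 0 i) x - pd k w x / w x ^+ 2 * log_pd i x
    + (w x)^-1 * (pd k t x * pd i w1 (pi x) + t x * pd k (fun y => pd i w1 (pi y)) x
      + pd k (fun y => pd i w0 (pi y)) x
      - (pd k (fun y => theta y 0 i) x * w1 (pi x) + theta x 0 i * pd k (fun y => w1 (pi y)) x)).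
Proof.
move=> Mx; have A1M := lift (A1s i); have wV := smoothV oM wn0 ws.
have d1 := lift (smooth_pd i w1s); have d0 := lift (smooth_pd i w0s); have w1M := lift w1s.
have td := smoothM oM ts d1; have tw := smoothM oM (ths i) w1M.
rewrite (pdD k A1M (smoothM oM wV (nS i)) Mx) (pdM k wV (nS i) Mx) (pdV k (wn0 Mx) ws Mx).
rewrite (pdB k (smoothD oM td d0) tw Mx) (pdD k td d0 Mx) (pdM k ts d1 Mx).
by rewrite (pdM k (ths i) w1M Mx) !mulNr addrA.
Qed.

(** The mixed component of F^0, contracted with the unit vertical vector. *)
Definition faraday_form x : 'rV[R]_3 :=
  - (w1 (pi x) / w x) *: mono_form aB w0 w1 A0 A1 x + mono_form1 aB w1 (pi x).

Lemma faraday_form_entry i x : M x -> faraday_form x 0 i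
  = pd i w1 (pi x) - A1 (pi x) 0 i * w1 (pi x) - w1 (pi x) / w x * log_pd i x.
Proof.
move=> Mx; have -> : faraday_form x 0 i = - (w1 (pi x) / w x) *
    (t x * mono_form1 aB w1 (pi x) 0 i + mono_form0 aB w0 w1 A0 A1 (pi x) 0 i)
    + mono_form1 aB w1 (pi x) 0 i.
  rewrite /faraday_form /mono_form; move: (mono_form1 _ _ _) (mono_form0 _ _ _ _ _ _) => p q.
  by rewrite !mxE.
rewrite mono_form1_entry mono_form0_entry /log_pd affine_theta_entry.
have := wn0 Mx; rewrite /w /affine_weight -/(t x) => wx.
by field.
Qed.

Lemma pd_fib_minimal_base i x : M x ->
  w x * pd fib (minimal_base i) x = faraday_form x 0 i.
Proof.
move=> Mx; rewrite pd_minimal_base // faraday_form_entry //.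
rewrite (pd_fib_lsubmx (fun b => A1 b 0 i)) (pd_fib_lsubmx (pd i w1)) (pd_fib_lsubmx (pd i w0)).
rewrite (pd_fib_lsubmx w1) pd_t_fib (pd_fib_w cmB monoB oM MB) // (pd_fib_theta cmB monoB oM MB) //.
move: (log_pd i x) => n; field; exact: wn0.
Qed.

(** The horizontal part of F^0 is the star of its vertical part. Both are linear
    combinations of the two monopole forms and their stars, with the coefficient
    - w1 / w coming from the derivative of w along the fibre. *)
Lemma horizontal_faraday i j x : M x ->
  pd (base i) (minimal_base j) x - pd (base j) (minimal_base i) x
  - theta x 0 i * pd fib (minimal_base j) x + theta x 0 j * pd fib (minimal_base i) x
  = star1 (gB (pi x)) (faraday_form x) i j.
Proof.
move=> Mx; have [_ _ _ _ /(_ _ (BM Mx))[eq1 _]] := monoB.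
have starE : star1 (gB (pi x)) (faraday_form x) = - (w1 (pi x) / w x) *: horiz_curvature theta x
    + ext_d A1 (pi x).
  by rewrite /faraday_form star1_linear eq1 (monopole_star cmB monoB oM MB Mx).
have entry (P Q : 'M[R]_3) c : (c *: P + Q) i j = c * P i j + Q i j by rewrite !mxE.
rewrite starE entry ext_dE (horiz_curvature_mono cmB monoB oM MB Mx).
have entry3 (P Q S : 'M[R]_3) : (t x *: P + (Q + S)) i j = t x * P i j + (Q i j + S i j).
  by rewrite !mxE.
rewrite entry3 !ext_dE wedgeE !pd_minimal_base //.
rewrite !(pd_base_lsubmx (fun b => A1 b 0 _)) !(pd_base_lsubmx w1).
rewrite !(pd_base_lsubmx (pd _ w1)) !(pd_base_lsubmx (pd _ w0)).
rewrite !(pd_fib_lsubmx (fun b => A1 b 0 _)) !(pd_fib_lsubmx w1).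
rewrite !(pd_fib_lsubmx (pd _ w1)) !(pd_fib_lsubmx (pd _ w0)).
rewrite !pd_t_base !pd_t_fib !(pd_base_w cmB monoB oM MB) // !(pd_fib_w cmB monoB oM MB) //.
rewrite !(pd_base_theta cmB monoB oM MB) // !(pd_fib_theta cmB monoB oM MB) //.
rewrite (pdC j i oB w1s (BM Mx)) (pdC j i oB w0s (BM Mx)) /log_pd !affine_theta_entry.
have := wn0 Mx; rewrite /w /affine_weight -/(t x).
move: (pd i (pd j w1) (pi x)) (pd i (pd j w0) (pi x)) (pd i w1 (pi x)) (pd j w1 (pi x)) => a b c d.
move: (pd i w0 (pi x)) (pd j w0 (pi x)) (w1 (pi x)) (w0 (pi x)) (t x) => e f w1x w0x tx wx.
move: (pd i (fun b => A1 b 0 j) (pi x)) (pd j (fun b => A1 b 0 i) (pi x)) => k l.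
move: (pd i (fun b => A0 b 0 j) (pi x)) (pd j (fun b => A0 b 0 i) (pi x)) => m n.
move: (A1 (pi x) 0 i) (A1 (pi x) 0 j) (A0 (pi x) 0 i) (A0 (pi x) 0 j) => p q r s.
by field.
Qed.

Lemma monopole_selfdual_submersion : selfdual_submersion M g.
Proof.
exists (minimal_form lam w theta); first exact: minimal_weyl_form adM.
move=> x Mx; have [EB oEB] := adapted_orthoframe adM Mx.
have oE := adapted_frame_ortho adM Mx oEB.
pose beta : 'rV[R]_3 := \row_i pd fib (minimal_base i) x.
pose bB : 'M[R]_3 := \matrix_(i, j) (pd (base i) (minimal_base j) x - pd (base j) (minimal_base i) x).
have mE i : forall y, M y -> minimal_form lam w theta y 0 (base i) = minimal_base i y.
  by move=> y My; rewrite minimal_form_mono // row_mxEl mxE.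
have m0 : forall y, M y -> minimal_form lam w theta y 0 fib = 0.
  by move=> y My; rewrite minimal_form_mono // row_mxEr mxE.
have dE : ext_d (minimal_form lam w theta) x = block_mx bB (- beta^T) beta 0.
  apply/matrixP; elim/ord4P => [i|]; elim/ord4P => [j|]; rewrite ext_dE.
  - rewrite block_mxEul (pd_eq_on _ oM (mE j) Mx) (pd_eq_on _ oM (mE i) Mx).
    by rewrite [RHS]mxE.
  - rewrite block_mxEur (pd_eq_on _ oM m0 Mx) (pd_eq_on _ oM (mE i) Mx) pd_cst sub0r.
    by rewrite [RHS]mxE; congr (- _); rewrite !mxE.
  - rewrite block_mxEdl (pd_eq_on _ oM m0 Mx) (pd_eq_on _ oM (mE j) Mx) pd_cst subr0.
    by rewrite mxE.
  - by rewrite block_mxEdr (pd_eq_on _ oM m0 Mx) pd_cst subrr mxE.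
pose chi := faraday_form x.
have HE : bB - (theta x)^T *m beta + beta^T *m theta x = star1 (gB (pi x)) chi.
  apply/matrixP => i j; rewrite -horizontal_faraday //.
  have entry (P : 'M[R]_3) (u v : 'rV[R]_3) : (P - u^T *m v + v^T *m u) i j
     = P i j - u 0 i * v 0 j + v 0 i * u 0 j by rewrite !mxE !big_ord1 !mxE.
  by rewrite entry [bB i j]mxE ![beta _ _]mxE [_ * theta x 0 j]mulrC.
have betaE : w x *: beta = chi.
  by apply/rowP => i; rewrite mxE [X in _ * X]mxE pd_fib_minimal_base.
have frameE : adapted_frame lam w theta EB x *m ext_d (minimal_form lam w theta) x
     *m (adapted_frame lam w theta EB x)^T
   = block_mx (star1 1%:M (chi *m EB^T)) (- (chi *m EB^T)^T) (chi *m EB^T) 0.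
  by rewrite dE /adapted_frame /lam invr1 !scale1r frame_change_block HE betaE star1_frame.
have [U0 U1 U2 UT] := star1_1E (chi *m EB^T).
apply: (star2_fixed oE); rewrite frameE.
- rewrite tr_block_mx UT opp_block_mx oppr0 trmx0 opprK; congr block_mx.
  by rewrite linearN /= trmxK.
- by rewrite block_mxEul block_mxEdl U0.
- by rewrite block_mxEul block_mxEdl U1.
- by rewrite block_mxEul block_mxEdl U2.
Qed.

End MonopoleFaraday.

(** * Exterior calculus *)

Section ExteriorCalculus.
Context {R : realType} {n : nat}.
Variable U : set 'rV[R]_n.
Hypothesis oU : open U.
Implicit Types (a b : 'rV[R]_n -> 'rV[R]_n) (h : 'rV[R]_n -> R) (x : 'rV[R]_n).

Lemma smooth_rVD a b : smooth_rV U a -> smooth_rV U b -> smooth_rV U (fun y => a y + b y).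
Proof.
move=> as_ bs i; have := smoothD oU (as_ i) (bs i).
by apply: (smooth_eq_on oU) => y _; rewrite mxE.
Qed.

Lemma smooth_rVZ h a : smooth U h -> smooth_rV U a -> smooth_rV U (fun y => h y *: a y).
Proof.
move=> hs as_ i; have := smoothM oU hs (as_ i).
by apply: (smooth_eq_on oU) => y _; rewrite mxE.
Qed.

Lemma smooth_rVN a : smooth_rV U a -> smooth_rV U (fun y => - a y).
Proof.
by move=> as_ i; have := smoothN oU (as_ i); apply: (smooth_eq_on oU) => y _; rewrite mxE.
Qed.

Lemma ext_dD a b x : smooth_rV U a -> smooth_rV U b -> U x ->
  ext_d (fun y => a y + b y) x = ext_d a x + ext_d b x.
Proof.
move=> as_ bs Ux; apply/matrixP => i j; rewrite [RHS]mxE !ext_dE.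
have pdE k l : pd k (fun y => (a y + b y) 0 l) x
    = pd k (fun y => a y 0 l) x + pd k (fun y => b y 0 l) x.
  rewrite -(pdD k (as_ l) (bs l) Ux); congr (pd k _ x).
  by apply/funext => y; rewrite mxE.
by rewrite !pdE; ring.
Qed.

Lemma ext_dZ h a x : smooth U h -> smooth_rV U a -> U x ->
  ext_d (fun y => h y *: a y) x = wedge (dfun h x) (a x) + h x *: ext_d a x.
Proof.
move=> hs as_ Ux; apply/matrixP => i j; rewrite [RHS]mxE [X in _ + X]mxE wedgeE !ext_dE.
have pdE k l : pd k (fun y => (h y *: a y) 0 l) x
    = pd k h x * a x 0 l + h x * pd k (fun y => a y 0 l) x.
  rewrite -(pdM k hs (as_ l) Ux); congr (pd k _ x).
  by apply/funext => y; rewrite mxE.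
rewrite !pdE ![dfun h x _ _]mxE; move: (pd i h x) (pd j h x) (h x) (a x 0 i) (a x 0 j).
by move: (pd i _ x) (pd j _ x) => *; ring.
Qed.

Lemma ext_dN a x : smooth_rV U a -> U x -> ext_d (fun y => - a y) x = - ext_d a x.
Proof.
move=> as_ Ux; apply/matrixP => i j; rewrite [RHS]mxE !ext_dE.
have pdE k l : pd k (fun y => (- a y) 0 l) x = - pd k (fun y => a y 0 l) x.
  rewrite -(pdN k (as_ l) Ux); congr (pd k _ x).
  by apply/funext => y; rewrite mxE.
by rewrite !pdE; ring.
Qed.

Lemma wedge_congr (E : 'M[R]_n) (a b : 'rV[R]_n) :
  E *m wedge a b *m E^T = wedge (a *m E^T) (b *m E^T).
Proof. by rewrite /wedge mulmxBr mulmxBl !trmx_mul !trmxK !mulmxA. Qed.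

End ExteriorCalculus.

Section Cyclic.
(** Statements about three frame directions are made once, for any cyclic
    relabelling of the indices. *)
Variant cyclic (c c1 c2 : 'I_3) : Prop :=
| Cyclic012 of c = o0 & c1 = o1 & c2 = o2
| Cyclic120 of c = o1 & c1 = o2 & c2 = o0
| Cyclic201 of c = o2 & c1 = o0 & c2 = o1.

Lemma cyclicS c c1 c2 : cyclic c c1 c2 -> cyclic c1 c2 c.
Proof. by case=> -> -> ->; constructor. Qed.

Lemma cyclic_neq c c1 c2 : cyclic c c1 c2 ->
  [/\ (c == c1) = false, (c1 == c2) = false & (c2 == c) = false].
Proof. by case=> -> -> ->. Qed.

Lemma cyclic_sum (V : nmodType) c c1 c2 (F : 'I_3 -> V) :
  cyclic c c1 c2 -> \sum_k F k = F c + F c1 + F c2.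
Proof.
case=> -> -> ->; rewrite sum3 //; first by rewrite -addrA addrC.
by rewrite addrC addrA.
Qed.

Context {R : pzRingType}.

(** The three independent entries of a skew 3 by 3 matrix, numbered so that entry c sits
    in position (c+1, c+2). *)
Definition axial (T : 'M[R]_3) (c : 'I_3) : R := nth 0 [:: T o1 o2; T o2 o0; T o0 o1] c.

Lemma axialE T c c1 c2 : cyclic c c1 c2 -> axial T c = T c1 c2.
Proof. by case=> -> -> ->. Qed.

(** The vector product, with values in a module on the right. *)
Definition cross (V : lmodType R) (p : 'I_3 -> R) (e : 'I_3 -> V) (c : 'I_3) : V :=
  nth 0 [:: p o1 *: e o2 - p o2 *: e o1; p o2 *: e o0 - p o0 *: e o2;
            p o0 *: e o1 - p o1 *: e o0] c.

Lemma crossE (V : lmodType R) p (e : 'I_3 -> V) c c1 c2 :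
  cyclic c c1 c2 -> cross p e c = p c1 *: e c2 - p c2 *: e c1.
Proof. by case=> -> -> ->. Qed.

End Cyclic.

Lemma star1_cyclic (R : realType) (v : 'rV[R]_3) c c1 c2 : cyclic c c1 c2 ->
  let S := star1 1%:M v in
  [/\ S c1 c2 = v 0 c, S c2 c1 = - v 0 c & S c c = 0].
Proof.
move=> cyc S; have [U0 U1 U2 UT] := star1_1E v.
have sk i j : S i j = - S j i.
  by have := congr1 (fun m : 'M_3 => m j i) UT; rewrite mxE [in RHS]mxE.
have S0 i : S i i = 0 by have := sk i i; lra.
by case: cyc => -> -> ->; split; rewrite ?S0 // sk -/S ?U0 ?U1 ?U2.
Qed.

Lemma asd_comp_cyclic (R : realType) (b : 'I_(3 + 1) -> 'I_(3 + 1) -> R) c c1 c2 :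
  cyclic c c1 c2 -> asd_comp b c = b fib (base c) - b (base c1) (base c2).
Proof. by case=> -> -> ->. Qed.

(** * Structure equations of an Einstein-Weyl space *)

(** If the connection matrices are skew up to a multiple f of the identity, so is the
    curvature, with the derivative of f as trace part. *)
Lemma curvature_mx_skew (R : realType) n (U : set 'rV[R]_n) (T : 'I_n -> 'rV[R]_n -> 'M[R]_n)
    (f : 'I_n -> 'rV[R]_n -> R) i j x :
  open U -> (forall k, smooth_mx U (T k)) -> U x ->
  (forall k y, U y -> T k y + (T k y)^T = (f k y)%:M) ->
  curvature_mx T i j x + (curvature_mx T i j x)^T = (pd i (f j) x - pd j (f i) x)%:M.
Proof.
move=> oU Ts Ux Tf.
have dT k l p q : pd k (fun y => T l y p q) x + pd k (fun y => T l y q p) x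
    = pd k (f l) x *+ (p == q).
  rewrite -(pdD k (Ts l p q) (Ts l q p) Ux).
  have eqU y : U y -> T l y p q + T l y q p = f l y *+ (p == q).
    by move=> /(Tf l)/(congr1 (fun m : 'M_n => m p q)); rewrite mxE [X in _ + X]mxE [RHS]mxE.
  rewrite (pd_eq_on k oU eqU Ux); case: (p == q); first by rewrite mulr1n.
  by rewrite mulr0n; exact: pd_cst.
have Tt k : (T k x)^T = (f k x)%:M - T k x by rewrite -(Tf k x Ux) addrC addKr.
have comm : (T i x *m T j x - T j x *m T i x)^T = - (T i x *m T j x - T j x *m T i x).
  rewrite linearB /= !trmx_mul !Tt; move: (T i x) (T j x) (f i x) (f j x) => a b u v.
  rewrite !(mulmxBl, mulmxBr) -!scalar_mxM !mul_scalar_mx !mul_mx_scalar [v * u]mulrC.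
  by apply/matrixP => p q; rewrite !mxE; ring.
apply/matrixP => p q.
have := congr1 (fun m : 'M_n => m p q) comm; rewrite /curvature_mx.
move: (T i x *m T j x - T j x *m T i x) => K Kpq.
have entry (A B : 'M[R]_n) : (A - B + K + (A - B + K)^T) p q
    = A p q + A q p - (B p q + B q p) + (K p q + K q p) by rewrite !mxE; ring.
have KE : K p q + K q p = 0 by move: Kpq; rewrite mxE [RHS]mxE => ->; rewrite subrr.
rewrite entry KE ![pd_mx _ _ _ _ _]mxE !dT [RHS]mxE addr0.
by rewrite mulrnBl.
Qed.

Definition base_frame {R : realType} (gB : 'rV[R]_3 -> 'M[R]_3) b := gram_schmidt (gB b).

Section BaseStructure.
Context {R : realType}.
Variables (B : set 'rV[R]_3) (gB : 'rV[R]_3 -> 'M[R]_3) (aB : 'rV[R]_3 -> 'rV[R]_3).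
Hypotheses (cmB : conformal_manifold B gB) (aBs : smooth_rV B aB).

Let EB := base_frame gB.
Let oB : open B. Proof. by case: cmB. Qed.
Let gs : smooth_mx B gB. Proof. by case: cmB. Qed.
Let gT b : B b -> (gB b)^T = gB b. Proof. by case: cmB => _ _ gp /gp[]. Qed.

Lemma smooth_base_frame : smooth_mx B EB.
Proof. by case: cmB => _ _ gp; exact: smooth_gram_schmidt oB gs gp. Qed.

Lemma base_frame_ortho b : B b -> orthoframe (gB b) (EB b).
Proof. by case: cmB => _ _ gp /gp[gbT gbp]; exact: gram_schmidt_orthoframe. Qed.

Let Es := smooth_base_frame.
Let oE := base_frame_ortho.
Let Th := frame_connection gB aB EB.
Let Ths i : smooth_mx B (Th i). Proof. exact: smooth_frame_connection oB gs aBs Es oE i. Qed.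

Definition base_coform c b : 'rV[R]_3 := row c (coframe gB EB b).
(** The skew part of the Weyl connection of B in the orthonormal frame; its trace part
    is the Weyl 1-form. *)
Definition base_conn c b : 'rV[R]_3 := \row_i axial (Th i b) c.
(** The skew part of the curvature of the Weyl connection, with the form indices in
    the chart. *)
Definition base_curv c b : 'M[R]_3 := \matrix_(i, j) axial (curvature_mx Th i j b) c.

Lemma base_connE c c1 c2 i b : cyclic c c1 c2 -> B b ->
  [/\ Th i b c1 c2 = base_conn c b 0 i, Th i b c2 c1 = - base_conn c b 0 i &
      Th i b c c = aB b 0 i].
Proof.
move=> cyc Bb; have [n1 n2 n3] := cyclic_neq cyc.
have ent p q : Th i b p q + Th i b q p = 2 * aB b 0 i *+ (p == q).
  have entT (P : 'M[R]_3) v : P + P^T = v%:M -> P p q + P q p = v *+ (p == q).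
    by move=> /(congr1 (fun m : 'M_3 => m p q)); rewrite !mxE.
  exact: entT (frame_connection_compatible aB oB gs gT Es oE i Bb).
have e12 := ent c1 c2; have ecc := ent c c; rewrite n2 mulr0n eqxx mulr1n in e12 ecc.
have bE : base_conn c b 0 i = Th i b c1 c2 by rewrite mxE (axialE _ cyc).
rewrite bE; split; [by []|by move: (Th i b c1 c2) (Th i b c2 c1) e12 => p q e12; lra|].
by move: (Th i b c c) (aB b 0 i) ecc => p q ecc; lra.
Qed.

Lemma smooth_base_coform c : smooth_rV B (base_coform c).
Proof.
move=> i; have := smooth_mxM oB Es gs c i.
by apply: (smooth_eq_on oB) => y _; rewrite [RHS]mxE.
Qed.

Lemma smooth_base_conn c : smooth_rV B (base_conn c).
Proof.
move=> i; have [c1 [c2 cyc]] : exists c1 c2, cyclic c c1 c2.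
  by elim/ord3P: c; [exists o1, o2|exists o2, o0|exists o0, o1]; constructor.
have := Ths i c1 c2.
by apply: (smooth_eq_on oB) => y _; rewrite [RHS]mxE (axialE _ cyc).
Qed.

Lemma ext_d_base_coform c c1 c2 b : cyclic c c1 c2 -> B b ->
  ext_d (base_coform c) b = - wedge (base_conn c2 b) (base_coform c1 b)
    + wedge (base_conn c1 b) (base_coform c2 b) - wedge (aB b) (base_coform c b).
Proof.
move=> cyc Bb; apply/matrixP => i j; rewrite ext_dE.
have entry (P Q S : 'M[R]_3) : (- P + Q - S) i j = - P i j + Q i j - S i j by rewrite !mxE.
rewrite entry !wedgeE.
have coE k d y : base_coform k y 0 d = coframe gB EB y k d by rewrite mxE.
have dE k l : pd k (fun y => base_coform c y 0 l) b = pd_mx k (coframe gB EB) b c l.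
  by rewrite mxE; congr (pd k _ b); apply/funext => y; rewrite coE.
have [_ t21 tcc] := base_connE i (cyclicS cyc) Bb.
have [_ s21 scc] := base_connE j (cyclicS cyc) Bb.
have [t12 _ _] := base_connE i (cyclicS (cyclicS cyc)) Bb.
have [s12 _ _] := base_connE j (cyclicS (cyclicS cyc)) Bb.
have [_ _ tc] := base_connE i cyc Bb; have [_ _ sc] := base_connE j cyc Bb.
have key (Ti Tj C Di Dj : 'M[R]_3) k1i k1j k2i k2j ai aj :
    Ti c c = ai -> Tj c c = aj -> Ti c c1 = k2i -> Tj c c1 = k2j ->
    Ti c c2 = - k1i -> Tj c c2 = - k1j -> (Ti *m C + Di) c j = (Tj *m C + Dj) c i ->
    Di c j - Dj c i = - (k2i * C c1 j - C c1 i * k2j) + (k1i * C c2 j - C c2 i * k1j)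
      - (ai * C c j - C c i * aj).
  have mulE (P Q S : 'M[R]_3) k :
      (P *m Q + S) c k = P c c * Q c k + P c c1 * Q c1 k + P c c2 * Q c2 k + S c k.
    by rewrite mxE [X in X + _]mxE (cyclic_sum _ cyc).
  move=> Tc Sc T1 S1 T2 S2; rewrite !mulE Tc Sc T1 S1 T2 S2.
  move: (C c i) (C c j) (C c1 i) (C c1 j) (C c2 i) (C c2 j) (Di c j) (Dj c i) => *; lra.
rewrite (dE i j) (dE j i) (coE c) (coE c i) (coE c1 j) (coE c1 i) (coE c2 j) (coE c2 i).
exact: key tc sc t12 s12 t21 s21 (frame_connection_torsion_free aB oB gs gT Es oE i j Bb c).
Qed.

(** The second structure equation; the trace part commutes with everything and drops out. *)
Lemma ext_d_base_conn c c1 c2 b : cyclic c c1 c2 -> B b ->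
  ext_d (base_conn c) b = base_curv c b + wedge (base_conn c1 b) (base_conn c2 b).
Proof.
move=> cyc Bb; apply/matrixP => i j; rewrite ext_dE.
have entry (P Q : 'M[R]_3) : (P + Q) i j = P i j + Q i j by rewrite !mxE.
rewrite entry wedgeE [base_curv c b i j]mxE (axialE _ cyc).
have dE k l : pd k (fun y => base_conn c y 0 l) b = pd_mx k (Th l) b c1 c2.
  by rewrite mxE; congr (pd k _ b); apply/funext => y; rewrite mxE (axialE _ cyc).
rewrite !dE.
have curvE (P Q S T : 'M[R]_3) : (P - Q + (S *m T - T *m S)) c1 c2
    = P c1 c2 - Q c1 c2 + (S c1 c * T c c2 + S c1 c1 * T c1 c2 + S c1 c2 * T c2 c2
      - (T c1 c * S c c2 + T c1 c1 * S c1 c2 + T c1 c2 * S c2 c2)).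
  have mulE (V W : 'M[R]_3) : (V *m W) c1 c2 = V c1 c * W c c2 + V c1 c1 * W c1 c2
      + V c1 c2 * W c2 c2 by rewrite mxE (cyclic_sum _ cyc).
  by rewrite -!mulE !mxE.
have [t12 _ _] := base_connE i cyc Bb; have [s12 _ _] := base_connE j cyc Bb.
have [_ t21' tcc'] := base_connE i (cyclicS cyc) Bb.
have [_ s21' scc'] := base_connE j (cyclicS cyc) Bb.
have [_ t21'' tcc''] := base_connE i (cyclicS (cyclicS cyc)) Bb.
have [_ s21'' scc''] := base_connE j (cyclicS (cyclicS cyc)) Bb.
have key (Ti Tj Di Dj : 'M[R]_3) k1i k1j k2i k2j ki kj ai aj :
    Ti c1 c1 = ai -> Tj c1 c1 = aj -> Ti c2 c2 = ai -> Tj c2 c2 = aj ->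
    Ti c1 c2 = ki -> Tj c1 c2 = kj -> Ti c c2 = - k1i -> Tj c c2 = - k1j ->
    Ti c1 c = - k2i -> Tj c1 c = - k2j ->
    Di c1 c2 - Dj c1 c2 = (Di - Dj + (Ti *m Tj - Tj *m Ti)) c1 c2
      + (k1i * k2j - k2i * k1j).
  move=> a1 a2 a3 a4 a5 a6 a7 a8 a9 a10; rewrite curvE a1 a2 a3 a4 a5 a6 a7 a8 a9 a10.
  by move: (Di c1 c2) (Dj c1 c2) => *; ring.
exact: key tcc' scc' tcc'' scc'' t12 s12 t21' s21' t21'' s21''.
Qed.

Definition base_curv_frame c b : 'M[R]_3 := EB b *m base_curv c b *m (EB b)^T.

Lemma base_curv_frameE c c1 c2 b r s : cyclic c c1 c2 -> B b ->
  base_curv_frame c b r s = frame_curv gB aB EB b c1 c2 r s.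
Proof.
move=> cyc Bb; rewrite /base_curv_frame /frame_curv.
suff -> : base_curv c b = frame_form gB aB EB b c1 c2 by [].
apply/matrixP => i j; rewrite [LHS]mxE (axialE _ cyc) [RHS]mxE.
have conE k y : B y -> pd_mx k (fun z => (EB z)^T) y + christoffel_mx gB aB k y *m (EB y)^T
   = (EB y)^T *m Th k y by move=> By; exact: (@frame_connectionE R 3 B gB aB EB oE k y By).
by rewrite (frame_curvature oB gs aBs Es oE Ths conE).
Qed.

(** The curvature of a Weyl connection is skew up to the Faraday form, which occupies
    the diagonal. *)
Lemma base_frame_curv_skew r s b : B b -> exists F, forall p q,
  frame_curv gB aB EB b p q r s + frame_curv gB aB EB b q p r s = F *+ (p == q).
Proof.
move=> Bb.
have conE k y : B y -> pd_mx k (fun z => (EB z)^T) y + christoffel_mx gB aB k y *m (EB y)^T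
   = (EB y)^T *m Th k y by move=> By; exact: (@frame_connectionE R 3 B gB aB EB oE k y By).
pose f k y := 2 * aB y 0 k.
pose Fm : 'M[R]_3 := \matrix_(i, j) (pd i (f j) b - pd j (f i) b).
exists ((EB b *m Fm *m (EB b)^T) r s) => p q; rewrite /frame_curv.
have formE : frame_form gB aB EB b p q + frame_form gB aB EB b q p = Fm *+ (p == q).
  apply/matrixP => i j.
  have entM (P : 'M[R]_3) k : (P *+ k) i j = P i j *+ k by rewrite mulmxnE.
  rewrite [LHS]mxE entM [frame_form gB aB EB b p q i j]mxE [frame_form gB aB EB b q p i j]mxE.
  rewrite (frame_curvature oB gs aBs Es oE Ths conE) // [Fm i j]mxE.
  have skew := curvature_mx_skew i j oB Ths Bb
    (fun k y (By : B y) => frame_connection_compatible aB oB gs gT Es oE k By).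
  have entT (P : 'M[R]_3) v : P + P^T = v%:M -> P p q + P q p = v *+ (p == q).
    by move=> /(congr1 (fun m : 'M_3 => m p q)); rewrite !mxE.
  exact: entT skew.
have entD (P Q S : 'M[R]_3) : P + Q = S -> (EB b *m P *m (EB b)^T) r s
   + (EB b *m Q *m (EB b)^T) r s = (EB b *m S *m (EB b)^T) r s.
  by move=> <-; rewrite mulmxDr mulmxDl [RHS]mxE.
rewrite (entD _ _ _ formE); case: (p == q); first by rewrite !mulr1n.
by rewrite !mulr0n mulmx0 mul0mx mxE.
Qed.

Hypothesis ewB : einstein_weyl B gB aB.

Lemma einstein_weyl_frame b : B b -> exists mu, forall r s,
  \sum_p frame_curv gB aB EB b p s p r + \sum_p frame_curv gB aB EB b p r p s
  = mu *+ (r == s).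
Proof.
move=> Bb; have := ewB Bb; rewrite /sym_tracefree; move: (_ / _) => m /eqP.
rewrite subr_eq0 => /eqP Sm; exists (2 * m) => r s.
rewrite -!(frame_ricciE _ (oE Bb)).
have ent (E P : 'M[R]_3) (G : 'M[R]_3) : E *m G *m E^T = 1%:M -> 2^-1 *: (P + P^T) = m *: G ->
    (E *m P *m E^T) r s + (E *m P *m E^T) s r = 2 * m *+ (r == s).
  move=> EG PG.
  have PT : E *m (P + P^T) *m E^T = E *m P *m E^T + (E *m P *m E^T)^T.
    by rewrite mulmxDr mulmxDl !trmx_mul trmxK !mulmxA.
  have := congr1 (fun Q => (2 *: (E *m Q *m E^T)) r s) PG.
  rewrite -!scalemxAr -!scalemxAl EG PT scalerA divff ?pnatr_eq0 // scale1r => eqE.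
  by move: eqE; rewrite !mxE mulrnAr mulr1 mulrnAr.
exact: ent (coframeK (oE Bb)) Sm.
Qed.

(** For an Einstein-Weyl structure the frame components of the curvature, as a
    map from 2-forms to skew endomorphisms, have no symmetric tracefree part. *)
Lemma base_curv_frame_sym c c1 c2 b : cyclic c c1 c2 -> B b ->
  base_curv_frame c b c2 c + base_curv_frame c1 b c1 c2 = 0 /\
  base_curv_frame c b c1 c2 = base_curv_frame c1 b c2 c.
Proof.
move=> cyc Bb; have [mu Ric] := einstein_weyl_frame Bb.
have [n1 n2 n3] := cyclic_neq cyc; have cyc1 := cyclicS cyc.
rewrite !(base_curv_frameE _ _ cyc Bb) !(base_curv_frameE _ _ cyc1 Bb).
have skr p q r s : frame_curv gB aB EB b p q r s = - frame_curv gB aB EB b p q s r.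
  exact: frame_curv_skew.
have skl p q r s : p == q = false ->
    frame_curv gB aB EB b p q r s = - frame_curv gB aB EB b q p r s.
  move=> pq; have [F /(_ p q)] := base_frame_curv_skew r s Bb.
  by rewrite pq => /eqP; rewrite addr_eq0 => /eqP.
have dg p q r s : frame_curv gB aB EB b p p r s = frame_curv gB aB EB b q q r s.
  have [F FE] := base_frame_curv_skew r s Bb.
  have := FE p p; have := FE q q; rewrite !eqxx mulr1n => *; lra.
(* Off the diagonal the Ricci tensor is, up to the Faraday form, a component of
   the curvature; on the diagonal it is a sum of two of them. *)
have := Ric c c1; have := Ric c c; have := Ric c1 c1.
rewrite n1 !eqxx mulr0n !mulr1n !(cyclic_sum _ cyc).
move: (frame_curv gB aB EB b) skr skl dg => K skr skl dg.
have z p q r : K p q r r = 0 by have := skr p q r r; lra.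
have d := dg c c1 c c1.
have := skl c1 c2 c2 c n2; have := skl c2 c c1 c2 n3; have := skl c1 c2 c1 c2 n2.
have := skr c2 c c2 c1; have := skl c2 c c2 c n3; have := skl c c1 c c1 n1.
have := skr c1 c1 c1 c; have := skr c1 c c1 c; have := skr c2 c c2 c.
have := skr c1 c2 c1 c2; have := skr c2 c1 c2 c1.
by rewrite !z => *; split; lra.
Qed.

End BaseStructure.

(** * Structure equations of a monopole metric *)

Section PullbackForms.
Context {R : realType}.
Implicit Types (a b : 'rV[R]_3 -> 'rV[R]_3) (x : 'rV[R]_(3 + 1)).

Lemma ext_d_pullback a x : ext_d (pullback a) x = block_mx (ext_d a (pi x)) 0 0 0.
Proof.
have pb i y : pullback a y 0 (base i) = a (pi y) 0 i by rewrite /pullback row_mxEl.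
have pf y : pullback a y 0 fib = 0 by rewrite /pullback row_mxEr mxE.
have db k i : pd k (fun y => pullback a y 0 (base i)) x = pd k (fun y => a (pi y) 0 i) x.
  by congr (pd k _ x); apply/funext => y; exact: pb.
have df k : pd k (fun y => pullback a y 0 fib) x = 0.
  by rewrite (_ : (fun y => _) = (fun=> 0)) ?pd_cst //; apply/funext => y; exact: pf.
apply/matrixP; elim/ord4P => [i|]; elim/ord4P => [j|]; rewrite ext_dE ?db ?df.
- rewrite block_mxEul ext_dE (pd_base_lsubmx (fun y => a y 0 j)).
  by rewrite (pd_base_lsubmx (fun y => a y 0 i)).
- by rewrite block_mxEur mxE (pd_fib_lsubmx (fun y => a y 0 i)) subrr.
- by rewrite block_mxEdl mxE (pd_fib_lsubmx (fun y => a y 0 j)) subrr.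
- by rewrite block_mxEdr mxE subrr.
Qed.

Lemma wedge_pullback a b x :
  wedge (pullback a x) (pullback b x) = block_mx (wedge (a (pi x)) (b (pi x))) 0 0 0.
Proof.
have pb c i : pullback c x 0 (base i) = c (pi x) 0 i by rewrite /pullback row_mxEl.
have pf c : pullback c x 0 fib = 0 by rewrite /pullback row_mxEr mxE.
apply/matrixP; elim/ord4P => [i|]; elim/ord4P => [j|]; rewrite wedgeE ?pb ?pf.
- by rewrite block_mxEul wedgeE.
- by rewrite block_mxEur mxE !mulr0 subrr.
- by rewrite block_mxEdl mxE !mul0r subrr.
- by rewrite block_mxEdr mxE mul0r subrr.
Qed.

End PullbackForms.

Lemma star1_wedge (R : realType) (q : 'rV[R]_3) : star1 1%:M q
  = q 0 o0 *: wedge (delta_mx 0 o1) (delta_mx 0 o2) + q 0 o1 *: wedge (delta_mx 0 o2) (delta_mx 0 o0)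
    + q 0 o2 *: wedge (delta_mx 0 o0) (delta_mx 0 o1).
Proof.
have [U0 U1 U2 UT] := star1_1E q.
have sk i j : star1 1%:M q i j = - star1 1%:M q j i.
  by have := congr1 (fun m : 'M_3 => m j i) UT; rewrite mxE [in RHS]mxE.
have S0 i : star1 1%:M q i i = 0 by have := sk i i; lra.
have entry (Q S T : 'M[R]_3) c d e i j :
  (c *: Q + d *: S + e *: T) i j = c * Q i j + d * S i j + e * T i j by rewrite !mxE.
have dE (c i : 'I_3) : (delta_mx 0 c : 'rV[R]_3) 0 i = (i == c)%:R by rewrite mxE.
apply/matrixP; elim/ord3P; elim/ord3P; rewrite entry !wedgeE !dE /= ?S0 ?U0 ?U1 ?U2.
- ring.
- ring.
- by rewrite sk U1; ring.
- by rewrite sk U2; ring.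
- ring.
- ring.
- ring.
- by rewrite sk U0; ring.
- ring.
Qed.

Section MonopoleCoframe.
Context {R : realType}.
Variables (B : set 'rV[R]_3) (gB : 'rV[R]_3 -> 'M[R]_3) (aB : 'rV[R]_3 -> 'rV[R]_3)
  (w0 w1 : 'rV[R]_3 -> R) (A0 A1 : 'rV[R]_3 -> 'rV[R]_3) (M : set 'rV[R]_(3 + 1)).
Hypotheses (cmB : conformal_manifold B gB) (aBs : smooth_rV B aB)
  (monoB : affine_monopole B gB aB w0 w1 A0 A1) (oM : open M)
  (MB : image_pi M `<=` B)
  (wpos : forall x, M x -> 0 < affine_weight w0 w1 (fun y : 'rV[R]_(3 + 1) => y 0 fib) x).
Implicit Types (x : 'rV[R]_(3 + 1)).

Let t x : R := x 0 fib.
Let w : 'rV[R]_(3 + 1) -> R := affine_weight w0 w1 t.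
Let g := affine_metric gB w0 w1 A0 A1 t.
Let lam (x : 'rV[R]_(3 + 1)) : R := 1.
Let theta := affine_theta A0 A1.
Let adM : adapted M g gB lam w theta := monopole_adapted cmB monoB oM MB wpos.
Let BM x : M x -> B (pi x). Proof. by move=> Mx; apply: MB; exists x. Qed.
Let oB : open B. Proof. by case: cmB. Qed.
Let lift v : smooth B v -> smooth M (fun x => v (pi x)).
Proof. by move=> /(smooth_lsubmx oB); exact: smooth_subset. Qed.
Let wn0 x : M x -> w x != 0. Proof. by move=> /wpos/lt0r_neq0. Qed.
Let EB := base_frame gB.
Let oEB x : M x -> orthoframe (gB (pi x)) (EB (pi x)).
Proof. by move=> /BM; exact: base_frame_ortho. Qed.

Definition monopole_frame x := adapted_frame (fun=> 1) (affine_weight w0 w1 (fun y => y 0 fib))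
  (affine_theta A0 A1) (base_frame gB (pi x)) x.
Definition hcoform c : 'rV[R]_(3 + 1) -> 'rV[R]_(3 + 1) := pullback (base_coform gB c).
Definition hconn c : 'rV[R]_(3 + 1) -> 'rV[R]_(3 + 1) := pullback (base_conn gB aB c).
Definition vcoform x : 'rV[R]_(3 + 1) :=
  (affine_weight w0 w1 (fun y => y 0 fib) x)^-1 *: fibre_form (affine_theta A0 A1) x.
(** Components of the Weyl 1-form of B, and then of the monopole form divided by w, in
    the orthonormal frame of B. *)
Definition weyl_comp c x : R := (aB (pi x) *m (base_frame gB (pi x))^T) 0 c.
Definition mono_comp c x : R := ((affine_weight w0 w1 (fun y => y 0 fib) x)^-1 *:
  (mono_form aB w0 w1 A0 A1 x *m (base_frame gB (pi x))^T)) 0 c.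

Let E4 := monopole_frame.

Lemma monopole_frame_ortho x : M x -> orthoframe (g x) (E4 x).
Proof.
move=> Mx; have := adapted_frame_ortho adM Mx (oEB Mx).
by [].
Qed.

Lemma coframe_block x : M x -> coframe g E4 x
  = block_mx (coframe gB EB (pi x)) 0 ((w x)^-1 *: theta x) ((w x)^-1)%:M.
Proof.
move=> Mx; set X := block_mx _ _ _ _.
have XE : X *m (E4 x)^T = 1%:M.
  rewrite /X /E4 /monopole_frame /adapted_frame invr1 !scale1r -/EB -/w -/theta tr_block_mx.
  rewrite trmx0 tr_scalar_mx mulmx_block !(mul0mx, mulmx0, addr0, add0r).
  rewrite (coframeK (oEB Mx)) -scalar_mxM mulVf ?wn0 // linearN /= trmx_mul trmxK.
  rewrite mulmxN -/EB !mul_scalar_mx -scalemxAl subrr.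
  by rewrite scalar_mx_block.
have CE : coframe g E4 x *m (E4 x)^T = 1%:M := coframeK (monopole_frame_ortho Mx).
have EC : (E4 x)^T *m coframe g E4 x = 1%:M := frame_coframe (monopole_frame_ortho Mx).
by rewrite -[X]mulmx1 -EC mulmxA XE mul1mx.
Qed.

Lemma coframe_base c j x : M x -> coframe g E4 x (base c) j = hcoform c x 0 j.
Proof.
move=> Mx; rewrite coframe_block // /hcoform /pullback; move: j; elim/ord4P => [i|].
  by rewrite block_mxEul row_mxEl [RHS]mxE.
by rewrite block_mxEur row_mxEr [LHS]mxE [RHS]mxE.
Qed.

Lemma coframe_fib j x : M x -> coframe g E4 x fib j = vcoform x 0 j.
Proof.
move=> Mx; rewrite coframe_block // /vcoform /fibre_form scale_row_mx; move: j; elim/ord4P => [i|].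
  by rewrite block_mxEdl row_mxEl.
by rewrite block_mxEdr row_mxEr scalemx1.
Qed.

Lemma base_coform_sum (v : 'rV[R]_3) b : B b ->
  v = \sum_c (v *m (EB b)^T) 0 c *: base_coform gB c b.
Proof.
move=> Bb; have {1}-> : v = v *m (EB b)^T *m coframe gB EB b.
  by rewrite -mulmxA (frame_coframe (base_frame_ortho cmB Bb)) mulmx1.
by rewrite mulmx_sum_row.
Qed.

Lemma pullback_sum (f : 'I_3 -> R) x :
  row_mx (\sum_c f c *: base_coform gB c (pi x)) 0 = \sum_c f c *: hcoform c x.
Proof.
by rewrite !sum3 /hcoform /pullback !scale_row_mx !add_row_mx !scaler0 !addr0.
Qed.

Lemma pullback_weyl x : M x -> pullback aB x = \sum_c weyl_comp c x *: hcoform c x.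
Proof.
move=> Mx; rewrite -(pullback_sum (weyl_comp ^~ x)) /pullback; congr row_mx.
exact: base_coform_sum (BM Mx).
Qed.

Lemma minimal_form_frame x : M x -> minimal_form lam w theta x
  = \sum_c (weyl_comp c x + mono_comp c x) *: hcoform c x.
Proof.
move=> Mx; have := minimal_form_scale adM Mx.
have -> : dfun lam x = 0 by apply/rowP => i; rewrite !mxE; exact: pd_cst.
rewrite scaler0 addr0 => ->; have := scale_form_mono cmB monoB oM MB Mx.
rewrite -/t -/w -/theta -/lam => /eqP; rewrite subr_eq mulr1 => /eqP ->.
rewrite scalerDr scalerA mulVf ?wn0 // scale1r.
rewrite -(pullback_sum (fun c => weyl_comp c x + mono_comp c x)); congr row_mx.
rewrite [LHS](base_coform_sum _ (BM Mx)); apply: eq_bigr => c _; congr (_ *: _).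
by rewrite mulmxDl -scalemxAl mxE addrC.
Qed.

(** The first structure equation of the fibres; this is where the monopole
    equation enters. *)
Lemma ext_d_vcoform x : M x -> ext_d vcoform x
  = - wedge (\sum_c (weyl_comp c x + mono_comp c x) *: hcoform c x) (vcoform x)
    + (mono_comp o0 x *: wedge (hcoform o1 x) (hcoform o2 x)
     + mono_comp o1 x *: wedge (hcoform o2 x) (hcoform o0 x)
     + mono_comp o2 x *: wedge (hcoform o0 x) (hcoform o1 x)).
Proof.
move=> Mx; rewrite -minimal_form_frame //.
have xiE y : M y -> xi_form g y = vcoform y.
  by move=> My; apply/rowP => i; rewrite (xi_form_adapted adM i My) [RHS]mxE.
have := weyl_ext_d_xi adM Mx; rewrite /weyl_ext_d (xiE x Mx).
have -> : ext_d (xi_form g) x = ext_d vcoform x.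
  apply/matrixP => i j; rewrite !ext_dE.
  have dE k l : pd k (fun y => xi_form g y 0 l) x = pd k (fun y => vcoform y 0 l) x.
    by apply: (pd_eq_on k oM _ Mx) => y /xiE ->.
  by rewrite !dE.
move=> /(canRL (addrK _)) ->; rewrite addrC; congr (_ + _).
rewrite -(monopole_star cmB monoB oM MB Mx) /hcoform !wedge_pullback.
rewrite !(scale_block_mx, add_block_mx) !scaler0 !addr0; congr block_mx.
have oE := oEB Mx; have FC := frame_coframe oE; rewrite -/(coframe gB EB (pi x)) in FC.
have CF := coframeK oE; rewrite -/(coframe gB EB (pi x)) in CF.
(* 2-forms on the base are compared in the orthonormal frame, where the star is
   explicit. *)
have conj_inj (P Q : 'M[R]_3) :
    EB (pi x) *m P *m (EB (pi x))^T = EB (pi x) *m Q *m (EB (pi x))^T -> P = Q.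
  have recover (E C S : 'M[R]_3) : E^T *m C = 1%:M -> C^T *m (E *m S *m E^T) *m C = S.
    move=> EC; have CE : C^T *m E = 1%:M by rewrite -[E]trmxK -trmx_mul EC trmx1.
    by rewrite !mulmxA CE mul1mx -mulmxA EC mulmx1.
  by move=> eqPQ; rewrite -(recover _ _ P FC) eqPQ recover.
have wE c d : EB (pi x) *m wedge (base_coform gB c (pi x)) (base_coform gB d (pi x))
    *m (EB (pi x))^T = wedge (delta_mx 0 c) (delta_mx 0 d).
  by rewrite wedge_congr /base_coform -!row_mul CF !row1.
apply: conj_inj; rewrite -scalemxAr -scalemxAl (star1_frame _ oE).
have conjD (E P Q S : 'M[R]_3) u v z : E *m (u *: P + v *: Q + z *: S) *m E^T
    = u *: (E *m P *m E^T) + v *: (E *m Q *m E^T) + z *: (E *m S *m E^T).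
  by rewrite !mulmxDr !mulmxDl -!scalemxAr -!scalemxAl.
rewrite conjD !wE star1_wedge.
have qE c : mono_comp c x = (w x)^-1 * (mono_form aB w0 w1 A0 A1 x *m (EB (pi x))^T) 0 c.
  by rewrite /mono_comp; move: (_ *m _) => q; rewrite [LHS]mxE.
rewrite !qE; move: (mono_form aB w0 w1 A0 A1 x *m (EB (pi x))^T) (wedge _ _) (wedge _ _) (wedge _ _).
by move=> q W0 W1 W2; rewrite !scalerDr !scalerA.

Qed.

(** The first structure equation of B, pulled back. *)
Lemma ext_d_hcoform c c1 c2 x : cyclic c c1 c2 -> M x -> ext_d (hcoform c) x
  = - wedge (hconn c2 x) (hcoform c1 x) + wedge (hconn c1 x) (hcoform c2 x)
    - wedge (pullback aB x) (hcoform c x).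
Proof.
move=> cyc Mx; rewrite ext_d_pullback (ext_d_base_coform aB cmB cyc (BM Mx)) !wedge_pullback.
by rewrite !(opp_block_mx, add_block_mx) !oppr0 !addr0.
Qed.

Lemma ext_d_hconn c c1 c2 x : cyclic c c1 c2 -> M x -> ext_d (hconn c) x
  = block_mx (base_curv gB aB c (pi x)) 0 0 0 + wedge (hconn c1 x) (hconn c2 x).
Proof.
move=> cyc Mx; rewrite ext_d_pullback (ext_d_base_conn aB cmB cyc (BM Mx)) wedge_pullback.
by rewrite add_block_mx !addr0.
Qed.

Lemma smooth_pullback a : smooth_rV B a -> smooth_rV M (pullback a).
Proof.
move=> as_; elim/ord4P => [i|].
  have := lift (as_ i); apply: (smooth_eq_on oM) => y _; rewrite /pullback row_mxEl.
  by [].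
have := @smooth_cst R _ M 0; apply: (smooth_eq_on oM) => y _.
by rewrite /pullback row_mxEr mxE.
Qed.

Lemma smooth_hcoform c : smooth_rV M (hcoform c).
Proof. by apply: smooth_pullback; exact: smooth_base_coform. Qed.

Lemma smooth_hconn c : smooth_rV M (hconn c).
Proof. by apply: smooth_pullback; exact: smooth_base_conn. Qed.

Let wVs : smooth M (fun x => (w x)^-1).
Proof. exact: smoothV oM wn0 (adapted_rho adM). Qed.

Lemma smooth_vcoform : smooth_rV M vcoform.
Proof.
apply: (smooth_rVZ oM wVs); elim/ord4P => [i|].
  by have := adapted_theta adM i; apply: (smooth_eq_on oM) => y _; rewrite fibre_form_base.
by have := @smooth_cst R _ M 1; apply: (smooth_eq_on oM) => y _; rewrite fibre_form_fib.
Qed.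

Let smooth_frame_comp (v : 'rV[R]_(3 + 1) -> 'rV[R]_3) c :
  (forall i, smooth M (fun x => v x 0 i)) -> smooth M (fun x => (v x *m (EB (pi x))^T) 0 c).
Proof.
move=> vs; have := smooth_sum (index_enum 'I_3) oM
  (fun i (_ : true) => smoothM oM (vs i) (lift (smooth_base_frame cmB c i))).
apply: (smooth_eq_on oM) => y _; rewrite [RHS]mxE; apply: eq_bigr => i _.
by rewrite [(EB (pi y))^T _ _]mxE.
Qed.

Lemma smooth_weyl_comp c : smooth M (weyl_comp c).
Proof. by apply: (smooth_frame_comp c) => i; exact: lift (aBs i). Qed.

Lemma smooth_mono_comp c : smooth M (mono_comp c).
Proof.
have [w0s w1s A0s A1s _] := monoB.
have ms i : smooth M (fun x => mono_form aB w0 w1 A0 A1 x 0 i).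
  have s1 := lift (smoothB oB (smooth_pd i w1s) (smoothM oB w1s (aBs i))).
  have s0 := lift (smoothB oB (smoothD oB (smoothB oB (smooth_pd i w0s) (smoothM oB w0s (aBs i)))
    (smoothM oB w0s (A1s i))) (smoothM oB w1s (A0s i))).
  have := smoothD oM (smoothM oM (smooth_coord fib oM) s1) s0.
  apply: (smooth_eq_on oM) => y _; rewrite -mono_form1_entry -mono_form0_entry.
  have entry (P Q : 'rV[R]_3) r : (r *: P + Q) 0 i = r * P 0 i + Q 0 i by rewrite !mxE.
  by rewrite /mono_form entry.
have := smoothM oM wVs (smooth_frame_comp c ms).
by apply: (smooth_eq_on oM) => y _; rewrite [RHS]mxE.
Qed.

End MonopoleCoframe.

(** * Selfdual conformal structures from structure equations *)

Section AsdCurvatureFrame.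
Context {R : realType}.
Notation idx := 'I_(3 + 1).
Variables (o h : 'I_3 -> idx -> R) (S : 'I_3 -> idx -> idx -> R) (al p ga : 'I_3 -> R).
Hypotheses (o_fib : forall c, o c fib = 0) (S_fib : forall c i, S c fib i = 0)
  (gaE : forall c, ga c = - (al c + 2^-1 * p c)).

Definition wedge_comp (u v : idx -> R) r s : R := u r * v s - v r * u s.
Let D c (i : idx) : R := (i == base c)%:R.
Let Df (i : idx) : R := (i == fib)%:R.

Definition d_hcoframe c c1 c2 r s : R :=
  - wedge_comp (o c2) (D c1) r s + wedge_comp (o c1) (D c2) r s
  - wedge_comp (fun i => al c * D c i + al c1 * D c1 i + al c2 * D c2 i) (D c) r s.

Definition d_vcoframe c c1 c2 r s : R :=
  - wedge_comp (fun i => (al c + p c) * D c i + (al c1 + p c1) * D c1 i + (al c2 + p c2) * D c2 i) Df r s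
  + (p c * wedge_comp (D c1) (D c2) r s + p c1 * wedge_comp (D c2) (D c) r s + p c2 * wedge_comp (D c) (D c1) r s).

Definition asd_form c c1 c2 i : R :=
  - o c i + (ga c * Df i + (ga c1 * D c2 i - ga c2 * D c1 i)).

(** Frame components of the curvature of the antiselfdual part of the connection, with
    o, h and S standing for the components of om, of the derivatives of gam and of
    the curvature terms in d om. *)
Definition asd_curv c c1 c2 r s : R :=
  - (S c r s + wedge_comp (o c1) (o c2) r s)
  + (wedge_comp (h c) Df r s + ga c * d_vcoframe c c1 c2 r s
     + (wedge_comp (h c1) (D c2) r s + ga c1 * d_hcoframe c2 c c1 r s
        - (wedge_comp (h c2) (D c1) r s + ga c2 * d_hcoframe c1 c2 c r s)))
  + wedge_comp (asd_form c1 c2 c) (asd_form c2 c c1) r s.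

(** Apart from the terms in S, the antiselfdual components form a multiple of the identity
    plus a skew matrix, whatever the values of o, h, al and p; the symmetric tracefree
    part is therefore that of - S. *)
Lemma asd_curv_sym c c1 c2 : cyclic c c1 c2 ->
  S c (base c2) (base c) + S c1 (base c1) (base c2) = 0 ->
  S c (base c1) (base c2) = S c1 (base c2) (base c) ->
  (asd_curv c c1 c2 fib (base c1) - asd_curv c c1 c2 (base c2) (base c))
  + (asd_curv c1 c2 c fib (base c) - asd_curv c1 c2 c (base c1) (base c2)) = 0 /\
  asd_curv c c1 c2 fib (base c) - asd_curv c c1 c2 (base c1) (base c2)
  = asd_curv c1 c2 c fib (base c1) - asd_curv c1 c2 c (base c2) (base c).
Proof.
move=> cyc S0 S1; have [n1 n2 n3] := cyclic_neq cyc.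
have Db k l : D k (base l) = (l == k)%:R by rewrite /D (inj_eq (@lshift_inj _ _)).
have Dfib k : D k fib = 0 by rewrite /D eq_rlshift.
have Dff : Df fib = 1 by rewrite /Df eqxx.
have Dfb k : Df (base k) = 0 by rewrite /Df eq_lrshift.
have m1 : (c1 == c) = false by rewrite eq_sym.
have m2 : (c2 == c1) = false by rewrite eq_sym.
have m3 : (c == c2) = false by rewrite eq_sym.
rewrite /asd_curv /asd_form /d_vcoframe /d_hcoframe /wedge_comp.
rewrite !Db !Dfib !Dff !Dfb !S_fib !o_fib !eqxx n1 n2 n3 m1 m2 m3 !mulr0n !mulr1n.
have -> : S c (base c2) (base c) = - S c1 (base c1) (base c2).
  by move/eqP: S0; rewrite addr_eq0 => /eqP.
rewrite S1 !gaE; clear.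
move: (S c1 (base c1) (base c2)) (S c1 (base c2) (base c)) => s1 s2.
move: (al c) (al c1) (al c2) (p c) (p c1) (p c2) => a0 a1 a2 p0 p1 p2.
move: (h c fib) (h c (base c)) (h c (base c1)) (h c (base c2)) => h1 h2 h3 h4.
move: (h c1 fib) (h c1 (base c)) (h c1 (base c1)) (h c1 (base c2)) => k1 k2 k3 k4.
move: (h c2 fib) (h c2 (base c)) (h c2 (base c1)) (h c2 (base c2)) => l1 l2 l3 l4.
move: (o c (base c)) (o c (base c1)) (o c (base c2)) => u1 u2 u3.
move: (o c1 (base c)) (o c1 (base c1)) (o c1 (base c2)) => v1 v2 v3.
move: (o c2 (base c)) (o c2 (base c1)) (o c2 (base c2)) => w1 w2 w3.
by split; field.
Qed.

End AsdCurvatureFrame.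

Section StructureEquations.
Context {R : realType}.
Variables (M : set 'rV[R]_(3 + 1)) (g E : 'rV[R]_(3 + 1) -> 'M[R]_(3 + 1))
  (e om : 'I_3 -> 'rV[R]_(3 + 1) -> 'rV[R]_(3 + 1)) (eta : 'rV[R]_(3 + 1) -> 'rV[R]_(3 + 1))
  (al p : 'I_3 -> 'rV[R]_(3 + 1) -> R) (Om : 'I_3 -> 'rV[R]_(3 + 1) -> 'M[R]_(3 + 1)).
Implicit Types (x : 'rV[R]_(3 + 1)).
Hypotheses (oM : open M) (gs : smooth_mx M g) (gT : forall x, M x -> (g x)^T = g x)
  (Es : smooth_mx M E) (oE : forall x, M x -> orthoframe (g x) (E x)).
Hypotheses (es : forall c, smooth_rV M (e c)) (oms : forall c, smooth_rV M (om c))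
  (etas : smooth_rV M eta) (als : forall c, smooth M (al c)) (ps : forall c, smooth M (p c)).
Hypotheses (coframe_base : forall c j x, M x -> coframe g E x (base c) j = e c x 0 j)
  (coframe_fib : forall j x, M x -> coframe g E x fib j = eta x 0 j).
Hypotheses
  (d_eta : forall x, M x -> ext_d eta x
    = - wedge (\sum_c (al c x + p c x) *: e c x) (eta x)
      + (p o0 x *: wedge (e o1 x) (e o2 x) + p o1 x *: wedge (e o2 x) (e o0 x)
         + p o2 x *: wedge (e o0 x) (e o1 x)))
  (d_e : forall c c1 c2 x, cyclic c c1 c2 -> M x -> ext_d (e c) x
    = - wedge (om c2 x) (e c1 x) + wedge (om c1 x) (e c2 x)
      - wedge (\sum_c al c x *: e c x) (e c x))
  (d_om : forall c c1 c2 x, cyclic c c1 c2 -> M x ->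
    ext_d (om c) x = Om c x + wedge (om c1 x) (om c2 x)).

Definition uform c x : 'rV[R]_(3 + 1) :=
  - ((p c x + al c x) *: eta x + 2^-1 *: cross (p ^~ x) (e ^~ x) c).
Definition vform c x : 'rV[R]_(3 + 1) :=
  om c x + (cross (al ^~ x) (e ^~ x) c - (2^-1 * p c x) *: eta x).

(** The Levi-Civita connection matrix of the metric sum_c e_c^2 + eta^2, with the forms
    vform in positions (c+1, c+2) and uform in positions (fib, c). *)
Definition lc_conn (i : 'I_(3 + 1)) x : 'M[R]_(3 + 1) :=
  block_mx (star1 1%:M (\row_c vform c x 0 i)) (- (\row_c uform c x 0 i)^T)
    (\row_c uform c x 0 i) 0.

Lemma cyclic_ex c : exists c1 c2, cyclic c c1 c2.
Proof. by elim/ord3P: c; [exists o1, o2|exists o2, o0|exists o0, o1]; constructor. Qed.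

Lemma lc_connE c c1 c2 i x : cyclic c c1 c2 ->
  [/\ lc_conn i x (base c1) (base c2) = vform c x 0 i,
      lc_conn i x (base c2) (base c1) = - vform c x 0 i &
      lc_conn i x (base c) (base c) = 0] /\
  [/\ lc_conn i x fib (base c) = uform c x 0 i,
      lc_conn i x (base c) fib = - uform c x 0 i & lc_conn i x fib fib = 0].
Proof.
move=> cyc; have [s12 s21 s0] := star1_cyclic (\row_c vform c x 0 i) cyc.
have rowE (f : 'I_3 -> R) k : (\row_c f c) 0 k = f k by rewrite mxE.
have colE (f : 'I_3 -> R) k : (- (\row_c f c)^T) k 0 = - f k by rewrite !mxE.
rewrite /lc_conn !block_mxEul !block_mxEur block_mxEdl block_mxEdr s12 s21 s0 !rowE colE.
by split; split=> //; rewrite mxE.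
Qed.

Lemma smooth_cross (q : 'I_3 -> 'rV[R]_(3 + 1) -> R) c :
  (forall k, smooth M (q k)) -> smooth_rV M (fun x => cross (q ^~ x) (e ^~ x) c).
Proof.
move=> qs; have [c1 [c2 cyc]] := cyclic_ex c.
have := smooth_rVD oM (smooth_rVZ oM (qs c1) (es c2)) (smooth_rVN oM (smooth_rVZ oM (qs c2) (es c1))).
move=> + i => /(_ i); apply: (smooth_eq_on oM) => y _.
by rewrite (crossE _ _ cyc).
Qed.

Lemma smooth_uform c : smooth_rV M (uform c).
Proof.
have := smooth_rVN oM (smooth_rVD oM (smooth_rVZ oM (smoothD oM (ps c) (als c)) etas)
  (smooth_rVZ oM (@smooth_cst _ _ M 2^-1) (smooth_cross c ps))).
by [].
Qed.

Lemma smooth_vform c : smooth_rV M (vform c).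
Proof.
have := smooth_rVD oM (oms c) (smooth_rVD oM (smooth_cross c als)
  (smooth_rVN oM (smooth_rVZ oM (smoothM oM (@smooth_cst _ _ M 2^-1) (ps c)) etas))).
by [].
Qed.

(** The entries of a 4 by 4 matrix by position: diagonal, horizontal off-diagonal in
    either cyclic order, and the two borders. *)
Lemma index4_cases (P : 'I_(3 + 1) -> 'I_(3 + 1) -> Prop) :
  (forall c, P (base c) (base c)) ->
  (forall c c1 c2, cyclic c c1 c2 -> P (base c1) (base c2)) ->
  (forall c c1 c2, cyclic c c1 c2 -> P (base c2) (base c1)) ->
  (forall c, P fib (base c)) -> (forall c, P (base c) fib) -> P fib fib -> forall a b, P a b.
Proof.
move=> P0 P1 P2 P3 P4 P5; elim/ord4P => [a|]; elim/ord4P => [b|]; [|exact: P4|exact: P3|exact: P5].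
move: a b; elim/ord3P; elim/ord3P; try exact: P0.
- by apply: (P1 o2); constructor.
- by apply: (P2 o1); constructor.
- by apply: (P2 o2); constructor.
- by apply: (P1 o0); constructor.
- by apply: (P1 o1); constructor.
- by apply: (P2 o0); constructor.
Qed.

Lemma smooth_lc_conn i : smooth_mx M (lc_conn i).
Proof.
have pos c a b s (f : 'I_3 -> 'rV[R]_(3 + 1) -> 'rV[R]_(3 + 1)) : smooth_rV M (f c) ->
    (forall y, lc_conn i y a b = (-1) ^+ s * f c y 0 i) -> smooth M (fun y => lc_conn i y a b).
  move=> fs fE; have := smoothM oM (@smooth_cst _ _ M ((-1) ^+ s)) (fs i).
  by apply: (smooth_eq_on oM) => y _; rewrite fE.
apply: index4_cases => [c|c c1 c2 cyc|c c1 c2 cyc|c|c|].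
- have := @smooth_cst R _ M 0; apply: (smooth_eq_on oM) => y _.
  by have [c1 [c2 cyc]] := cyclic_ex c; have [[_ _ ->] _] := lc_connE i y cyc.
- apply: (pos c _ _ 0 vform (smooth_vform c)) => y; rewrite mul1r.
  by have [[-> _ _] _] := lc_connE i y cyc.
- apply: (pos c _ _ 1 vform (smooth_vform c)) => y; rewrite mulN1r.
  by have [[_ -> _] _] := lc_connE i y cyc.
- apply: (pos c _ _ 0 uform (smooth_uform c)) => y; rewrite mul1r.
  by have [c1 [c2 cyc]] := cyclic_ex c; have [_ [-> _ _]] := lc_connE i y cyc.
- apply: (pos c _ _ 1 uform (smooth_uform c)) => y; rewrite mulN1r.
  by have [c1 [c2 cyc]] := cyclic_ex c; have [_ [_ -> _]] := lc_connE i y cyc.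
- have := @smooth_cst R _ M 0; apply: (smooth_eq_on oM) => y _.
  have cyc : cyclic o0 o1 o2 by constructor.
  by have [_ [_ _ ->]] := lc_connE i y cyc.
Qed.

Lemma lc_conn_skew i x : (lc_conn i x)^T = - lc_conn i x.
Proof.
have [_ _ _ ST] := star1_1E (\row_c vform c x 0 i).
rewrite /lc_conn tr_block_mx ST opp_block_mx oppr0 trmx0 opprK; congr block_mx.
by rewrite linearN /= trmxK.
Qed.

Lemma lc_conn_compatible : compatible M (fun=> 0) lc_conn.
Proof. by move=> x i Mx; rewrite lc_conn_skew subrr mxE mulr0 raddf0. Qed.

Lemma uformE c c1 c2 i x : cyclic c c1 c2 -> uform c x 0 i
  = - ((p c x + al c x) * eta x 0 i + 2^-1 * (p c1 x * e c2 x 0 i - p c2 x * e c1 x 0 i)).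
Proof.
move=> cyc; rewrite /uform (crossE _ _ cyc).
by move: (eta x) (e c1 x) (e c2 x) => a b c'; rewrite !mxE.
Qed.

Lemma vformE c c1 c2 i x : cyclic c c1 c2 -> vform c x 0 i
  = om c x 0 i + (al c1 x * e c2 x 0 i - al c2 x * e c1 x 0 i - 2^-1 * p c x * eta x 0 i).
Proof.
move=> cyc; rewrite /vform (crossE _ _ cyc).
by move: (om c x) (eta x) (e c1 x) (e c2 x) => a b c' d; rewrite !mxE.
Qed.

(** The formulas for uform and vform are exactly the solution of the first structure
    equation with a skew connection matrix. *)
Lemma lc_conn_torsion_free : torsion_free M g E lc_conn.
Proof.
move=> x i j Mx b.
have mulE (P Q S : 'M[R]_(3 + 1)) r k : (P *m Q + S) r k
    = P r (base o0) * Q (base o0) k + P r (base o1) * Q (base o1) k + P r (base o2) * Q (base o2) k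
      + P r fib * Q fib k + S r k.
  by rewrite mxE [X in X + _]mxE sum4.
have dbE c k l : pd_mx k (coframe g E) x (base c) l = pd k (fun y => e c y 0 l) x.
  by rewrite [LHS]mxE; apply: (pd_eq_on k oM _ Mx) => y My; exact: coframe_base.
have dfE k l : pd_mx k (coframe g E) x fib l = pd k (fun y => eta y 0 l) x.
  by rewrite [LHS]mxE; apply: (pd_eq_on k oM _ Mx) => y My; exact: coframe_fib.
apply: etrans (mulE (lc_conn i x) (coframe g E x) (pd_mx i (coframe g E) x) b j) _.
apply: etrans _ (esym (mulE (lc_conn j x) (coframe g E x) (pd_mx j (coframe g E) x) b i)).
rewrite (coframe_base o0 j Mx) (coframe_base o1 j Mx) (coframe_base o2 j Mx) (coframe_fib j Mx).
rewrite (coframe_base o0 i Mx) (coframe_base o1 i Mx) (coframe_base o2 i Mx) (coframe_fib i Mx).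
have scE r (v : 'rV[R]_(3 + 1)) k : (r *: v) 0 k = r * v 0 k by rewrite mxE.
have sumE (q : 'I_3 -> R) k : (\sum_c q c *: e c x) 0 k
    = q o0 * e o0 x 0 k + q o1 * e o1 x 0 k + q o2 * e o2 x 0 k.
  by rewrite summxE sum3 !scE.
have cyc0 : cyclic o0 o1 o2 by constructor.
have cyc1 := cyclicS cyc0; have cyc2 := cyclicS cyc1.
move: b; elim/ord4P => [c|]; last first.
  have [_ [_ _ f0]] := lc_connE i x cyc0; have [_ [_ _ g0]] := lc_connE j x cyc0.
  rewrite (dfE i j) (dfE j i) f0 g0.
  have fE k c c1 c2 (cyc : cyclic c c1 c2) : lc_conn k x fib (base c) = uform c x 0 k.
    by have [_ [-> _ _]] := lc_connE k x cyc.
  rewrite !(fE _ _ _ _ cyc0) !(fE _ _ _ _ cyc1) !(fE _ _ _ _ cyc2).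
  rewrite (uformE i x cyc0) (uformE j x cyc0) (uformE i x cyc1) (uformE j x cyc1).
  rewrite (uformE i x cyc2) (uformE j x cyc2).
  have entry (P Q S T : 'M[R]_(3 + 1)) q r s : (- P + (q *: Q + r *: S + s *: T)) i j
     = - P i j + (q * Q i j + r * S i j + s * T i j) by rewrite !mxE.
  have := congr1 (fun m : 'M_(_) => m i j) (d_eta Mx).
  rewrite ext_dE entry !wedgeE !sumE.
  move: (pd i _ _) (pd j _ _) (eta x 0 i) (eta x 0 j) => d1 d2 ei ej.
  move: (e o0 x 0 i) (e o0 x 0 j) (e o1 x 0 i) (e o1 x 0 j) (e o2 x 0 i) (e o2 x 0 j).
  move: (al o0 x) (al o1 x) (al o2 x) (p o0 x) (p o1 x) (p o2 x) => *; lra.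
have [c1 [c2 cyc]] := cyclic_ex c.
have [[v12 v21 v0] [_ uf _]] := lc_connE i x cyc; have [[w12 w21 z0] [_ wf _]] := lc_connE j x cyc.
have [[_ v1c _] _] := lc_connE i x (cyclicS cyc); have [[_ w1c _] _] := lc_connE j x (cyclicS cyc).
have [[v2c _ _] _] := lc_connE i x (cyclicS (cyclicS cyc)).
have [[w2c _ _] _] := lc_connE j x (cyclicS (cyclicS cyc)).
have rot (F : 'I_3 -> R) r : F o0 + F o1 + F o2 + r = F c + F c1 + F c2 + r.
  by rewrite -sum3 (cyclic_sum _ cyc).
rewrite (rot (fun k => lc_conn i x (base c) (base k) * e k x 0 j)).
rewrite (rot (fun k => lc_conn j x (base c) (base k) * e k x 0 i)).
rewrite (dbE c i j) (dbE c j i) v0 z0 uf wf v1c w1c v2c w2c !(uformE _ _ cyc).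
rewrite !(vformE _ _ (cyclicS cyc)) !(vformE _ _ (cyclicS (cyclicS cyc))).
have entry (P Q S : 'M[R]_(3 + 1)) : (- P + Q - S) i j = - P i j + Q i j - S i j by rewrite !mxE.
have := congr1 (fun m : 'M_(_) => m i j) (d_e cyc Mx).
have sumE' k : (\sum_c al c x *: e c x) 0 k
    = al c x * e c x 0 k + al c1 x * e c1 x 0 k + al c2 x * e c2 x 0 k.
  by rewrite summxE (cyclic_sum _ cyc) !scE.
rewrite ext_dE entry !wedgeE !sumE'.
move: (pd i _ _) (pd j _ _) (eta x 0 i) (eta x 0 j) => d1 d2 ei ej.
move: (e c x 0 i) (e c x 0 j) (e c1 x 0 i) (e c1 x 0 j) (e c2 x 0 i) (e c2 x 0 j).
move: (om c1 x 0 i) (om c1 x 0 j) (om c2 x 0 i) (om c2 x 0 j).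
move: (al c x) (al c1 x) (al c2 x) (p c x) (p c1 x) (p c2 x) => *; lra.
Qed.

Definition weyl_gam c x : R := - (al c x + 2^-1 * p c x).

(** The antiselfdual part of the connection; al and p enter it only through gam. *)
Definition sform c x : 'rV[R]_(3 + 1) :=
  - om c x + (weyl_gam c x *: eta x + cross (weyl_gam ^~ x) (e ^~ x) c).

Lemma smooth_weyl_gam c : smooth M (weyl_gam c).
Proof.
have := smoothN oM (smoothD oM (als c) (smoothM oM (@smooth_cst _ _ M 2^-1) (ps c))).
by [].
Qed.

Lemma sformE c x : sform c x = uform c x - vform c x.
Proof.
have [c1 [c2 cyc]] := cyclic_ex c; apply/rowP => i.
have entry (P Q : 'rV[R]_(3 + 1)) : (P - Q) 0 i = P 0 i - Q 0 i by rewrite !mxE.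
rewrite entry (uformE _ _ cyc) (vformE _ _ cyc) /sform (crossE _ _ cyc) /weyl_gam.
have entry2 (P Q S T : 'rV[R]_(3 + 1)) u v z : (- P + (u *: Q + (v *: S - z *: T))) 0 i
    = - P 0 i + (u * Q 0 i + (v * S 0 i - z * T 0 i)) by rewrite !mxE.
rewrite entry2.
move: (om c x 0 i) (eta x 0 i) (e c1 x 0 i) (e c2 x 0 i) => k1 k2 k3 k4.
by move: (al c x) (al c1 x) (al c2 x) (p c x) (p c1 x) (p c2 x) => *; lra.
Qed.

(** The antiselfdual part of the curvature is the curvature of the
    antiselfdual part of the connection, an SO(3)-connection. *)
Lemma curvature_lc_conn c c1 c2 i j x : cyclic c c1 c2 -> M x ->
  curvature_mx lc_conn i j x fib (base c) - curvature_mx lc_conn i j x (base c1) (base c2)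
  = (ext_d (sform c) x + wedge (sform c1 x) (sform c2 x)) i j.
Proof.
move=> cyc Mx.
have entry (P Q : 'M[R]_(3 + 1)) : (P + Q) i j = P i j + Q i j by rewrite !mxE.
have entrym (P Q : 'rV[R]_(3 + 1)) k : (P - Q) 0 k = P 0 k - Q 0 k by rewrite !mxE.
have dE k l : pd k (fun y => sform c y 0 l) x
    = pd k (fun y => uform c y 0 l) x - pd k (fun y => vform c y 0 l) x.
  rewrite -(pdB k (smooth_uform c l) (smooth_vform c l) Mx); congr (pd k _ x).
  by apply/funext => y; rewrite sformE entrym.
rewrite entry ext_dE wedgeE (dE i j) (dE j i) !sformE !entrym.
have du k l : pd_mx k (lc_conn l) x fib (base c) = pd k (fun y => uform c y 0 l) x.
  rewrite [LHS]mxE; congr (pd k _ x); apply/funext => y.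
  by have [_ [-> _ _]] := lc_connE l y cyc.
have dv k l : pd_mx k (lc_conn l) x (base c1) (base c2) = pd k (fun y => vform c y 0 l) x.
  rewrite [LHS]mxE; congr (pd k _ x); apply/funext => y.
  by have [[-> _ _] _] := lc_connE l y cyc.
have rot (F : 'I_(3 + 1) -> R) : \sum_k F k = F (base c) + F (base c1) + F (base c2) + F fib.
  rewrite sum4 -(sum3 (fun k => F (base k))).
  by rewrite (cyclic_sum (fun k => F (base k)) cyc).
have curvE (P Q S T : 'M[R]_(3 + 1)) r s : (P - Q + (S *m T - T *m S)) r s = P r s - Q r s
    + (S r (base c) * T (base c) s + S r (base c1) * T (base c1) s + S r (base c2) * T (base c2) s
       + S r fib * T fib s - (T r (base c) * S (base c) s + T r (base c1) * S (base c1) s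
       + T r (base c2) * S (base c2) s + T r fib * S fib s)).
  by rewrite !mxE !rot.
have curvE' r s := curvE (pd_mx i (lc_conn j) x) (pd_mx j (lc_conn i) x) (lc_conn i x) (lc_conn j x) r s.
apply: etrans (congr2 (fun a b => a - b) (curvE' fib (base c)) (curvE' (base c1) (base c2))) _.
rewrite (du i j) (du j i) (dv i j) (dv j i).
have cyc1 := cyclicS cyc; have cyc2 := cyclicS cyc1.
have [[a1 a2 a3] [a4 a5 a6]] := lc_connE i x cyc; have [[b1 b2 b3] [b4 b5 b6]] := lc_connE j x cyc.
have [[d1 d2 d3] [d4 d5 _]] := lc_connE i x cyc1; have [[f1 f2 f3] [f4 f5 _]] := lc_connE j x cyc1.
have [[k1 k2 k3] [k4 k5 _]] := lc_connE i x cyc2; have [[l1 l2 l3] [l4 l5 _]] := lc_connE j x cyc2.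
move: (lc_conn i x) (lc_conn j x) a1 a2 a3 a4 a5 a6 b1 b2 b3 b4 b5 b6 d1 d2 d3 d4 d5 f1 f2 f3 f4 f5
  k1 k2 k3 k4 k5 l1 l2 l3 l4 l5 => P Q.
move=> a1 a2 a3 a4 a5 a6 b1 b2 b3 b4 b5 b6 d1 d2 d3 d4 d5 f1 f2 f3 f4 f5 k1 k2 k3 k4 k5 l1 l2 l3 l4 l5.
rewrite a1 a3 a4 a6 b1 b3 b4 b6 d1 f1 d2 d3 d4 d5 f2 f3 f4 f5 k2 k3 k4 l2 l3 l4.
move: (pd i _ _) (pd j _ _) (pd i _ _) (pd j _ _) => e1 e2 e3 e4.
move: (uform c x 0 i) (uform c1 x 0 i) (uform c2 x 0 i) (uform c x 0 j) (uform c1 x 0 j) (uform c2 x 0 j).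
move: (vform c x 0 i) (vform c1 x 0 i) (vform c2 x 0 i) (vform c x 0 j) (vform c1 x 0 j) (vform c2 x 0 j).
move=> *; ring.
Qed.

Lemma ext_d_sform c c1 c2 x : cyclic c c1 c2 -> M x -> ext_d (sform c) x
  = - (Om c x + wedge (om c1 x) (om c2 x))
    + (wedge (dfun (weyl_gam c) x) (eta x) + weyl_gam c x *: ext_d eta x
       + (wedge (dfun (weyl_gam c1) x) (e c2 x) + weyl_gam c1 x *: ext_d (e c2) x
          - (wedge (dfun (weyl_gam c2) x) (e c1 x) + weyl_gam c2 x *: ext_d (e c1) x))).
Proof.
move=> cyc Mx; have gms := smooth_weyl_gam.
have t0 := smooth_rVZ oM (gms c) etas; have t1 := smooth_rVZ oM (gms c1) (es c2).
have t2 := smooth_rVZ oM (gms c2) (es c1); have t2N := smooth_rVN oM t2.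
have t12 := smooth_rVD oM t1 t2N; have omN := smooth_rVN oM (oms c).
have -> : sform c = (fun y => - om c y + (weyl_gam c y *: eta y
    + (weyl_gam c1 y *: e c2 y + - (weyl_gam c2 y *: e c1 y)))).
  by apply/funext => y; rewrite /sform (crossE _ _ cyc).
rewrite (ext_dD omN (smooth_rVD oM t0 t12) Mx) (ext_dN (oms c) Mx) (ext_dD t0 t12 Mx).
rewrite (ext_dD t1 t2N Mx) (ext_dN t2 Mx) (ext_dZ (gms c) etas Mx).
by rewrite (ext_dZ (gms c1) (es c2) Mx) (ext_dZ (gms c2) (es c1) Mx) (d_om cyc Mx).
Qed.

Definition frame_comp (a : 'I_3 -> 'rV[R]_(3 + 1) -> 'rV[R]_(3 + 1)) x c i : R :=
  (a c x *m (E x)^T) 0 i.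

Lemma asd_curv_frame c c1 c2 r s x : cyclic c c1 c2 -> M x ->
  (E x *m (ext_d (sform c) x + wedge (sform c1 x) (sform c2 x)) *m (E x)^T) r s
  = asd_curv (frame_comp om x) (frame_comp (fun c => dfun (weyl_gam c)) x)
      (fun c r s => (E x *m Om c x *m (E x)^T) r s) (al ^~ x) (p ^~ x) (weyl_gam ^~ x) c c1 c2 r s.
Proof.
move=> cyc Mx; have cyc1 := cyclicS cyc; have cyc2 := cyclicS cyc1.
rewrite (ext_d_sform cyc Mx) (d_eta Mx) (d_e cyc1 Mx) (d_e cyc2 Mx).
have -> : p o0 x *: wedge (e o1 x) (e o2 x) + p o1 x *: wedge (e o2 x) (e o0 x)
     + p o2 x *: wedge (e o0 x) (e o1 x)
   = p c x *: wedge (e c1 x) (e c2 x) + p c1 x *: wedge (e c2 x) (e c x)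
     + p c2 x *: wedge (e c x) (e c1 x).
  case: cyc => -> -> -> //; first by rewrite -[LHS]addrA [LHS]addrC.
  by rewrite [LHS]addrC [LHS]addrA.
pose fr X := (E x *m X *m (E x)^T) r s; rewrite -/(fr _).
pose ev (a : 'rV[R]_(3 + 1)) i := (a *m (E x)^T) 0 i.
have frD X Y : fr (X + Y) = fr X + fr Y by rewrite /fr mulmxDr mulmxDl mxE.
have frN X : fr (- X) = - fr X by rewrite /fr mulmxN mulNmx mxE.
have frZ k X : fr (k *: X) = k * fr X by rewrite /fr -scalemxAr -scalemxAl mxE.
have frW a b : fr (wedge a b) = ev a r * ev b s - ev b r * ev a s.
  by rewrite /fr wedge_congr wedgeE.
have evD a b i : ev (a + b) i = ev a i + ev b i by rewrite /ev mulmxDl mxE.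
have evN a i : ev (- a) i = - ev a i by rewrite /ev mulNmx mxE.
have evZ k a i : ev (k *: a) i = k * ev a i by rewrite /ev -scalemxAl mxE.
have evS q i : ev (\sum_k q k *: e k x) i = q c * ev (e c x) i + q c1 * ev (e c1 x) i
    + q c2 * ev (e c2 x) i by rewrite (cyclic_sum _ cyc) !evD !evZ.
have CK := coframeK (oE Mx); rewrite -/(coframe g E x) in CK.
have eve k i : ev (e k x) i = (i == base k)%:R.
  have -> : e k x = row (base k) (coframe g E x).
    by apply/rowP => j; rewrite [RHS]mxE coframe_base.
  by rewrite /ev -row_mul CK row1 mxE eqxx eq_sym.
have eveta i : ev (eta x) i = (i == fib)%:R.
  have -> : eta x = row fib (coframe g E x).
    by apply/rowP => j; rewrite [RHS]mxE coframe_fib.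
  by rewrite /ev -row_mul CK row1 mxE eqxx eq_sym.
have evom k i : frame_comp om x k i = ev (om k x) i by [].
have evh k i : frame_comp (fun c => dfun (weyl_gam c)) x k i = ev (dfun (weyl_gam k) x) i by [].
have frO k : (E x *m Om k x *m (E x)^T) r s = fr (Om k x) by [].
rewrite /asd_curv /asd_form /d_vcoframe /d_hcoframe /wedge_comp !evom !evh frO /sform.
rewrite (crossE _ _ cyc1) (crossE _ _ cyc2).
move: fr ev frD frN frZ frW evD evN evZ evS eve eveta {CK evom evh frO}.
move=> fr ev frD frN frZ frW evD evN evZ evS eve eveta.
rewrite !(frD, frN, frZ, frW) !(evD, evN, evZ) !evS !eve !eveta.
ring.
Qed.

Hypotheses (om_fib : forall c x, M x -> (om c x *m (E x)^T) 0 fib = 0)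
  (Om_fib : forall c i x, M x -> (E x *m Om c x *m (E x)^T) fib i = 0)
  (Om_sym : forall c c1 c2 x, cyclic c c1 c2 -> M x ->
    (E x *m Om c x *m (E x)^T) (base c2) (base c)
      + (E x *m Om c1 x *m (E x)^T) (base c1) (base c2) = 0 /\
    (E x *m Om c x *m (E x)^T) (base c1) (base c2)
      = (E x *m Om c1 x *m (E x)^T) (base c2) (base c)).

Let frame_curvE x a b r s : M x -> frame_curv g (fun=> 0) E x a b r s
  = (E x *m (\matrix_(i, j) curvature_mx lc_conn i j x a b) *m (E x)^T) r s.
Proof.
move=> Mx; rewrite /frame_curv; congr ((_ *m _ *m _) r s); apply/matrixP => i j.
have z : smooth_rV M (fun=> 0 : 'rV[R]_(3 + 1)).
  by move=> k; have := @smooth_cst R _ M 0; apply: (smooth_eq_on oM) => y _; rewrite mxE.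
have lc := connection_unique oM gs gT Es oE lc_conn_compatible lc_conn_torsion_free.
rewrite [LHS]mxE [RHS]mxE.
by rewrite (frame_curvature oM gs z Es oE smooth_lc_conn (fun k y My => lc k y My) i j Mx).
Qed.

Let asd_block_frame c c1 c2 n n1 n2 x : cyclic c c1 c2 -> cyclic n n1 n2 -> M x ->
  let F := asd_curv (frame_comp om x) (frame_comp (fun c => dfun (weyl_gam c)) x)
      (fun c r s => (E x *m Om c x *m (E x)^T) r s) (al ^~ x) (p ^~ x) (weyl_gam ^~ x) in
  asd_block (frame_curv g (fun=> 0) E x) c n
  = F c c1 c2 fib (base n) - F c c1 c2 (base n1) (base n2).
Proof.
move=> cyc cycn Mx /=; rewrite /asd_block (asd_comp_cyclic _ cycn) !(asd_comp_cyclic _ cyc).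
have inner r s : frame_curv g (fun=> 0) E x fib (base c) r s
    - frame_curv g (fun=> 0) E x (base c1) (base c2) r s
    = (E x *m (ext_d (sform c) x + wedge (sform c1 x) (sform c2 x)) *m (E x)^T) r s.
  rewrite !frame_curvE //.
  have frB (P Q : 'M[R]_(3 + 1)) : (E x *m P *m (E x)^T) r s - (E x *m Q *m (E x)^T) r s
     = (E x *m (P - Q) *m (E x)^T) r s by rewrite mulmxBr mulmxBl !mxE.
  rewrite frB; congr ((_ *m _ *m _) r s); apply/matrixP => i j.
  rewrite -(curvature_lc_conn i j cyc Mx) [LHS]mxE [X in X + _]mxE.
  by rewrite [X in _ + X]mxE [X in _ - X]mxE.
by rewrite !inner !(asd_curv_frame _ _ cyc Mx).
Qed.

(** By the symmetry assumed in Om_sym the antiselfdual block of the curvature operator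
    has no symmetric tracefree part. *)
Lemma structure_selfdual : selfdual_conformal M g.
Proof.
move=> x Mx; apply: (asd_part_weyl (oE Mx)) => a b n.
have cyc0 : cyclic o0 o1 o2 by constructor.
have cyc1 := cyclicS cyc0; have cyc2 := cyclicS cyc1.
have sym c c1 c2 : cyclic c c1 c2 ->
    asd_block (frame_curv g (fun=> 0) E x) c c1 + asd_block (frame_curv g (fun=> 0) E x) c1 c = 0 /\
    asd_block (frame_curv g (fun=> 0) E x) c c = asd_block (frame_curv g (fun=> 0) E x) c1 c1.
  move=> cyc; have cyc' := cyclicS cyc; have [S0 S1] := Om_sym cyc Mx.
  rewrite (asd_block_frame cyc cyc' Mx) (asd_block_frame cyc' cyc Mx).
  rewrite (asd_block_frame cyc cyc Mx) (asd_block_frame cyc' cyc' Mx).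
  apply: asd_curv_sym cyc S0 S1 => [k|k i|k].
  - exact: om_fib k x Mx.
  - exact: Om_fib k i x Mx.
  - by [].
have [off0 diag0] := sym _ _ _ cyc0; have [off1 diag1] := sym _ _ _ cyc1.
have [off2 _] := sym _ _ _ cyc2.
apply: frame_weyl_selfdual => [p' q r s|p' q r s|p' q r s|k l||].
- rewrite !frame_curvE //.
  have frN (P : 'M[R]_(3 + 1)) : - (E x *m P *m (E x)^T) r s = (E x *m (- P) *m (E x)^T) r s.
    by rewrite mulmxN mulNmx [RHS]mxE.
  rewrite frN; congr ((_ *m _ *m _) r s); apply/matrixP => i j; rewrite [LHS]mxE [RHS]mxE.
  rewrite [X in - X]mxE.
  have zT k y : M y -> lc_conn k y + (lc_conn k y)^T = (0 : R)%:M.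
    by move=> My; rewrite lc_conn_skew subrr raddf0.
  have := curvature_mx_skew i j oM smooth_lc_conn Mx zT.
  rewrite !pd_cst subrr raddf0 => /(congr1 (fun m : 'M_(_) => m p' q)).
  have entT (P : 'M[R]_(3 + 1)) : (P + P^T) p' q = P p' q + P q p' by rewrite !mxE.
  by rewrite entT [RHS]mxE => /eqP; rewrite addr_eq0 => /eqP.
- exact: frame_curv_skew.
- exact: (frame_curv_bianchi (fun=> 0) E oM gT Mx).
- by move: k l; elim/ord3P; elim/ord3P => // _; rewrite 1?addrC ?off0 ?off1 ?off2.
- exact: diag0.
- exact: diag1.
Qed.

End StructureEquations.

(** * Selfduality of the monopole metric *)

Section MonopoleWeyl.
Context {R : realType}.
Variables (B : set 'rV[R]_3) (gB : 'rV[R]_3 -> 'M[R]_3) (aB : 'rV[R]_3 -> 'rV[R]_3)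
  (w0 w1 : 'rV[R]_3 -> R) (A0 A1 : 'rV[R]_3 -> 'rV[R]_3) (M : set 'rV[R]_(3 + 1)).
Hypotheses (cmB : conformal_manifold B gB) (aBs : smooth_rV B aB)
  (ewB : einstein_weyl B gB aB)
  (monoB : affine_monopole B gB aB w0 w1 A0 A1) (oM : open M)
  (MB : image_pi M `<=` B)
  (wpos : forall x, M x -> 0 < affine_weight w0 w1 (fun y : 'rV[R]_(3 + 1) => y 0 fib) x).
Implicit Types (x : 'rV[R]_(3 + 1)).

Let t x : R := x 0 fib.
Let w : 'rV[R]_(3 + 1) -> R := affine_weight w0 w1 t.
Let g := affine_metric gB w0 w1 A0 A1 t.
Let lam (x : 'rV[R]_(3 + 1)) : R := 1.
Let theta := affine_theta A0 A1.
Let adM : adapted M g gB lam w theta := monopole_adapted cmB monoB oM MB wpos.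
Let BM x : M x -> B (pi x). Proof. by move=> Mx; apply: MB; exists x. Qed.
Let oB : open B. Proof. by case: cmB. Qed.
Let lift v : smooth B v -> smooth M (fun x => v (pi x)).
Proof. by move=> /(smooth_lsubmx oB); exact: smooth_subset. Qed.
Let E4 := monopole_frame gB w0 w1 A0 A1.

Lemma smooth_monopole_frame : smooth_mx M E4.
Proof.
have EBs i j : smooth M (fun x => base_frame gB (pi x) i j) := lift (smooth_base_frame cmB i j).
have E4E x : E4 x = block_mx (base_frame gB (pi x))
    (- (base_frame gB (pi x) *m (theta x)^T)) 0 (w x)%:M.
  by rewrite /E4 /monopole_frame /adapted_frame invr1 !scale1r.
elim/ord4P => [i|]; elim/ord4P => [j|].
- by have := EBs i j; apply: (smooth_eq_on oM) => y _; rewrite E4E block_mxEul.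
- have := smoothN oM (smooth_sum (index_enum 'I_3) oM
    (fun k (_ : true) => smoothM oM (EBs i k) (adapted_theta adM k))).
  apply: (smooth_eq_on oM) => y _; rewrite E4E block_mxEur [RHS]mxE [in RHS]mxE.
  by congr (- _); apply: eq_bigr => k _; rewrite [(theta y)^T _ _]mxE.
- by have := @smooth_cst R _ M 0; apply: (smooth_eq_on oM) => y _; rewrite E4E block_mxEdl mxE.
- have := adapted_rho adM; apply: (smooth_eq_on oM) => y _.
  by rewrite E4E block_mxEdr mxE eqxx mulr1n.
Qed.

(** The structure equations of the monopole coframe are those for which the selfduality
    criterion was established, with the Einstein-Weyl equation as its hypothesis on
    the curvature terms. *)
Lemma monopole_selfdual_conformal : selfdual_conformal M g.
Proof.
pose Om c x : 'M[R]_(3 + 1) := block_mx (base_curv gB aB c (pi x)) 0 0 0.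
have OmE c x : M x -> E4 x *m Om c x *m (E4 x)^T
    = block_mx (base_curv_frame gB aB c (pi x)) 0 0 0.
  move=> Mx; rewrite /Om /E4 /monopole_frame frame_horizontal_2form.
  by rewrite /= invr1 expr1n scale1r.
apply: (@structure_selfdual R M g E4 (hcoform gB) (hconn gB aB) (vcoform w0 w1 A0 A1)
  (weyl_comp gB aB) (mono_comp gB aB w0 w1 A0 A1) Om).
- exact: oM.
- exact: smooth_adapted adM.
- by move=> x Mx; exact: (adapted_symmetric adM Mx).
- exact: smooth_monopole_frame.
- by move=> x Mx; exact: (monopole_frame_ortho cmB monoB oM MB wpos Mx).
- by move=> c; exact: (smooth_hcoform cmB oM MB).
- by move=> c; exact: (smooth_hconn cmB aBs oM MB).
- exact: (smooth_vcoform cmB monoB oM MB wpos).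
- by move=> c; exact: (smooth_weyl_comp cmB aBs oM MB).
- by move=> c; exact: (smooth_mono_comp cmB aBs monoB oM MB wpos).
- by move=> c j x Mx; exact: (coframe_base cmB monoB oM MB wpos c j Mx).
- by move=> j x Mx; exact: (coframe_fib cmB monoB oM MB wpos j Mx).
- by move=> x Mx; exact: (ext_d_vcoform cmB monoB oM MB wpos Mx).
- move=> c c1 c2 x cyc Mx; rewrite -(pullback_weyl aB cmB MB Mx).
  exact: (ext_d_hcoform aB cmB MB cyc Mx).
- by move=> c c1 c2 x cyc Mx; exact: (ext_d_hconn aB cmB MB cyc Mx).
- move=> c x Mx; rewrite /hconn /pullback /E4 /monopole_frame row_mx_frame.
  by rewrite row_mxEr mxE.
- by move=> c i x Mx; rewrite OmE //; move: i; elim/ord4P => [i|]; rewrite ?block_mxEdl ?block_mxEdr mxE.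
- move=> c c1 c2 x cyc Mx; rewrite !OmE // !block_mxEul.
  exact: (base_curv_frame_sym cmB aBs ewB cyc (BM Mx)).
Qed.

End MonopoleWeyl.

(** * The correspondence *)

Theorem mainTheorem4 (R : realType) :
  (forall (M : set 'rV[R]_(3 + 1)) (g : 'rV[R]_(3 + 1) -> 'M[R]_(3 + 1))
      (B : set 'rV[R]_3) (gB : 'rV[R]_3 -> 'M[R]_3)
      (aB : 'rV[R]_3 -> 'rV[R]_3) (lam gam t : 'rV[R]_(3 + 1) -> R),
    conformal_submersion M B g gB lam ->
    selfdual_conformal M g ->
    selfdual_submersion M g ->
    affine_submersion M B g lam gam ->
    smooth_rV B aB ->
    induced_weyl M g lam aB ->
    einstein_weyl B gB aB ->
    affine_coordinate M gam t ->
    forall N : set 'rV[R]_(3 + 1), open N -> N `<=` M ->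
      (forall b : 'rV[R]_3, connected (N `&` [set x | lsubmx x = b])) ->
      exists (w0 w1 : 'rV[R]_3 -> R) (A0 A1 : 'rV[R]_3 -> 'rV[R]_3),
        affine_monopole [set (lsubmx x : 'rV[R]_3) | x in N] gB aB w0 w1 A0 A1 /\
        forall x, N x ->
          0 < affine_weight w0 w1 t x /\
          g x = lam x ^+ 2 *: affine_metric gB w0 w1 A0 A1 t x)
  /\
  (forall (B : set 'rV[R]_3) (gB : 'rV[R]_3 -> 'M[R]_3)
      (aB : 'rV[R]_3 -> 'rV[R]_3)
      (w0 w1 : 'rV[R]_3 -> R) (A0 A1 : 'rV[R]_3 -> 'rV[R]_3)
      (M : set 'rV[R]_(3 + 1)),
    conformal_manifold B gB ->
    smooth_rV B aB ->
    einstein_weyl B gB aB ->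
    affine_monopole B gB aB w0 w1 A0 A1 ->
    let t := fun x : 'rV[R]_(3 + 1) => x 0 fib in
    let piM := [set (lsubmx x : 'rV[R]_3) | x in M] in
    open M -> piM `<=` B ->
    (forall x, M x -> 0 < affine_weight w0 w1 t x) ->
    let g := affine_metric gB w0 w1 A0 A1 t in
    let lam := fun=> 1 : R in
    [/\ selfdual_conformal M g,
        conformal_submersion M piM g gB lam,
        forall x, M x ->
          (forall X, horizontal g x X <-> X *m (affine_form A0 A1 t x)^T = 0) /\
          rel_scale g lam x = affine_weight w0 w1 t x,
        exists gam, affine_submersion M piM g lam gam &
        selfdual_submersion M g /\ induced_weyl M g lam aB]).
Proof.
split.
- move=> M g B gB aB lam gam t csM _ _ affM _ iwM _ tM N oN NM cN.
  exact: monopole_direct csM affM iwM tM N oN NM cN.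
move=> B gB aB w0 w1 A0 A1 M cmB aBs ewB monoB t piM oM MB wpos g lam.
split.
- exact: (monopole_selfdual_conformal cmB aBs ewB monoB oM MB wpos).
- exact: (monopole_conformal_submersion cmB monoB oM MB wpos).
- move=> x Mx; split; first by move=> X; exact: (horizontalP gB A0 A1 wpos X Mx).
  exact: (monopole_rel_scale cmB monoB oM MB wpos Mx).
- by exists (fun=> 0); exact: (monopole_affine_submersion cmB monoB oM MB wpos).
- split; first exact: (monopole_selfdual_submersion cmB monoB oM MB wpos).
  exact: (monopole_induced_weyl cmB monoB oM MB wpos).
Qed.
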